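(* Let $\mu$ be a probability measure on $\mathbb{R}^n$ that is log-concave with respect to $\gamma_n$. Then, for any measurable functions $f,g:\mathbb{R}^n\to[0,\infty)$ and any measurable, non-decreasing function $W:[0,\infty)\to(0,\infty)$ satisfying $$f(x)^{1/2}g(y)^{1/2}\le W\Big(\frac{|x-y|}{2}\Big)\qquad\text{for all }x,y\in\mathbb{R}^n,$$ one has $$\Big(\int_{\mathbb{R}^n}f\,d\mu\Big)^{1/2}\Big(\int_{\mathbb{R}^n}g\,d\mu\Big)^{1/2}\le\int_{\mathbb{R}}W(|r|)\,d\gamma(r).$$
   Context: $\gamma_n$ is the standard Gaussian probability measure on $\mathbb{R}^n$, $d\gamma_n(x)=(2\pi)^{-n/2}e^{-|x|^2/2}dx$, and $\gamma=\gamma_1$. A probability measure $\mu$ on $\mathbb{R}^n$ is log-concave with respect to $\gamma_n$ if $d\mu=\varphi\,d\gamma_n$ for some log-concave function $\varphi:\mathbb{R}^n\to[0,\infty)$, i.e. $\varphi((1-t)x+ty)\ge\varphi(x)^{1-t}\varphi(y)^t$ for all $x,y\in\mathbb{R}^n$ and $t\in(0,1)$. $|\cdot|$ is the Euclidean norm; measurable means Borel measurable. *)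

(* Defs.v *)
From HB Require Import structures.
From mathcomp Require Import all_boot all_order all_algebra.
From mathcomp Require Import all_classical all_reals all_analysis.
From mathcomp Require Import measurable_realfun.

Set Implicit Arguments.
Unset Strict Implicit.
Unset Printing Implicit Defensive.

Import Order.TTheory GRing.Theory Num.Theory.
Import numFieldNormedType.Exports.

Local Open Scope classical_set_scope.
Local Open Scope ring_scope.

(* The Borel sigma-algebra, for the library topology on ['M[R]_(m, n)]: that of
   the sup norm, hence also that of the Euclidean norm. *)
HB.instance Definition _ (R : realType) (m n : nat) :=
  @isMeasurable.Build (sigma_display (@open 'M[R]_(m, n))) 'M[R]_(m, n)
    <<s @open 'M[R]_(m, n) >>
    (@sigma_algebra0 _ setT _) (@sigma_algebraC _ _)
    (@sigma_algebra_bigcup _ setT _).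

Section borel_rV.
Context {R : realType}.

Lemma open_measurable_mx m n (U : set 'M[R]_(m, n)) : open U -> measurable U.
Proof. exact: sub_sigma_algebra. Qed.

Lemma continuous_measurable_mx m n (f : 'M[R]_(m, n) -> R) :
  continuous f -> measurable_fun setT f.
Proof.
move=> /continuousP cf; apply: (measurability _ (RGenOpens.measurableE R)).
move=> _ [_ [a [b ->] <-]]; rewrite setTI; apply: open_measurable_mx.
exact/cf/interval_open.
Qed.

Lemma measurable_coord m n i j :
  measurable_fun [set: 'M[R]_(m, n)] (fun v : 'M[R]_(m, n) => v i j).
Proof.
apply: continuous_measurable_mx; exact: coord_continuous.
Qed.

Lemma measurable_fun_mx d (T : measurableType d) m n (f : T -> 'M[R]_(m, n)) :
  (forall i j, measurable_fun setT (fun t => f t i j)) ->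
  measurable_fun setT f.
Proof.
move=> mf; apply: (measurability (@open 'M[R]_(m, n))) => // _ [U oU <-].
rewrite setTI.
pose B (k : 'M[rat]_(m, n) * rat) : set 'M[R]_(m, n) :=
  [set v | forall i j, ball (ratr (k.1 i j) : R) (ratr k.2) (v i j)].
have -> : f @^-1` U = \bigcup_(k in [set k | B k `<=` U]) (f @^-1` (B k)).
  apply/seteqP; split => [t Ut|t [k kU Bt]]; last exact: kU.
  have /nbhs_ballP[e /= e0 eU] : nbhs (f t) U by exact: open_nbhs_nbhs.
  have /rat_in_itvoo[r] : (0 : R) < e / 2 by rewrite divr_gt0.
  rewrite in_itv /= => /andP[r0 re].
  have q_ex i j : exists q : rat, ball (f t i j) (ratr r) (ratr q : R).
    have /rat_in_itvoo[q] : f t i j - ratr r < f t i j + ratr r.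
      by rewrite ltrD2l gtrN.
    rewrite in_itv /= => /andP[q1 q2]; exists q.
    by rewrite /ball /= ltr_distlC q1 q2.
  pose q := \matrix_(i, j) projT1 (cid (q_ex i j)).
  have qP i j : ball (f t i j) (ratr r) (ratr (q i j) : R).
    by rewrite mxE; exact: (projT2 (cid (q_ex i j))).
  exists (q, r); last by move=> i j /=; exact: ball_sym.
  move=> v /= vq; apply: eU; split => // i j.
  have re2 : ratr r <= e / 2 by exact: ltW.
  exact: (ball_split (le_ball re2 (qP i j)) (le_ball re2 (vq i j))).
rewrite (_ : \bigcup_(k in _) _ =
    \bigcup_k (if `[< B k `<=` U >] then f @^-1` (B k) else set0)); last first.
  apply/seteqP; split => [t [k kU Bt]|t [k _]].
    by exists k => //; rewrite asboolT.
  by case: asboolP => // kU Bt; exists k.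
apply: countable_bigcupT_measurable; first exact: countableP.
move=> k; case: ifP => // _.
rewrite (_ : f @^-1` B k = \bigcap_(i in setT) \bigcap_(j in setT)
   ((fun t => f t i j) @^-1` ball (ratr (k.1 i j) : R) (ratr k.2))); last first.
  apply/seteqP; split => [t Bt i _ j _|t Bt i j]; first exact: Bt.
  exact: Bt.
apply: fin_bigcap_measurable => // i _; apply: fin_bigcap_measurable => // j _.
by rewrite -[X in measurable X]setTI; apply: mf => //; exact: measurable_ball.
Qed.

End borel_rV.

Section lebesgue_rV.
Context {R : realType}.

Definition rV_cons n (p : measurableTypeR R * 'rV[R]_n) : 'rV[R]_n.+1 :=
  row_mx p.1%:M p.2.

Definition rV_uncons n (v : 'rV[R]_n.+1) : measurableTypeR R * 'rV[R]_n :=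
  (v 0 ord0, \row_i v 0 (lift ord0 i)).

Lemma rV_cons0 n (p : measurableTypeR R * 'rV[R]_n) :
  rV_cons p 0 ord0 = p.1.
Proof.
rewrite /rV_cons (_ : ord0 = @lshift 1 n ord0); last exact/val_inj.
by apply: etrans (row_mxEl _ _ _ _) _; rewrite mxE eqxx.
Qed.

Lemma rV_consS n (p : measurableTypeR R * 'rV[R]_n) i :
  rV_cons p 0 (lift ord0 i) = p.2 0 i.
Proof.
rewrite /rV_cons (_ : lift ord0 i = @rshift 1 n i); last exact/val_inj.
exact: row_mxEr.
Qed.

Lemma rV_consK n : cancel (@rV_cons n) (@rV_uncons n).
Proof.
move=> [x v]; congr pair; first by rewrite rV_cons0.
by apply/rowP => i; rewrite mxE rV_consS.
Qed.

Lemma measurable_rV_cons n : measurable_fun setT (@rV_cons n).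
Proof.
apply: measurable_fun_mx => i j; rewrite ord1.
case: (unliftP ord0 j) => [k|] ->.
  under eq_fun do rewrite rV_consS.
  exact: (measurableT_comp (@measurable_coord R 1 n 0 k) measurable_snd).
under eq_fun do rewrite rV_cons0; exact: measurable_fst.
Qed.

Lemma measurable_rV_uncons n : measurable_fun setT (@rV_uncons n).
Proof.
apply/measurable_fun_pairP; split; first exact: measurable_coord.
apply: measurable_fun_mx => i j.
rewrite (_ : (fun _ => _) = (fun v : 'rV[R]_n.+1 => v 0 (lift ord0 j))).
  exact: measurable_coord.
by apply/funext => v; rewrite ord1 /= mxE.
Qed.

Section step.
Context n (mu : {sigma_finite_measure set 'rV[R]_n -> \bar R}).

Definition lebesgue_rV_step : set 'rV[R]_n.+1 -> \bar R :=
  pushforward (lebesgue_measure \x mu)%E (@rV_cons n).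

Let mcons := @measurable_rV_cons n.

Let step0 : lebesgue_rV_step set0 = 0%E.
Proof. exact: measure0. Qed.

Let step_ge0 A : (0 <= lebesgue_rV_step A)%E.
Proof. exact: measure_ge0. Qed.

Let step_sigma_additive : semi_sigma_additive lebesgue_rV_step.
Proof. exact: measure_semi_sigma_additive. Qed.

HB.instance Definition _ := isMeasure.Build _ _ _ lebesgue_rV_step
  step0 step_ge0 step_sigma_additive.

Lemma lebesgue_rV_step_sigma_finite : sigma_finite setT lebesgue_rV_step.
Proof.
have /sigma_finiteP[F [FT ndF Foo]] := sigma_finiteT (@lebesgue_measure R).
have /sigma_finiteP[G [GT ndG Goo]] := sigma_finiteT mu.
exists (fun k => @rV_uncons n @^-1` (F k `*` G k)).
  apply/seteqP; split => // v _.
  have [i _ Fi] : (\bigcup_i F i) (rV_uncons v).1 by rewrite -FT.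
  have [j _ Gj] : (\bigcup_i G i) (rV_uncons v).2 by rewrite -GT.
  exists (maxn i j) => //; split.
    by move: Fi; exact/subsetPset/ndF/leq_maxl.
  by move: Gj; exact/subsetPset/ndG/leq_maxr.
move=> k; have [mF Fk] := Foo k; have [mG Gk] := Goo k; split.
  rewrite -[X in measurable X]setTI; apply: measurable_rV_uncons => //.
  exact: measurableX.
rewrite /lebesgue_rV_step /pushforward -comp_preimage.
rewrite (_ : _ \o _ = id); last by apply/funext => p /=; rewrite rV_consK.
by rewrite preimage_id product_measure1E// lte_mul_pinfty// ge0_fin_numE.
Qed.

HB.instance Definition _ := @Measure_isSigmaFinite.Build _ _ _
  lebesgue_rV_step lebesgue_rV_step_sigma_finite.

End step.

(* Lebesgue measure on R^n, built by iterating the product with the Lebesgue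
   measure on R; [lebesgue_rV_box] is its characteristic property. *)
Fixpoint lebesgue_rV n : {sigma_finite_measure set 'rV[R]_n -> \bar R} :=
  match n with
  | 0 => dirac (0 : 'rV[R]_0)
  | n.+1 => lebesgue_rV_step (lebesgue_rV n)
  end.

Lemma measurable_box n (A : 'I_n -> set R) : (forall i, measurable (A i)) ->
  measurable [set v : 'rV[R]_n | forall i, A i (v 0 i)].
Proof.
move=> mA; rewrite (_ : mkset _ = \bigcap_(i in setT)
   ((fun v : 'rV[R]_n => v 0 i) @^-1` A i)); last first.
  by apply/seteqP; split => [v Av i _|v Av i]; exact: Av.
apply: fin_bigcap_measurable => // i _.
by rewrite -[X in measurable X]setTI; exact: measurable_coord.
Qed.

Lemma lebesgue_rV_box n (A : 'I_n -> set R) : (forall i, measurable (A i)) ->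
  lebesgue_rV n [set v | forall i, A i (v 0 i)] =
  (\prod_(i < n) lebesgue_measure (A i))%E.
Proof.
elim: n A => [|n IH] A mA.
  rewrite big_ord0 /= diracE mem_set//= => -[]//.
rewrite big_ord_recl /= /lebesgue_rV_step /pushforward -IH//.
rewrite -product_measure1E; [|exact: mA|
  exact: (@measurable_box n (fun i => A (lift ord0 i)))].
congr ((_ \x _)%E _); apply/seteqP; split => [p /= Av|p /= [Ax Av] i].
  by split=> [|i]; [rewrite -rV_cons0|rewrite -rV_consS].
by case: (unliftP ord0 i) => [k|] ->; [rewrite rV_consS|rewrite rV_cons0].
Qed.

End lebesgue_rV.
Arguments lebesgue_rV R n : clear implicits.

Section gaussian.
Context {R : realType}.

(* The library norm [`|x|] on ['rV[R]_n] is the sup norm. *)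
Definition enorm n (x : 'rV[R]_n) : R := Num.sqrt (\sum_(i < n) x 0 i ^+ 2).

Definition gaussian_pdf n (x : 'rV[R]_n) : R :=
  (2 * pi) `^ (- (n%:R / 2)) * expR (- (enorm x ^+ 2 / 2)).

Definition gaussian n : set 'rV[R]_n -> \bar R :=
  fun A => (\int[lebesgue_rV R n]_(x in A) (gaussian_pdf x)%:E)%E.

Lemma gaussian_pdf_ge0 n (x : 'rV[R]_n) : 0 <= gaussian_pdf x.
Proof. by rewrite mulr_ge0 ?powR_ge0 ?expR_ge0. Qed.

Lemma enorm_sqr n (x : 'rV[R]_n) : enorm x ^+ 2 = \sum_(i < n) x 0 i ^+ 2.
Proof. by rewrite sqr_sqrtr// sumr_ge0// => i _; rewrite sqr_ge0. Qed.

Lemma measurable_gaussian_pdf n :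
  measurable_fun setT (@gaussian_pdf n).
Proof.
apply: measurable_funM => //; apply: measurableT_comp => //.
apply: measurableT_comp => //; apply: measurable_funM => //.
under eq_fun do rewrite enorm_sqr.
apply: measurable_sum => i; apply: measurable_funX; exact: measurable_coord.
Qed.

Lemma gaussian_pdf_cons n (p : R * 'rV[R]_n) :
  gaussian_pdf (rV_cons p) = normal_pdf 0 1 p.1 * gaussian_pdf p.2.
Proof.
rewrite normal_pdfE ?oner_neq0// /normal_peak /normal_fun /gaussian_pdf.
rewrite mulrACA -expRD !enorm_sqr big_ord_recl; congr (_ * expR _).
  rewrite expr1n mul1r -[pi *+ 2]mulr_natl -powR12_sqrt.
    rewrite -powRN -powRD.
      by congr (_ `^ _); rewrite -natr1 mulrDl opprD addrC mul1r.
    by apply/implyP => _; rewrite mulf_neq0// gt_eqF// pi_gt0.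
  by rewrite mulr_ge0// pi_ge0.
rewrite subr0 expr1n rV_cons0 mulrDl opprD -mulNr; congr (_ - _ / _).
by apply: eq_bigr => i _; rewrite rV_consS.
Qed.

Lemma integral_gaussian_pdf n :
  (\int[lebesgue_rV R n]_x (gaussian_pdf x)%:E = 1)%E.
Proof.
elim: n => [|n IH].
  rewrite integral_dirac//=; last first.
    by apply/measurable_EFinP; exact: measurable_gaussian_pdf.
  rewrite diracE in_setT mul1e /gaussian_pdf mul0r oppr0 powRr0.
  by rewrite enorm_sqr big_ord0 mul0r oppr0 expR0 mulr1.
rewrite /= ge0_integral_pushforward//=; last 3 first.
- exact: measurable_rV_cons.
- by apply/measurable_EFinP; exact: measurable_gaussian_pdf.
- by move=> x _; rewrite lee_fin gaussian_pdf_ge0.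
under eq_integral do rewrite /= gaussian_pdf_cons.
rewrite fubini_tonelli1//=; last 2 first.
- apply/measurable_EFinP; apply: measurable_funM.
    exact: (measurableT_comp (measurable_normal_pdf 0 1) measurable_fst).
  exact: (measurableT_comp (@measurable_gaussian_pdf n) measurable_snd).
- by move=> x; rewrite lee_fin mulr_ge0 ?normal_pdf_ge0 ?gaussian_pdf_ge0.
rewrite -[RHS](integral_normal_pdf 0 1); apply: eq_integral => x _.
rewrite /fubini_F /=; under eq_integral do rewrite EFinM.
rewrite ge0_integralZl//= ?IH ?mule1 ?lee_fin ?normal_pdf_ge0//.
- by apply/measurable_EFinP; exact: measurable_gaussian_pdf.
- by move=> y _; rewrite lee_fin gaussian_pdf_ge0.
Qed.

Let gaussian0 n : @gaussian n set0 = 0%E.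
Proof. by rewrite /gaussian integral_set0. Qed.

Let gaussian_ge0 n A : (0 <= @gaussian n A)%E.
Proof. by apply: integral_ge0 => x _; rewrite lee_fin gaussian_pdf_ge0. Qed.

Let gaussian_sigma_additive n : semi_sigma_additive (@gaussian n).
Proof.
apply: semi_sigma_additive_nng_induced => [|x].
  by apply/measurable_EFinP; exact: measurable_gaussian_pdf.
by rewrite lee_fin gaussian_pdf_ge0.
Qed.

HB.instance Definition _ n := isMeasure.Build _ _ _ (@gaussian n)
  (@gaussian0 n) (@gaussian_ge0 n) (@gaussian_sigma_additive n).

Let gaussian_setT n : @gaussian n setT = 1%E.
Proof. exact: integral_gaussian_pdf. Qed.

HB.instance Definition _ n :=
  @Measure_isProbability.Build _ _ R (@gaussian n) (@gaussian_setT n).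

(* [0 `^ s = 0] for [s != 0], so zeros of [phi] are handled as usual. *)
Definition log_concave n (phi : 'rV[R]_n -> R) :=
  (forall x, 0 <= phi x) /\
  forall x y t, 0 < t < 1 ->
    phi x `^ (1 - t) * phi y `^ t <= phi ((1 - t) *: x + t *: y).

Definition log_concave_wrt_gaussian n (mu : set 'rV[R]_n -> \bar R) :=
  exists phi : 'rV[R]_n -> R,
    [/\ log_concave phi, measurable_fun setT phi &
        forall A, measurable A ->
          mu A = (\int[@gaussian n]_(x in A) (phi x)%:E)%E].

End gaussian.
Arguments gaussian R n : clear implicits.

(* Main.v *)
From HB Require Import structures.
Require Import Defs.
From mathcomp Require Import all_boot all_order all_algebra.
From mathcomp Require Import all_classical all_reals all_analysis.
From mathcomp Require Import measurable_realfun ring lra.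

Set Implicit Arguments.
Unset Strict Implicit.
Unset Printing Implicit Defensive.

Import Order.TTheory GRing.Theory Num.Theory.
Import numFieldNormedType.Exports.

Local Open Scope classical_set_scope.
Local Open Scope ring_scope.

(* The inequality is proved by localization, by induction on the dimension.
   Suppose it fails for a measure that is strongly log-concave.  Bisecting
   repeatedly by hyperplanes through the points of a fine planar grid, chosen so
   that each piece keeps the ratio of the two integrals, one always finds a piece
   on which it still fails; the final piece is convex and, avoiding the grid in
   its interior, lies in a thin slab.  Integrating out the thin direction (after
   a rotation) preserves strong log-concavity by Prekopa-Leindler and the
   hypothesis up to a small shift of [W], which contradicts the inequality in
   one dimension less.  On the line the measure is the image of the Gaussian
   under a 1-Lipschitz increasing map, and the inequality is Prekopa-Leindler
   applied to [f] and to the reflection of [g]. *)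

(** * Lebesgue measure on the line *)

(** The failed inequality is quadratic in the integrals, so it need not pass to a half. With
    [r ^+ 2 = Rint p / Rint q] it becomes [Rint p = r ^+ 2 * Rint q] and
    [K * Rint psi < r * Rint q], both linear: a cut that balances the first leaves the second true
    on at least one side. A line through a prescribed grid point has one degree of freedom, just
    enough for the balance; so each step works in a coordinate plane, and dimensions 0 and 1 are
    treated apart.

    The functions travel as weights [p = f * psi] and [q = g * psi]; the hypothesis then bounds
    [p x * q y] by a multiple of [psi x * psi y], a form that survives integration over pairs of
    fibres.

    A finite grid leaves slabs of positive width, so the induction proves a version with weight
    [W (r + e)]; every dimension removed spends half of the remaining [e], and [e] tends to 0 at the
    end. Finite grids, finite marginals and that limit rely on a bounded density, a bounded [W] and
    a bounded support; the general case is then recovered by truncation. *)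

Definition image_measure d d' (T1 : measurableType d) (T2 : measurableType d')
    (R : realFieldType) (m : {measure set T1 -> \bar R}) (f : T1 -> T2)
    (mf : measurable_fun setT f) : {measure set T2 -> \bar R} :=
  measure_function_pushforward__canonical__measure_function_Measure m mf.

Section line.
Context {R : realType}.
Local Notation leb := (@lebesgue_measure R).
Implicit Types (A B C : set R) (f g h : R -> R).

(** The image of Lebesgue measure under [a * x + b], scaled by [a], gives []u, v]] its length, so it
    is Lebesgue measure by uniqueness. *)
Lemma ge0_integral_affine (F : R -> \bar R) (a b : R) : 0 < a ->
  measurable_fun setT F -> (forall x, 0 <= F x)%E ->
  (a%:E * \int[leb]_x F (a * x + b)%R = \int[leb]_x F x)%E.
Proof.
move=> a0 mF F0.
pose phi : measurableTypeR R -> measurableTypeR R := fun x => a * x + b.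
have mphi : measurable_fun setT phi.
  by apply: measurable_funD => //; exact: measurable_funM.
pose k : {nonneg R} := NngNum (ltW a0).
pose nu := mscale k (image_measure leb mphi).
have -> : (\int[leb]_x F x = \int[nu]_x F x)%E.
  apply: eq_measure_integral => A mA _; apply: lebesgue_measure_unique => //.
  move=> _ [[u v]] _ <-; rewrite /nu /= /mscale/= /pushforward.
  have -> : phi @^-1` `]u, v] = `](u - b) / a, (v - b) / a]%classic.
    apply/seteqP; split => x /=; rewrite /phi !in_itv/= ltr_pdivrMr//;
      rewrite ler_pdivlMr// -ltrBlDr// -lerBrDr// [x * a]mulrC; lra.
  rewrite !lebesgue_measure_itv/= !lte_fin ltr_pM2r ?invr_gt0// ltrD2r.
  case: ifPn => uv; last by rewrite mule0.
  rewrite -!EFinD -EFinM; congr EFin.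
  by field; rewrite gt_eqF.
rewrite ge0_integral_mscale//= ge0_integral_pushforward//.
Qed.

Lemma ge0_integral_shift (F : R -> \bar R) (b : R) :
  measurable_fun setT F -> (forall x, 0 <= F x)%E ->
  (\int[leb]_x F (x + b)%R = \int[leb]_x F x)%E.
Proof.
move=> mF F0; rewrite -(ge0_integral_affine b ltr01 mF F0) mul1e.
by under [RHS]eq_integral do rewrite mul1r.
Qed.

Lemma ge0_integral_opp (F : R -> \bar R) :
  measurable_fun setT F -> (forall x, 0 <= F x)%E ->
  (\int[leb]_x F (- x)%R = \int[leb]_x F x)%E.
Proof.
move=> mF F0.
pose phi : measurableTypeR R -> measurableTypeR R := -%R.
have mphi : measurable_fun setT phi by exact: (@oppr_measurable R setT).
transitivity (\int[image_measure leb mphi]_x F x)%E.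
  by rewrite ge0_integral_pushforward.
by apply: eq_measure_integral => A mA _; exact: lebesgue_measureN.
Qed.

Lemma lebesgue_measure_affine (a b : R) A : 0 < a -> measurable A ->
  (a%:E * leb [set x | A (a * x + b)%R] = leb A)%E.
Proof.
move=> a0 mA.
have mB : measurable [set x | A (a * x + b)].
  rewrite -[X in measurable X]setTI.
  have : measurable_fun setT (fun x : R => a * x + b).
    by apply: measurable_funD => //; exact: measurable_funM.
  by apply.
have indE D : measurable D -> leb D = (\int[leb]_x (\1_D x)%:E)%E.
  by move=> mD; rewrite integral_indic// setIT.
rewrite (indE A)// (indE _ mB).
have mI : measurable_fun setT (fun x : R => (\1_A x)%:E : \bar R).
  by apply/measurable_EFinP; exact: measurable_indic.
by rewrite -[RHS](ge0_integral_affine b a0 mI).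
Qed.

Lemma lebesgue_measure_shift (b : R) A : measurable A ->
  leb [set x | A (x + b)] = leb A.
Proof.
move=> mA; rewrite -(lebesgue_measure_affine b ltr01 mA) mul1e.
by congr (leb _); apply/funext => x /=; rewrite mul1r.
Qed.

Let compact_nonempty_max A : compact A -> A !=set0 ->
  exists2 m, A m & forall x, A x -> x <= m.
Proof.
move=> cA A0.
have cid : {within A, continuous (@idfun R)}.
  by apply: continuous_subspaceT => x; exact: cvg_id.
have [m /set_mem Am mP] := compact_EVT_max A0 cA cid.
by exists m => // x Ax; apply: mP; rewrite inE.
Qed.

Let compact_nonempty_min A : compact A -> A !=set0 ->
  exists2 m, A m & forall x, A x -> m <= x.
Proof.
move=> cA A0.
have cid : {within A, continuous (@idfun R)}.
  by apply: continuous_subspaceT => x; exact: cvg_id.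
have [m /set_mem Am mP] := compact_EVT_min A0 cA cid.
by exists m => // x Ax; apply: mP; rewrite inE.
Qed.

(* With [m = max A] and [l = min B], the translates [A + l] and [m + B] lie in
   the sumset and meet only at [m + l]. *)
Let brunn_minkowski_compact A B C : compact A -> compact B -> measurable C ->
  A !=set0 -> B !=set0 -> (forall a b, A a -> B b -> C (a + b)) ->
  (leb A + leb B <= leb C)%E.
Proof.
move=> cA cB mC A0 B0 AB.
have [m Am mP] := compact_nonempty_max cA A0.
have [l Bl lP] := compact_nonempty_min cB B0.
have mA : measurable A by exact: compact_measurable.
have mB : measurable B by exact: compact_measurable.
pose A' := [set x | A (x - l)]; pose B' := [set x | (B `\ l) (x - m)].
have mB1 : measurable (B `\ l) by exact: measurableD.
have mA' : measurable A'.
  rewrite -[X in measurable X]setTI.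
  have : measurable_fun setT (fun x : R => x - l) by exact: measurable_funB.
  by apply.
have mB' : measurable B'.
  rewrite -[X in measurable X]setTI.
  have : measurable_fun setT (fun x : R => x - m) by exact: measurable_funB.
  by apply.
rewrite -(lebesgue_measure_shift (- l) mA).
have -> : leb B = leb (B `\ l).
  have BE : B = (B `\ l) `|` [set l].
    apply/seteqP; split => [x Bx|x [[]|->]//].
    by have [->|xl] := pselect (x = l); [right|left].
  rewrite [LHS](congr1 leb BE) measureU//.
    by rewrite [X in (_ + X)%E](_ : _ = 0%E) ?adde0//; exact: lebesgue_measure_set1.
  by apply/seteqP; split => // x [[]].
rewrite -(lebesgue_measure_shift (- m) mB1) -measureU//.
  apply: le_measure; rewrite ?inE//; first exact: measurableU.
  move=> x [Ax|[Bx _]].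
    by rewrite -(subrK l x); exact: AB.
  by rewrite -(subrK m x) addrC; exact: AB.
apply/seteqP; split => // x [/= /mP xm [/lP xl xln]]; apply: xln => /=; lra.
Qed.

(** Inner regularity reduces to compact subsets, first of [A], then of [B]. Subtracting a measure
    needs it finite, so infinite [leb C] is set aside. [C] stands for the sumset, which need not be
    Borel. *)
Lemma brunn_minkowski_line A B C : measurable A -> measurable B ->
  measurable C -> A !=set0 -> B !=set0 ->
  (forall a b, A a -> B b -> C (a + b)) -> (leb A + leb B <= leb C)%E.
Proof.
move=> mA mB mC A0 B0 AB.
have [->|Cfin] := eqVneq (leb C) +oo%E; first by rewrite leey.
have Cn : leb C \is a fin_num.
  by rewrite ge0_fin_numE// ltey.
have leA K : compact K -> K `<=` A -> (leb K + leb B <= leb C)%E.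
  (* The compact case excludes empty sets; for empty [K] a translate of [B] by a point of [A]
     already lies in [C]. *)
  move=> cK KA; have [->|K0] := eqVneq K set0.
    rewrite measure0 add0e; have [a Aa] := A0.
    rewrite -(lebesgue_measure_shift (- a) mB).
    apply: le_measure; rewrite ?inE//.
      rewrite -[X in measurable X]setTI.
      have : measurable_fun setT (fun x : R => x - a).
        exact: measurable_funB.
      by apply.
    by move=> x /= Bx; rewrite -(subrK a x) addrC; exact: AB.
  have Kn : leb K \is a fin_num.
    by rewrite ge0_fin_numE//; exact: compact_finite_measure.
  rewrite -leeBrDl// (lebesgue_regularity_inner_sup mB).
  apply: ub_ereal_sup => _ [L [cL LB] <-]; rewrite leeBrDl//.
  have [->|L0] := eqVneq L set0.
    rewrite measure0 adde0; have [b Bb] := B0.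
    have mK : measurable K by exact: compact_measurable.
    rewrite -(lebesgue_measure_shift (- b) mK).
    apply: le_measure; rewrite ?inE//.
      rewrite -[X in measurable X]setTI.
      have : measurable_fun setT (fun x : R => x - b).
        exact: measurable_funB.
      by apply.
    by move=> x /= Kx; rewrite -(subrK b x); apply: AB => //; exact: KA.
  apply: brunn_minkowski_compact => //; [exact/set0P|exact/set0P|].
  by move=> a b Ka Lb; apply: AB; [exact: KA|exact: LB].
have Bn : leb B \is a fin_num.
  rewrite ge0_fin_numE//; apply: le_lt_trans (_ : leb C < _)%E.
    have := leA set0 (@compact0 _) (@sub0set _ _).
    by rewrite measure0 add0e.
  by rewrite ltey.
rewrite -leeBrDr// (lebesgue_regularity_inner_sup mA).
apply: ub_ereal_sup => _ [L [cL LA] <-]; rewrite leeBrDr//.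
exact: leA.
Qed.

(** Levels are the first coordinate. Starting them at 0 gives the fibre over [x] the length [f x]
    when [f] is nonnegative. *)
Let hypograph f : set (measurableTypeR R * measurableTypeR R) :=
  [set p | 0 < p.1 < f p.2].

Let measurable_hypograph f : measurable_fun setT f ->
  measurable (hypograph f).
Proof.
move=> mf.
have m1 : measurable_fun setT
    (fun p : measurableTypeR R * measurableTypeR R =>
      (0 < p.1) && (p.1 < f p.2)).
  apply: measurable_and; apply: measurable_fun_ltr => //.
  exact: (measurableT_comp mf).
by move: (m1 measurableT [set true] I); rewrite setTI.
Qed.

Let xsection_hypograph f s : xsection (hypograph f) s = [set x | 0 < s < f x].
Proof. by apply/seteqP; split => x; rewrite /xsection /= ?inE. Qed.

Lemma measurable_superlevel f s : measurable_fun setT f ->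
  measurable [set x | 0 < s < f x].
Proof.
move=> /measurable_hypograph mE; rewrite -xsection_hypograph.
exact: measurable_xsection.
Qed.

Lemma measurable_measure_superlevel f : measurable_fun setT f ->
  measurable_fun setT (fun s : R => leb [set x | 0 < s < f x]).
Proof.
move=> /measurable_hypograph mE; under eq_fun do rewrite -xsection_hypograph.
exact: measurable_fun_xsection.
Qed.

(** Both sides are the measure of the hypograph, sliced in the two directions. *)
Lemma layer_cake f : measurable_fun setT f -> (forall x, 0 <= f x) ->
  (\int[leb]_x (f x)%:E = \int[leb]_s leb [set x | 0 < s < f x]%R)%E.
Proof.
move=> mf f0; pose E := hypograph f.
have mE : measurable E by exact: measurable_hypograph.
pose F (p : measurableTypeR R * measurableTypeR R) : \bar R := (\1_E p)%:E.
have mF : measurable_fun setT F.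
  by apply/measurable_EFinP; exact: measurable_indic.
have F0 p : (0 <= F p)%E by rewrite lee_fin.
have := @fubini_tonelli _ _ _ _ _ leb leb F mF F0.
rewrite /fubini_F /fubini_G => E1.
transitivity (\int[leb]_x \int[leb]_s F (s, x))%E.
  apply: eq_integral => x _.
  have -> : (\int[leb]_s F (s, x) = \int[leb]_s (\1_(`]0, f x[) s)%:E)%E.
    by apply: eq_integral => s _; rewrite /F !indicE !mem_setE /E/= in_itv.
  rewrite integral_indic// setIT.
  transitivity (leb `]0, f x[%classic) => //.
  rewrite lebesgue_measure_itv/= lte_fin.
  case: ltP => fx; first by rewrite -EFinB subr0.
  by congr EFin; apply/eqP; rewrite eq_le f0 fx.
rewrite -E1; apply: eq_integral => s _.
have mEs := measurable_superlevel s mf.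
by rewrite -[in RHS](setIT [set _ | _]) -integral_indic.
Qed.

End line.

(** * The Prekopa-Leindler inequality on the line *)

Section prekopa_leindler.
Context {R : realType}.
Local Notation leb := (@lebesgue_measure R).
Implicit Types f g h : R -> R.

(** Young's inequality with the conjugate exponents [(1 - t)^-1] and [t^-1]. *)
Lemma powR_am_gm (t x y : R) : 0 < t < 1 -> 0 <= x -> 0 <= y ->
  x `^ (1 - t) * y `^ t <= (1 - t) * x + t * y.
Proof.
move=> /andP[t0 t1] x0 y0.
have t1' : 0 < 1 - t by rewrite subr_gt0.
have := @conjugate_powR R (x `^ (1 - t)) (y `^ t) (1 - t)^-1 t^-1.
rewrite !powR_ge0 !invr_gt0 t0 t1' !invrK subrK => /(_ isT isT isT isT erefl).
by rewrite -!powRrM !mulfV ?gt_eqF// !powRr1// [x * _]mulrC [y * _]mulrC.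
Qed.

(** Since [f] and [g] have the same supremum 1, at every level [0 < s < 1] both superlevel sets are
    nonempty, and (1 - t) {f > s} + t {g > s} lies in {h > s}. Brunn-Minkowski at each level and
    integration in [s] give the sum form, stronger than the product form. *)
Lemma prekopa_leindler_normalized f g h (t : R) : 0 < t < 1 ->
  measurable_fun setT f -> measurable_fun setT g -> measurable_fun setT h ->
  (forall x, 0 <= f x <= 1) -> (forall x, 0 <= g x <= 1) ->
  (forall s, s < 1 -> exists x, s < f x) ->
  (forall s, s < 1 -> exists x, s < g x) ->
  (forall x y, f x `^ (1 - t) * g y `^ t <= h ((1 - t) * x + t * y)) ->
  ((1 - t)%:E * \int[leb]_x (f x)%:E + t%:E * \int[leb]_x (g x)%:E
   <= \int[leb]_x (h x)%:E)%E.
Proof.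
move=> t01 mf mg mh f01 g01 fsup gsup fgh; have /andP[t0 t1] := t01.
have t1' : 0 < 1 - t by rewrite subr_gt0.
have f0 x : 0 <= f x by have /andP[] := f01 x.
have g0 x : 0 <= g x by have /andP[] := g01 x.
have h0 x : 0 <= h x.
  have := fgh x x; rewrite -mulrDl subrK mul1r; apply: le_trans.
  by rewrite mulr_ge0 ?powR_ge0.
rewrite !layer_cake//.
rewrite -!ge0_integralZl//=; try by [exact: measurable_measure_superlevel|
  rewrite lee_fin ltW].
rewrite -ge0_integralD//=; try by [move=> s _; rewrite mule_ge0// lee_fin ltW|
  apply: measurable_funeM; exact: measurable_measure_superlevel].
apply: ge0_le_integral => //=.
- by move=> s _; rewrite adde_ge0// mule_ge0// lee_fin ltW.
- by apply: emeasurable_funD; apply: measurable_funeM;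
    exact: measurable_measure_superlevel.
- exact: measurable_measure_superlevel.
move=> s _.
have empty (k : R -> R) : (forall x, 0 <= k x <= 1) -> ~~ (0 < s < 1) ->
    [set x | 0 < s < k x] = set0.
  move=> k01; apply: contraNeq => /set0P[x /= /andP[-> sx]].
  by have /andP[_] := k01 x; exact: lt_le_trans.
have [/andP[s0 s1]|s01] := boolP (0 < s < 1); last first.
  by rewrite (empty f)// (empty g)// !measure0 !mule0 adde0.
have scale (k : R -> R) (a : R) : 0 < a -> measurable_fun setT k ->
    (a%:E * leb [set x | 0 < s < k x]%R =
     leb [set x | 0 < s < k (a^-1 * x + 0)]%R)%E.
  move=> a0 mk; have mK := measurable_superlevel s mk.
  rewrite -(lebesgue_measure_affine 0 (_ : 0 < a^-1) mK) ?invr_gt0//.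
  by rewrite muleA -EFinM mulfV ?gt_eqF// mul1e.
rewrite !scale//; apply: brunn_minkowski_line.
- apply: measurable_superlevel; apply: (measurableT_comp mf).
  by apply: measurable_funD => //; exact: measurable_funM.
- apply: measurable_superlevel; apply: (measurableT_comp mg).
  by apply: measurable_funD => //; exact: measurable_funM.
- exact: measurable_superlevel.
- have [x sx] := fsup _ s1; exists ((1 - t) * x) => /=.
  by rewrite addr0 mulrA mulVf ?gt_eqF// mul1r s0.
- have [x sx] := gsup _ s1; exists (t * x) => /=.
  by rewrite addr0 mulrA mulVf ?gt_eqF// mul1r s0.
move=> a b /=; rewrite !addr0 => /andP[_ sa] /andP[_ sb]; rewrite s0/=.
apply: lt_le_trans (_ : f ((1 - t)^-1 * a) `^ (1 - t) *
    g (t^-1 * b) `^ t <= _).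
  have {1}-> : s = s `^ (1 - t) * s `^ t.
    by rewrite -powRD ?subrK ?powRr1 ?ltW// gt_eqF// implybT.
  by apply: ltr_pM; rewrite ?powR_ge0// gt0_ltr_powR// nnegrE// ltW// (lt_trans s0).
apply: le_trans (fgh _ _) _.
by rewrite !mulrA !mulfV ?gt_eqF// !mul1r.
Qed.

(** Dividing [f] and [g] by their suprema and [h] by the weighted geometric mean of these keeps the
    hypothesis; the normalized sum then dominates the product by [powR_am_gm]. A zero integral makes
    the left side 0, and a nonzero one makes the supremum positive. *)
Theorem prekopa_leindler f g h (t M a b : R) : 0 < t < 1 ->
  measurable_fun setT f -> measurable_fun setT g -> measurable_fun setT h ->
  (forall x, 0 <= f x <= M) -> (forall x, 0 <= g x <= M) ->
  (forall x y, f x `^ (1 - t) * g y `^ t <= h ((1 - t) * x + t * y)) ->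
  (\int[leb]_x (f x)%:E = a%:E)%E -> (\int[leb]_x (g x)%:E = b%:E)%E ->
  ((a `^ (1 - t) * b `^ t)%:E <= \int[leb]_x (h x)%:E)%E.
Proof.
move=> t01 mf mg mh f01 g01 fgh fa gb; have /andP[t0 t1] := t01.
have t1' : 0 < 1 - t by rewrite subr_gt0.
have f0 x : 0 <= f x by have /andP[] := f01 x.
have g0 x : 0 <= g x by have /andP[] := g01 x.
have h0 x : 0 <= h x.
  have := fgh x x; rewrite -mulrDl subrK mul1r; apply: le_trans.
  by rewrite mulr_ge0 ?powR_ge0.
have ih0 : (0 <= \int[leb]_x (h x)%:E)%E.
  by apply: integral_ge0 => x _; rewrite lee_fin.
have supP (k : R -> R) c : (forall x, 0 <= k x <= M) -> (\int[leb]_x (k x)%:E = c%:E)%E ->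
    c != 0 -> [/\ 0 < c, 0 < sup (range k), (forall x, k x <= sup (range k)) &
    forall s, s < 1 -> exists x, s < (sup (range k))^-1 * k x].
  move=> k01 kc c_neq0.
  have k0 x : 0 <= k x by have /andP[] := k01 x.
  have c0 : 0 < c.
    rewrite lt0r c_neq0/= -lee_fin -kc.
    by apply: integral_ge0 => x _; rewrite lee_fin.
  have ks : has_sup (range k).
    split; first by exists (k 0), 0.
    by exists M => _ [x _ <-]; have /andP[] := k01 x.
  have kle x : k x <= sup (range k).
    by apply: ub_le_sup; [exact: ks.2|exists x].
  have s0 : 0 < sup (range k).
    rewrite ltNge; apply/negP => s0; move/eqP: c_neq0; apply.
    apply: EFin_inj; rewrite -kc; apply: integral0_eq => x _.
    by congr EFin; apply/eqP; rewrite eq_le k0 (le_trans (kle x)).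
  split=> // s s1; have e0 : 0 < (1 - s) * sup (range k).
    by rewrite mulr_gt0// subr_gt0.
  have [_ [x _ <-] xs] := sup_adherent e0 ks.
  by exists x; rewrite mulrC ltr_pdivlMr//; lra.
have [->|a0] := eqVneq a 0; first by rewrite powR0 ?gt_eqF// mul0r.
have [->|b0] := eqVneq b 0; first by rewrite (@powR0 _ t) ?gt_eqF// mulr0.
have [{}a0 A0 fA fsup] := supP _ _ f01 fa a0.
have [{}b0 B0 gB gsup] := supP _ _ g01 gb b0.
set A := sup (range f) in A0 fA fsup; set B := sup (range g) in B0 gB gsup.
have D0 : 0 < (A `^ (1 - t) * B `^ t)^-1.
  by rewrite invr_gt0 mulr_gt0 ?powR_gt0.
have DE x y : 0 <= x -> 0 <= y ->
    (A^-1 * x) `^ (1 - t) * (B^-1 * y) `^ t =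
    (A `^ (1 - t) * B `^ t)^-1 * (x `^ (1 - t) * y `^ t).
  have VE c r : 0 <= c -> c^-1 `^ r = (c `^ r)^-1.
    by move=> c0; rewrite -(powR_inv1 c0) powRAC powR_inv1 ?powR_ge0.
  by move=> x0 y0; rewrite !powRM ?invr_ge0// ?ltW// !VE ?ltW// invfM; ring.
have := @prekopa_leindler_normalized (fun x => A^-1 * f x) (fun x => B^-1 * g x)
  (fun x => (A `^ (1 - t) * B `^ t)^-1 * h x) t t01.
under eq_integral do rewrite EFinM.
under [in X in (_ + X)%E]eq_integral do rewrite EFinM.
under [in X in (_ <= X)%E]eq_integral do rewrite EFinM.
rewrite !ge0_integralZl//= ?fa ?gb ?lee_fin ?invr_ge0 ?(ltW A0) ?(ltW B0)//;
  try by [exact/measurable_EFinP|move=> x _; rewrite lee_fin|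
  rewrite mulr_ge0 ?powR_ge0].
move=> PL; rewrite -(@lee_pmul2l _ (A `^ (1 - t) * B `^ t)^-1%:E)//.
apply: le_trans (PL _ _ _ _ _ _ _ _) => //.
- rewrite -!EFinM -EFinD lee_fin -(DE _ _ (ltW a0) (ltW b0)).
  by apply: powR_am_gm; rewrite ?mulr_ge0 ?invr_ge0 ?(ltW a0) ?(ltW b0) ?ltW.
- exact: measurable_funM.
- exact: measurable_funM.
- exact: measurable_funM.
- by move=> x; rewrite mulr_ge0 ?invr_ge0 ?(ltW A0)//= mulrC ler_pdivrMr// mul1r.
- by move=> x; rewrite mulr_ge0 ?invr_ge0 ?(ltW B0)//= mulrC ler_pdivrMr// mul1r.
- by move=> x y; rewrite DE// ler_pM2l.
Qed.

End prekopa_leindler.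

(** * Measures with a density *)

Section density.
Context d (T : measurableType d) (R : realType) (m : {measure set T -> \bar R}).
Variables (w : T -> R) (mw : measurable_fun setT w) (w0 : forall x, 0 <= w x).

(** The proofs are arguments so that the measure structure declared below is found from the term
    alone. *)
Definition density_measure of measurable_fun setT w & (forall x, 0 <= w x) :
  set T -> \bar R := fun A => (\int[m]_(x in A) (w x)%:E)%E.

Local Notation nu := (density_measure mw w0).

Let density0 : nu set0 = 0%E.
Proof. by rewrite /density_measure integral_set0. Qed.

Let density_ge0 A : (0 <= nu A)%E.
Proof. by apply: integral_ge0 => x _; rewrite lee_fin. Qed.

Let density_sigma_additive : semi_sigma_additive nu.
Proof.
apply: semi_sigma_additive_nng_induced => [|x]; last by rewrite lee_fin.
exact/measurable_EFinP.
Qed.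

HB.instance Definition _ :=
  isMeasure.Build _ _ _ nu density0 density_ge0 density_sigma_additive.

Import HBNNSimple.

(** For indicators this is the hypothesis on [mu]; simple functions and monotone convergence give
    the rest. Only the values of [mu] are constrained, so that it applies to image measures and to
    [gaussian] alike. *)
Lemma ge0_integral_density (mu : {measure set T -> \bar R}) (f : T -> \bar R) :
  (forall A, measurable A -> mu A = \int[m]_(x in A) (w x)%:E)%E ->
  measurable_fun setT f -> (forall x, 0 <= f x)%E ->
  (\int[mu]_x f x = \int[m]_x (f x * (w x)%:E))%E.
Proof.
move=> muE mf f0; pose f_ := nnsfun_approx measurableT mf.
have f_f x : (f_ n x)%:E @[n --> \oo] --> f x.
  by apply: cvg_nnsfun_approx.
have nd_f x : {homo (fun n => (f_ n x)%:E) : a b / (a <= b)%N >-> (a <= b)%E}.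
  by move=> a b ab; rewrite lee_fin; exact/lefP/nd_nnsfun_approx.
transitivity (limn (fun n => \int[mu]_x (f_ n x)%:E))%E.
  rewrite -monotone_convergence//.
  - by apply: eq_integral => y _; exact/esym/cvg_lim.
  - by move=> n; exact/measurable_EFinP/measurable_funP.
  - by move=> n y _; rewrite lee_fin.
transitivity (limn (fun n => \int[m]_x ((f_ n x)%:E * (w x)%:E)))%E; last first.
  rewrite -monotone_convergence//.
  - apply: eq_integral => y _; apply/cvg_lim => //.
    by apply: cvgeZr.
  - move=> n; apply: emeasurable_funM; last exact/measurable_EFinP.
    exact/measurable_EFinP/measurable_funP.
  - by move=> n y _; rewrite mule_ge0// lee_fin.
  - by move=> y _ a b ab; rewrite lee_wpmul2r ?lee_fin//; exact/lefP/nd_nnsfun_approx.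
congr (limn _); apply/funext => n.
transitivity (\sum_(k \in range (f_ n)) k%:E * mu (f_ n @^-1` [set k]))%E.
  by rewrite integral_nnsfun// patch_setT sintegralE.
transitivity (\sum_(k \in range (f_ n))
    \int[m]_x (k%:E * ((w x)%:E * (\1_(f_ n @^-1` [set k]) x)%:E)))%E.
  apply: eq_fsbigr => r /set_mem[x _ <-].
  rewrite ge0_integralZl//=; last 3 first.
  - apply: emeasurable_funM; first exact/measurable_EFinP.
    by apply/measurable_EFinP; exact: measurable_indic.
  - by move=> y _; rewrite mule_ge0// lee_fin.
  - by rewrite lee_fin.
  rewrite muE//; congr (_ * _)%E; rewrite integral_mkcond.
  apply: eq_integral => y _; rewrite patchE indicE.
  by case: ifP => _; rewrite ?mule1 ?mule0.
rewrite -ge0_integral_fsum//.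
- apply: eq_integral => x _.
  rewrite [in RHS](fimfunE (f_ n)) -fsumEFin// ge0_mule_fsuml//.
    apply: eq_fsbigr => r _; rewrite EFinM -muleA; congr (_ * _)%E.
    by rewrite muleC.
  by move=> r; rewrite lee_fin; exact: nnfun_muleindic_ge0.
- move=> r; apply: measurable_funeM; apply: emeasurable_funM.
    exact/measurable_EFinP.
  by apply/measurable_EFinP; exact: measurable_indic.
- move=> r x _; rewrite muleCA mule_ge0 ?lee_fin//.
  exact: nnfun_muleindic_ge0.
Qed.

End density.

(** The rays []x, +oo[] are stable under intersection and generate the Borel sets; total mass 1
    passes from lower rays to upper ones. *)
Lemma probability_ray_unique (R : realType)
    (m1 m2 : {measure set (measurableTypeR R) -> \bar R}) :
  m1 setT = 1%E -> m2 setT = 1%E ->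
  (forall x, m1 `]-oo, x]%classic = m2 `]-oo, x]%classic) ->
  forall A, measurable A -> m1 A = m2 A.
Proof.
move=> m1T m2T m12.
have mC (m : {measure set (measurableTypeR R) -> \bar R}) x : m setT = 1%E ->
    m `]x, +oo[%classic = (1 - m `]-oo, x]%classic)%E.
  move=> mT; rewrite -setCitvl -setTD measureD//; last first.
    by apply: le_lt_trans (ltry 1); rewrite -mT.
  by congr (_ - _)%E; [exact: mT|rewrite setTI].
move=> A; apply: (@measure_unique _ R (measurableTypeR R) (@RGenOInfty.G R)
  (fun n => `]- n%:R, +oo[%classic) _ _ _ _ m1 m2).
- exact: RGenOInfty.measurableE.
- move=> _ _ [x ->] [y ->]; exists (Num.max x y).
  by apply/seteqP; split => z /=; rewrite !in_itv/= !andbT gt_max => /andP.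
- by move=> n; eexists.
- apply/seteqP; split => // x _; exists (Num.bound `|x|) => //=.
  rewrite in_itv/= andbT ltrNl; apply: le_lt_trans (ler_norm _) _.
  by rewrite normrN; exact: (archi_boundP (normr_ge0 x)).
- by move=> _ [x ->]; rewrite !mC// m12.
- move=> n; apply: le_lt_trans (ltry 1).
  by rewrite -m1T; apply: le_measure; rewrite ?inE.
Qed.

(** * Distribution functions *)

Section density_cdf.
Context {R : realType}.
Local Notation leb := (@lebesgue_measure R).
Implicit Types (w : R -> R) (x y : R).

Definition bounded_density w (M : R) :=
  [/\ measurable_fun setT w, forall x, 0 <= w x <= M &
      (\int[leb]_x (w x)%:E = 1)%E].

Definition cdf_of w x : R := fine (\int[leb]_(y in `]-oo, x]) (w y)%:E).

Section bounded_density.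
Variables (w : R -> R) (M : R) (bw : bounded_density w M).

Let mw : measurable_fun setT w. Proof. by case: bw. Qed.
Let w0 x : 0 <= w x. Proof. by case: bw => _ /(_ x)/andP[]. Qed.
Let wM x : w x <= M. Proof. by case: bw => _ /(_ x)/andP[]. Qed.
Let w1 : (\int[leb]_x (w x)%:E = 1)%E. Proof. by case: bw. Qed.
Let mwE : measurable_fun setT (EFin \o w). Proof. exact/measurable_EFinP. Qed.

Let le1 (D : set R) : measurable D -> (\int[leb]_(x in D) (w x)%:E <= 1)%E.
Proof.
move=> mD; rewrite -w1; apply: ge0_subset_integral => //.
by move=> x _; rewrite lee_fin.
Qed.

Lemma cdf_ofE x : (cdf_of w x)%:E = (\int[leb]_(y in `]-oo, x]) (w y)%:E)%E.
Proof.
rewrite /cdf_of fineK// ge0_fin_numE.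
  by apply: le_lt_trans (ltry 1); exact: le1.
by apply: integral_ge0 => y _; rewrite lee_fin.
Qed.

Lemma cdf_of_itv x y : x <= y ->
  (\int[leb]_(z in `]x, y]) (w z)%:E = (cdf_of w y - cdf_of w x)%:E)%E.
Proof.
move=> xy; rewrite EFinB !cdf_ofE.
rewrite (_ : `]-oo, y]%classic = `]-oo, x] `|` `]x, y]); last first.
  by rewrite -itv_bndbnd_setU// bnd_simp.
rewrite ge0_integral_setU//=.
- by rewrite [X in (X - _)%E]addeC addeK// -cdf_ofE.
- exact: measurable_funTS.
- by move=> z _; rewrite lee_fin.
- apply/disj_setPS => z [/=]; rewrite !in_itv/= => zx /andP[xz _].
  by move: (lt_le_trans xz zx); rewrite ltxx.
Qed.

Lemma cdf_of_tail x :
  (\int[leb]_(z in `]x, +oo[) (w z)%:E = (1 - cdf_of w x)%:E)%E.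
Proof.
rewrite EFinB cdf_ofE -w1 -(itv_setU_setT false x).
rewrite ge0_integral_setU//=.
- by rewrite [X in (X - _)%E]addeC addeK// -cdf_ofE.
- exact: measurable_funTS.
- by move=> z _; rewrite lee_fin.
- apply/disj_setPS => z [/=]; rewrite !in_itv/= andbT => zx xz.
  by move: (lt_le_trans xz zx); rewrite ltxx.
Qed.

Lemma cdf_of_nondecreasing x y : x <= y -> cdf_of w x <= cdf_of w y.
Proof.
move=> xy; rewrite -subr_ge0 -lee_fin -cdf_of_itv//.
by apply: integral_ge0 => z _; rewrite lee_fin.
Qed.

Lemma cdf_of_bounds x : 0 <= cdf_of w x <= 1.
Proof.
rewrite -!lee_fin cdf_ofE le1// andbT.
by apply: integral_ge0 => z _; rewrite lee_fin.
Qed.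

Lemma cdf_of_lipschitz x y : x <= y -> cdf_of w y - cdf_of w x <= M * (y - x).
Proof.
move=> xy; rewrite -lee_fin -cdf_of_itv//.
apply: (@le_trans _ _ (\int[leb]_(z in `]x, y]) M%:E)%E).
  apply: ge0_le_integral => //=.
  - by move=> z _; rewrite lee_fin.
  - exact: measurable_funTS.
  - by move=> z _; rewrite lee_fin.
have L : (leb `]x, y]%classic = (y - x)%:E)%E.
  rewrite lebesgue_measure_itv/= lte_fin; case: ltP => // yx.
  by rewrite (_ : y = x) ?subrr//; apply/eqP; rewrite eq_le xy yx.
by rewrite integral_cst// [X in (_ * X)%E]L EFinM.
Qed.

Lemma continuous_cdf_of : continuous (cdf_of w).
Proof.
have M0 : 0 <= M by exact: le_trans (w0 0) (wM 0).
have lip x y : `|cdf_of w x - cdf_of w y| <= M * `|x - y|.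
  wlog xy : x y / x <= y => [wl|].
    have [|yx] := leP x y; first exact: wl.
    by rewrite distrC (distrC x); apply: wl; rewrite ltW.
  rewrite distrC (distrC x) !ger0_norm ?subr_ge0//.
    exact: cdf_of_lipschitz.
  exact: cdf_of_nondecreasing.
have M1 : 0 < M + 1 by rewrite ltr_wpDl.
move=> x; apply/cvgrPdist_lt => e e0.
have e1 : 0 < e / (M + 1) by rewrite divr_gt0.
near=> y; apply: le_lt_trans (lip _ _) _.
apply: (@le_lt_trans _ _ ((M + 1) * `|x - y|)).
  by rewrite ler_wpM2r// lerDl.
rewrite mulrC -ltr_pdivlMr//.
Unshelve. all: by end_near. Qed.

End bounded_density.

Lemma integral_lt_exists w1 w2 (D : set R) : measurable D ->
  measurable_fun setT w1 -> measurable_fun setT w2 ->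
  (forall x, 0 <= w1 x) -> (forall x, 0 <= w2 x) ->
  (\int[leb]_(x in D) (w1 x)%:E < \int[leb]_(x in D) (w2 x)%:E)%E ->
  exists2 x, D x & w1 x < w2 x.
Proof.
move=> mD m1 m2 w10 w20 lt12; apply: contrapT => ex; move: lt12.
rewrite ltNge => /negP; apply; apply: ge0_le_integral => //=;
  try by [move=> x _; rewrite lee_fin|apply: measurable_funTS; exact/measurable_EFinP].
by move=> x Dx; rewrite lee_fin leNgt; apply/negP => lt; apply: ex; exists x.
Qed.

Lemma cdf_of_shift w (c x : R) : measurable_fun setT w -> (forall x, 0 <= w x) ->
  cdf_of (fun y => w (y + c)) x = cdf_of w (x + c).
Proof.
move=> mw w0; rewrite /cdf_of; congr fine.
rewrite integral_mkcond [RHS]integral_mkcond.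
rewrite -[RHS](@ge0_integral_shift _ (_ \_ _) c).
- by apply: eq_integral => y _; rewrite !patchE !mem_setE !in_itv/= lerD2r.
- apply: (iffLR (measurable_restrictT _ _)) => //.
  by apply: measurable_funTS; exact/measurable_EFinP.
- by move=> y; apply: erestrict_ge0 => {}y _; rewrite lee_fin.
Qed.

End density_cdf.

(** * Contraction of the Gaussian measure on the line *)

Section gaussian_density.
Context {R : realType}.
Local Notation leb := (@lebesgue_measure R).
Local Notation gauss := (@normal_pdf R 0 1).
Implicit Types (w : R -> R) (x y : R).

Lemma gaussE x : gauss x = @normal_peak R 1 * expR (- x ^+ 2 / 2).
Proof. by rewrite normal_pdfE ?oner_neq0// /normal_fun subr0 expr1n. Qed.

Let peak_gt0 : 0 < @normal_peak R 1.
Proof. by apply: normal_peak_gt0; exact: oner_neq0. Qed.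

Lemma bounded_density_gauss : bounded_density gauss (@normal_peak R 1).
Proof.
split; first exact: measurable_normal_pdf.
- by move=> x; rewrite normal_pdf_ge0 normal_pdf_ub ?oner_neq0.
- exact: integral_normal_pdf.
Qed.

Lemma integral_normal_prob01 (f : R -> \bar R) : measurable_fun setT f ->
  (forall x, 0 <= f x)%E ->
  (\int[normal_prob 0 1]_x f x = \int[leb]_x (f x * (gauss x)%:E))%E.
Proof.
move=> mf f0; apply: ge0_integral_density => //.
- exact: measurable_normal_pdf.
- by move=> x; rewrite normal_pdf_ge0.
Qed.

Lemma normal_prob_ray x : normal_prob 0 1 `]-oo, x]%classic = (cdf_of gauss x)%:E.
Proof. by rewrite (cdf_ofE bounded_density_gauss). Qed.

Lemma cdf_gauss_increasing x y : x < y -> cdf_of gauss x < cdf_of gauss y.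
Proof.
move=> xy; rewrite -subr_gt0 -lte_fin -(cdf_of_itv bounded_density_gauss (ltW xy)).
(* Whatever the signs, [z ^+ 2 <= x ^+ 2 + y ^+ 2] for [z] between [x] and [y], so [m] bounds the
   density from below there. *)
pose m := @normal_peak R 1 * expR (- (x ^+ 2 + y ^+ 2) / 2).
have m0 : 0 < m by rewrite mulr_gt0// expR_gt0.
apply: (@lt_le_trans _ _ (\int[leb]_(z in `]x, y]) m%:E)%E).
  have L : (leb `]x, y]%classic = (y - x)%:E)%E.
    by rewrite lebesgue_measure_itv/= lte_fin xy.
  by rewrite integral_cst// [X in (_ * X)%E]L -EFinM lte_fin mulr_gt0// subr_gt0.
apply: ge0_le_integral => //=.
- by move=> z _; rewrite lee_fin ltW.
- by apply: measurable_funTS; apply/measurable_EFinP; exact: measurable_normal_pdf.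
move=> z; rewrite in_itv/= => /andP[xz zy]; rewrite lee_fin gaussE.
rewrite ler_pM2l// ler_expR ler_pM2r// lerN2.
have [z0|z0] := leP 0 z.
  by apply: ler_wpDl; [exact: sqr_ge0|rewrite lerXn2r ?nnegrE// (le_trans z0)].
apply: ler_wpDr; first exact: sqr_ge0.
by rewrite -[z ^+ 2]sqrrN -[x ^+ 2]sqrrN lerXn2r ?nnegrE; lra.
Qed.

Lemma cdf_gauss_bounds x : 0 < cdf_of gauss x < 1.
Proof.
have /andP[l _] := cdf_of_bounds bounded_density_gauss (x - 1).
have /andP[_ u] := cdf_of_bounds bounded_density_gauss (x + 1).
rewrite (le_lt_trans l) ?(lt_le_trans _ u)//; apply: cdf_gauss_increasing; lra.
Qed.

(** The lower rays ending at -n and n have masses tending to 0 and 1, which brackets [u] for the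
    intermediate value theorem. *)
Lemma cdf_gauss_onto (u : R) : 0 < u < 1 -> exists x, cdf_of gauss x = u.
Proof.
move=> /andP[u0 u1].
have [a ha] : exists a, cdf_of gauss a < u.
  have : normal_prob 0 1 (`]-oo, (- n%:R)%R]%classic : set (measurableTypeR R))
      @[n --> \oo] --> normal_prob 0 1 (\bigcap_n `]-oo, (- n%:R : R)]%classic).
    apply: nonincreasing_cvg_mu => //.
    - by apply: le_lt_trans (probability_le1 _ _) (ltry _).
    - exact: bigcap_measurable.
    - move=> m n mn; apply/subsetPset; apply: subset_itvl.
      by rewrite bnd_simp lerN2 ler_nat.
  rewrite (_ : \bigcap_n _ = set0) ?measure0; last first.
    apply/seteqP; split => // x /(_ (Num.bound `|x|) I) /=.
    rewrite in_itv/= leNgt => /negP; apply; rewrite ltrNl.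
    apply: le_lt_trans (ler_norm _) _.
    by rewrite normrN; exact: (archi_boundP (normr_ge0 x)).
  move=> /fine_cvgP[_] /cvgrPdist_lt/(_ _ u0)[N _ /(_ N (leqnn N))].
  rewrite /= normal_prob_ray sub0r normrN => h; exists (- N%:R).
  exact: le_lt_trans (ler_norm _) h.
have [b hb] : exists b, u < cdf_of gauss b.
  have : normal_prob 0 1 (`]-oo, (n%:R)%R]%classic : set (measurableTypeR R))
      @[n --> \oo] --> normal_prob 0 1 (\bigcup_n `]-oo, (n%:R : R)]%classic).
    apply: nondecreasing_cvg_mu => //; first exact: bigcup_measurable.
    move=> m n mn; apply/subsetPset; apply: subset_itvl.
    by rewrite bnd_simp ler_nat.
  rewrite (_ : \bigcup_n _ = setT) ?probability_setT; last first.
    apply/seteqP; split => // x _; exists (Num.bound `|x|) => //=.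
    rewrite in_itv/=; apply: le_trans (ler_norm _) _.
    exact/ltW/(archi_boundP (normr_ge0 x)).
  have u1' : 0 < 1 - u by rewrite subr_gt0.
  move=> /fine_cvgP[_] /cvgrPdist_lt/(_ _ u1')[N _ /(_ N (leqnn N))].
  rewrite /= normal_prob_ray => h; exists N%:R.
  by move: (le_lt_trans (ler_norm _) h); rewrite /=; lra.
have ab : a <= b.
  rewrite leNgt; apply/negP => /cdf_gauss_increasing; lra.
have [] := @IVT R (cdf_of gauss) a b u ab.
- apply: continuous_subspaceT; exact: continuous_cdf_of bounded_density_gauss.
- by rewrite ge_min le_max (ltW ha) (ltW hb) orbT.
- by move=> c _ <-; exists c.
Qed.

(** By [gauss_interpolate] this says, for nonnegative [w], that the ratio of [w] to [gauss] is
    log-concave, without a division. *)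
Definition slc1 w := forall x y t, 0 < t < 1 ->
  w x `^ (1 - t) * w y `^ t * expR (t * (1 - t) / 2 * (x - y) ^+ 2) <=
  w ((1 - t) * x + t * y).

Lemma gauss_interpolate x y t : 0 < t < 1 ->
  gauss x `^ (1 - t) * gauss y `^ t * expR (t * (1 - t) / 2 * (x - y) ^+ 2) =
  gauss ((1 - t) * x + t * y).
Proof.
move=> /andP[t0 t1]; rewrite !gaussE !powRM ?expR_ge0 ?ltW// -!expRM.
set c := @normal_peak R 1.
have cE : c = c `^ (1 - t) * c `^ t.
  by rewrite -powRD ?subrK ?powRr1 ?ltW// gt_eqF ?implybT.
rewrite [in RHS]cE mulrACA -!mulrA; congr (_ * (_ * _)).
by rewrite -!expRD; congr expR; field.
Qed.

(* At [x0 < x1 < x2] with [x0 <= a < x1 <= b < x2] the ratio of [w(. + c)] to the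
   Gaussian density would be [> 1], [< 1], [> 1], against log-concavity. *)
Lemma slc1_no_crossing w (M a b c : R) : bounded_density w M -> slc1 w -> a < b ->
  cdf_of gauss a < cdf_of w (a + c) -> cdf_of w (b + c) < cdf_of gauss b -> False.
Proof.
move=> bw lcw ab; have [mw wM iw] := bw; have bg := bounded_density_gauss.
pose v x := w (x + c).
have bv : bounded_density v M.
  split; first by apply: (measurableT_comp mw); exact: measurable_funD.
    by move=> x; exact: wM.
  rewrite -iw; apply: (@ge0_integral_shift _ (EFin \o w)).
    exact/measurable_EFinP.
  by move=> x; rewrite lee_fin; have /andP[] := wM x.
have [mv vM iv] := bv; have mg := @measurable_normal_pdf R 0 1.
have v0 x : 0 <= v x by have /andP[] := vM x.
have g0 x : 0 <= gauss x by exact: normal_pdf_ge0.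
have cv x : cdf_of v x = cdf_of w (x + c).
  by rewrite cdf_of_shift// => y; have /andP[] := wM y.
rewrite -!cv => ha hb.
have [x0 Dx0 h0] : exists2 x, `]-oo, a]%classic x & gauss x < v x.
  by apply: integral_lt_exists => //; rewrite -!(cdf_ofE bg) -!(cdf_ofE bv) lte_fin.
have [x1 Dx1 h1] : exists2 x, `]a, b]%classic x & v x < gauss x.
  apply: integral_lt_exists => //.
  by rewrite (cdf_of_itv bg (ltW ab)) (cdf_of_itv bv (ltW ab)) lte_fin; lra.
have [x2 Dx2 h2] : exists2 x, `]b, +oo[%classic x & gauss x < v x.
  apply: integral_lt_exists => //.
  by rewrite (cdf_of_tail bg) (cdf_of_tail bv) lte_fin; lra.
move: Dx0 Dx1 Dx2; rewrite /= !in_itv/= andbT => x0a /andP[ax1 x1b] bx2.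
pose t := (x1 - x0) / (x2 - x0).
have d0 : 0 < x2 - x0 by lra.
have t01 : 0 < t < 1.
  by rewrite divr_gt0 ?ltr_pdivrMr//=; lra.
have x1E : x1 = (1 - t) * x0 + t * x2.
  by rewrite /t; field; rewrite gt_eqF.
have /andP[t0 t1] := t01.
have := lcw (x0 + c) (x2 + c) t t01.
rewrite (_ : (1 - t) * (x0 + c) + t * (x2 + c) = x1 + c); last first.
  by rewrite x1E; ring.
rewrite (_ : x0 + c - (x2 + c) = x0 - x2); last by ring.
rewrite -/(v x0) -/(v x1) -/(v x2); apply/negP; rewrite -ltNge.
apply: lt_le_trans h1 _; rewrite {1}x1E -gauss_interpolate//.
rewrite ler_pM2r ?expR_gt0//; apply: ler_pM; rewrite ?powR_ge0//.
  by apply: ge0_ler_powR; rewrite ?nnegrE// ?subr_ge0 ltW.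
by apply: ge0_ler_powR; rewrite ?nnegrE// ltW.
Qed.

End gaussian_density.

(** * Monotone transport of the Gaussian measure *)

Section transport.
Context {R : realType}.
Local Notation leb := (@lebesgue_measure R).
Local Notation gauss := (@normal_pdf R 0 1).
Implicit Types (w W p q psi : R -> R) (x y : R).

(** [T] is the monotone rearrangement: [cdf_of w (T a) = cdf_of gauss a]. It cannot expand an
    interval, because a translate of [w] would then have a distribution function crossing the
    Gaussian one in the direction excluded by [slc1_no_crossing]. Bounded support gives a bounded
    interval for the intermediate value theorem. *)
Lemma slc1_transport w (M k : R) : bounded_density w M -> slc1 w ->
  (forall x, w x != 0 -> `|x| <= k) ->
  exists T : R -> R, [/\ {homo T : x y / x < y},
    forall x y, `|T x - T y| <= `|x - y| &
    forall f : R -> \bar R, measurable_fun setT f -> (forall x, 0 <= f x)%E ->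
      (\int[normal_prob 0 1]_x f (T x) = \int[leb]_x (f x * (w x)%:E))%E].
Proof.
move=> bw lcw wk; have [mw wM iw] := bw.
have w0 x : 0 <= w x by have /andP[] := wM x.
have lek x : k < `|x| -> w x = 0.
  by move=> kx; apply: contraTeq kx => /wk; rewrite -leNgt.
have F0 : cdf_of w (- `|k| - 1) = 0.
  apply: EFin_inj; rewrite (cdf_ofE bw); apply: integral0_eq => x /=.
  rewrite in_itv/= => xk; rewrite lek//; apply: le_lt_trans (ler_norm k) _.
  by rewrite ltr_normr; apply/orP; right; lra.
have F1 : cdf_of w (`|k| + 1) = 1.
  suff : (1 - cdf_of w (`|k| + 1))%:E = 0%E :> \bar R.
    by case=> h; lra.
  rewrite -(cdf_of_tail bw); apply: integral0_eq => x /=.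
  rewrite in_itv/= andbT => xk; rewrite lek//; apply: le_lt_trans (ler_norm k) _.
  by rewrite ltr_normr; apply/orP; left; lra.
have k1 : - `|k| - 1 <= `|k| + 1.
  by have := normr_ge0 k; lra.
have ex a : exists x, cdf_of w x = cdf_of gauss a.
  have /andP[a0 a1] := cdf_gauss_bounds a.
  have [] := @IVT R (cdf_of w) (- `|k| - 1) (`|k| + 1) (cdf_of gauss a) k1.
  - by apply: continuous_subspaceT; exact: continuous_cdf_of bw.
  - by rewrite F0 F1 ge_min le_max (ltW a0) (ltW a1) orbT.
  - by move=> x _ <-; exists x.
have [T FT] := choice ex.
have FleT x a : cdf_of w x < cdf_of gauss a -> x < T a.
  rewrite -FT => h; rewrite ltNge; apply/negP => /(cdf_of_nondecreasing bw).
  by move: h; lra.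
have TltF x a : cdf_of gauss a < cdf_of w x -> T a < x.
  rewrite -FT => h; rewrite ltNge; apply/negP => /(cdf_of_nondecreasing bw).
  by move: h; lra.
have ndT : {homo T : x y / x < y}.
  by move=> x y xy; apply: TltF; rewrite FT; exact: cdf_gauss_increasing.
have T1 x y : x < y -> T y - T x <= y - x.
  move=> xy; rewrite leNgt; apply/negP => lt.
  (* Half of the excess: widening [[x, y]] by [e] on both sides and translating yields exactly
     [[T x, T y]], while monotonicity of [cdf_of gauss] makes both comparisons strict. *)
  pose e := ((T y - T x) - (y - x)) / 2.
  have e0 : 0 < e by rewrite divr_gt0// subr_gt0.
  apply: (@slc1_no_crossing _ w M (x - e) (y + e) (T x - x + e) bw lcw).
  - lra.
  - rewrite (_ : x - e + (T x - x + e) = T x); last by ring.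
    by rewrite FT; apply: cdf_gauss_increasing; lra.
  - rewrite (_ : y + e + (T x - x + e) = T y); last by rewrite /e; field.
    by rewrite FT; apply: cdf_gauss_increasing; lra.
have mT : measurable_fun setT T.
  apply: nondecreasing_measurable => //= x y.
  by rewrite le_eqVlt => /predU1P[->//|/ndT/ltW].
exists T; split => // [x y|f mf f0].
  wlog xy : x y / x <= y => [wl|].
    have [|yx] := leP x y; first exact: wl.
    by rewrite distrC (distrC x); apply: wl; exact: ltW.
  move: xy; rewrite le_eqVlt => /predU1P[->|xy]; first by rewrite !subrr.
  rewrite distrC (distrC x) !ger0_norm ?subr_ge0 ?(ltW xy)//.
    exact: T1.
  exact/ltW/ndT.
pose mT' : measurable_fun setT (T : measurableTypeR R -> measurableTypeR R) := mT.
rewrite -(@ge0_integral_density _ _ _ leb w mw w0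
  (image_measure (normal_prob 0 1) mT'))//.
  by rewrite ge0_integral_pushforward.
move=> A mA.
apply: (@probability_ray_unique R (image_measure (normal_prob 0 1) mT')
  (density_measure leb mw w0) _ _ _ A mA) => //.
  by rewrite /= /pushforward preimage_setT probability_setT.
move=> x; rewrite /= /pushforward /density_measure.
rewrite -(cdf_ofE bw).
have /andP[u0 u1] := cdf_of_bounds bw x.
(* [cdf_of gauss] never takes the values 0 and 1, so no [a] matches these levels; the preimage of
   the ray is then empty or everything. *)
have [Fx0|Fx0] := eqVneq (cdf_of w x) 0.
  rewrite (_ : _ @^-1` _ = set0) ?measure0 ?Fx0//.
  apply/seteqP; split => // a /=; rewrite in_itv/= leNgt => /negP; apply.
  by apply: FleT; rewrite Fx0; have /andP[] := cdf_gauss_bounds a.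
have [Fx1|Fx1] := eqVneq (cdf_of w x) 1.
  rewrite (_ : _ @^-1` _ = setT) ?probability_setT ?Fx1//.
  apply/seteqP; split => // a _ /=; rewrite in_itv/=; apply/ltW/TltF.
  by rewrite Fx1; have /andP[] := cdf_gauss_bounds a.
have [a Ga] : exists a, cdf_of gauss a = cdf_of w x.
  by apply: cdf_gauss_onto; rewrite !lt_neqAle eq_sym Fx0 Fx1 u0.
have sub1 : `]-oo, a[%classic `<=` T @^-1` `]-oo, x].
  move=> b; rewrite /= !in_itv/= => ba; apply/ltW/TltF; rewrite -Ga.
  exact: cdf_gauss_increasing.
have sub2 : T @^-1` `]-oo, x] `<=` `]-oo, a]%classic.
  move=> b; rewrite /= !in_itv/= => Tbx; rewrite leNgt; apply/negP => ab.
  have := FleT x b; rewrite -Ga => /(_ (cdf_gauss_increasing ab)); lra.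
(* The preimage of the ray ends at [a], but may or may not contain it; a point has no mass. *)
have ray0 : normal_prob 0 1 `]-oo, a]%classic = normal_prob 0 1 `]-oo, a[%classic.
  rewrite (_ : `]-oo, a]%classic = `]-oo, a[ `|` [set a]); last first.
    apply/seteqP; split => b /=; rewrite !in_itv/= le_eqVlt.
      by move=> /predU1P[->|]; [right|left].
    by move=> [->|->]; rewrite ?orbT ?eqxx.
  rewrite measureU//; last first.
    by apply/seteqP; split => // b [/=]; rewrite in_itv/= => /[swap] ->; rewrite ltxx.
  rewrite [X in (_ + X)%E](_ : _ = 0%E) ?adde0//.
  have /null_content_dominatesP := @normal_prob_dominates R 0 1.
  by apply => //; exact: lebesgue_measure_set1.
rewrite -Ga -normal_prob_ray; apply/eqP; rewrite eq_le; apply/andP; split.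
  by apply: le_measure; rewrite ?inE// -[X in measurable X]setTI; exact: mT'.
by rewrite ray0; apply: le_measure; rewrite ?inE// -[X in measurable X]setTI; exact: mT'.
Qed.

End transport.

(** * The inequality on the line *)

Section line_case.
Context {R : realType}.
Local Notation leb := (@lebesgue_measure R).
Local Notation gauss := (@normal_pdf R 0 1).
Implicit Types (W p q psi : R -> R) (x y : R).

Lemma powR_half_le (x y : R) : 0 <= x -> 0 <= y -> x <= y ^+ 2 -> x `^ 2^-1 <= y.
Proof.
move=> x0 y0 xy; rewrite powR12_sqrt// -[leRHS](ger0_norm y0) -sqrtr_sqr.
exact: ler_wsqrtr.
Qed.

Let half01 : 0 < (2^-1 : R) < 1.
Proof. by rewrite invr_gt0 ltr0n/= invf_lt1// ltr1n. Qed.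

Let onem_half : 1 - 2^-1 = 2^-1 :> R. Proof. by field. Qed.

(** Reflecting the second function turns a difference into a sum: since [T] is 1-Lipschitz, [T x]
    and [T (- y)] are at most |x + y| apart, and half of this is the modulus of the midpoint [z] of
    [x] and [y], where [H] is evaluated. The Gaussian factors obey
    [gauss x * gauss y <= gauss z ^+ 2]. *)
Lemma line_bound_normalized W p q psi (M k K a b : R) :
  {homo W : x y / x <= y} -> (forall r, 0 <= W r) ->
  (\int[normal_prob 0 1]_r (W `|r|)%:E <= K%:E)%E ->
  bounded_density psi M -> slc1 psi -> (forall x, psi x != 0 -> `|x| <= k) ->
  measurable_fun setT p -> measurable_fun setT q ->
  (forall x, 0 <= p x <= M * psi x) -> (forall x, 0 <= q x <= M * psi x) ->
  (forall x y, p x * q y <= W (`|x - y| / 2) ^+ 2 * (psi x * psi y)) ->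
  (\int[leb]_x (p x)%:E = a%:E)%E -> (\int[leb]_x (q x)%:E = b%:E)%E ->
  a * b <= K ^+ 2.
Proof.
move=> ndW W0 WK bpsi lcpsi psik mp mq pM qM pq pa qb.
have [mpsi psiM ipsi] := bpsi.
have [T [ndT T1 iT]] := slc1_transport bpsi lcpsi psik.
have psi0 x : 0 <= psi x by have /andP[] := psiM x.
have M0 : 0 <= M by have /andP[h1 h2] := psiM 0; exact: le_trans h2.
have mT : measurable_fun setT T.
  apply: nondecreasing_measurable => //= x y.
  by rewrite le_eqVlt => /predU1P[->//|/ndT/ltW].
(* The inverse of 0 is 0, and a dominated [u] vanishes with [psi], so [quo u x * psi x = u x] holds
   everywhere. *)
pose quo (u : R -> R) x := u x / psi x.
have quo_bounds (u : R -> R) x : (forall x, 0 <= u x <= M * psi x) -> 0 <= quo u x <= M.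
  move=> uM; have /andP[u0 u1] := uM x.
  rewrite divr_ge0//=; have [z|nz] := eqVneq (psi x) 0.
    by rewrite /quo z invr0 mulr0.
  by rewrite ler_pdivrMr// lt0r nz psi0.
have quoK (u : R -> R) x : (forall x, 0 <= u x <= M * psi x) -> quo u x * psi x = u x.
  move=> uM; have /andP[u0 u1] := uM x.
  have [z|nz] := eqVneq (psi x) 0; last by rewrite mulfVK.
  by rewrite z mulr0; apply/eqP; rewrite eq_le u0 -(mulr0 M) -z u1.
have mquo (u : R -> R) : measurable_fun setT u -> measurable_fun setT (quo u).
  move=> mu; apply: measurable_funM => //.
  under eq_fun do rewrite -powR_inv1//.
  exact: (measurableT_comp (measurable_powR _)).
have move_int (u : R -> R) (c : R) : measurable_fun setT u -> (forall x, 0 <= u x <= M * psi x) ->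
    (\int[leb]_x (u x)%:E = c%:E)%E ->
    (\int[leb]_x (quo u (T x) * gauss x)%:E = c%:E)%E.
  move=> mu uM <-; transitivity (\int[leb]_x (quo u x * psi x)%:E)%E; last first.
    by apply: eq_integral => x _; rewrite quoK.
  under [RHS]eq_integral do rewrite EFinM.
  rewrite -iT; last 2 first.
  - by apply/measurable_EFinP; exact: mquo.
  - by move=> x; rewrite lee_fin; have /andP[] := quo_bounds u x uM.
  rewrite integral_normal_prob01//.
  - apply/measurable_EFinP; apply: measurableT_comp => //; exact: mquo.
  - by move=> x; rewrite lee_fin; have /andP[] := quo_bounds u (T x) uM.
pose F x := quo p (T x) * gauss x.
pose G x := quo q (T (- x)) * gauss x.
pose H x := W `|x| * gauss x.
have mg := @measurable_normal_pdf R 0 1.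
have g0 x : 0 <= gauss x by exact: normal_pdf_ge0.
have mF : measurable_fun setT F.
  apply: measurable_funM => //; apply: measurableT_comp => //; exact: mquo.
have mG : measurable_fun setT G.
  apply: measurable_funM => //; apply: measurableT_comp => //; first exact: mquo.
  by apply: measurableT_comp.
have mW : measurable_fun setT (fun x => W `|x|).
  apply: (measurableT_comp (nondecreasing_measurable _ _)) => //.
have mH : measurable_fun setT H by exact: measurable_funM.
have Fa : (\int[leb]_x (F x)%:E = a%:E)%E by exact: move_int.
have Gb : (\int[leb]_x (G x)%:E = b%:E)%E.
  rewrite -(move_int q b mq qM qb).
  rewrite -(@ge0_integral_opp _ (fun x => (quo q (T x) * gauss x)%:E)).
  - apply: eq_integral => x _; rewrite /G; congr (_ * _)%:E.
    by rewrite !gaussE sqrrN.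
  - apply/measurable_EFinP; apply: measurable_funM => //.
    by apply: measurableT_comp => //; exact: mquo.
  - by move=> x; rewrite lee_fin mulr_ge0//; have /andP[] := quo_bounds q (T x) qM.
pose c := @normal_peak R 1.
have bnd (u : R -> R) x y : (forall x, 0 <= u x <= M * psi x) ->
    0 <= quo u x * gauss y <= M * c.
  move=> uM; have /andP[u0 u1] := quo_bounds u x uM.
  rewrite mulr_ge0//=; apply: ler_pM => //.
  by apply: normal_pdf_ub; exact: oner_neq0.
have FGH x y : F x `^ (1 - 2^-1) * G y `^ 2^-1 <= H ((1 - 2^-1) * x + 2^-1 * y).
  have F0 : 0 <= F x by have /andP[] := bnd p (T x) x pM.
  have G0 : 0 <= G y by have /andP[] := bnd q (T (- y)) y qM.
  rewrite onem_half -powRM// -mulrDr.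
  set z := 2^-1 * (x + y).
  apply: powR_half_le; [exact: mulr_ge0|by rewrite mulr_ge0|].
  rewrite /F /G /H exprMn mulrACA; apply: ler_pM.
  - rewrite mulr_ge0//; [by have /andP[] := quo_bounds p (T x) pM|].
    by have /andP[] := quo_bounds q (T (- y)) qM.
  - by rewrite mulr_ge0.
  - have [zx|nzx] := eqVneq (psi (T x)) 0.
      by rewrite /quo zx invr0 mulr0 mul0r sqr_ge0.
    have [zy|nzy] := eqVneq (psi (T (- y))) 0.
      by rewrite /quo zy invr0 !mulr0 sqr_ge0.
    rewrite /quo mulrACA -invfM ler_pdivrMr; last first.
      by rewrite mulr_gt0 ?lt0r ?nzx ?nzy ?psi0.
    apply: le_trans (pq _ _) _; rewrite ler_wpM2r ?mulr_ge0//.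
    rewrite lerXn2r ?nnegrE//; apply: ndW.
    rewrite /z normrM ger0_norm ?invr_ge0// mulrC ler_pM2l ?invr_gt0//.
    by have := T1 x (- y); rewrite opprK.
  - rewrite !gaussE exprMn mulrACA -expr2 ler_wpM2l ?sqr_ge0//.
    rewrite -expRD -expRM_natl ler_expR /z.
    by have := sqr_ge0 (x - y); nra.
have := prekopa_leindler half01 mF mG mH _ _ FGH Fa Gb.
move=> /(_ (M * c)) PL.
have ab0 : 0 <= a /\ 0 <= b.
  by split; rewrite -lee_fin -?pa -?qb; apply: integral_ge0 => x _;
    rewrite lee_fin; [have /andP[] := pM x|have /andP[] := qM x].
have K0 : 0 <= K.
  by rewrite -lee_fin; apply: le_trans WK; apply: integral_ge0 => x _; rewrite lee_fin.
have : ((a `^ (1 - 2^-1) * b `^ 2^-1)%:E <= K%:E)%E.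
  apply: le_trans (PL _ _) _.
  - by move=> x; exact: bnd.
  - by move=> x; exact: bnd.
  apply: le_trans WK; rewrite integral_normal_prob01//.
    exact/measurable_EFinP.
  by move=> x; rewrite lee_fin.
case: ab0 => a0 b0.
rewrite lee_fin onem_half -powRM// powR12_sqrt ?mulr_ge0// => h.
rewrite -(sqr_sqrtr (mulr_ge0 a0 b0)) lerXn2r ?nnegrE// sqrtr_ge0//.
Qed.

(** Both sides are homogeneous of degree 2 when [p], [q] and [psi] are scaled together, so [psi] may
    be divided by its mass; mass 0 forces [a = 0]. *)
Lemma line_bound W p q psi (M k K a b z : R) :
  {homo W : x y / x <= y} -> (forall r, 0 <= W r) ->
  (\int[normal_prob 0 1]_r (W `|r|)%:E <= K%:E)%E ->
  measurable_fun setT psi -> (forall x, 0 <= psi x <= M) ->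
  slc1 psi -> (forall x, psi x != 0 -> `|x| <= k) ->
  measurable_fun setT p -> measurable_fun setT q ->
  (forall x, 0 <= p x <= M * psi x) -> (forall x, 0 <= q x <= M * psi x) ->
  (forall x y, p x * q y <= W (`|x - y| / 2) ^+ 2 * (psi x * psi y)) ->
  (\int[leb]_x (p x)%:E = a%:E)%E -> (\int[leb]_x (q x)%:E = b%:E)%E ->
  (\int[leb]_x (psi x)%:E = z%:E)%E ->
  a * b <= K ^+ 2 * z ^+ 2.
Proof.
move=> ndW W0 WK mpsi psiM lcpsi psik mp mq pM qM pq pa qb psiz.
have psi0 x : 0 <= psi x by have /andP[] := psiM x.
have p0 x : 0 <= p x by have /andP[] := pM x.
have q0 x : 0 <= q x by have /andP[] := qM x.
have M0 : 0 <= M by have /andP[h1 h2] := psiM 0; exact: le_trans h2.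
have z0 : 0 <= z.
  by rewrite -lee_fin -psiz; apply: integral_ge0 => x _; rewrite lee_fin.
have K0 : 0 <= K.
  by rewrite -lee_fin; apply: le_trans WK; apply: integral_ge0 => x _; rewrite lee_fin.
move: z0; rewrite le_eqVlt => /predU1P[z0|z0].
  suff -> : a = 0 by rewrite mul0r mulr_ge0 ?sqr_ge0.
  apply: le_anti; rewrite -!lee_fin -pa; apply/andP; split; last first.
    by apply: integral_ge0 => x _; rewrite lee_fin.
  apply: (@le_trans _ _ (\int[leb]_x (M%:E * (psi x)%:E))%E).
    apply: ge0_le_integral => //=.
    - by move=> x _; rewrite lee_fin.
    - exact/measurable_EFinP.
    - by apply: measurable_funeM; exact/measurable_EFinP.
    - by move=> x _; rewrite -EFinM lee_fin; have /andP[] := pM x.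
  rewrite ge0_integralZl//= ?psiz -?z0 ?mule0//.
  - exact/measurable_EFinP.
  - by move=> x _; rewrite lee_fin.
have scale (u : R -> R) (c : R) : measurable_fun setT u -> (forall x, 0 <= u x) ->
    (\int[leb]_x (u x)%:E = c%:E)%E -> (\int[leb]_x (z^-1 * u x)%:E = (z^-1 * c)%:E)%E.
  move=> mu u0 uc; under eq_integral do rewrite EFinM.
  rewrite ge0_integralZl//= ?uc// ?lee_fin ?invr_ge0 ?ltW//.
  - exact/measurable_EFinP.
  - by move=> x _; rewrite lee_fin.
(* [M] bounds both [psi] and the ratios of [p] and [q] to it; dividing by [z] rescales only the
   first bound, and [N] covers both. *)
pose N := Num.max M (z^-1 * M).
have MN : M <= N by rewrite le_max lexx.
have zM x (u : R) : 0 <= u <= M * psi x -> 0 <= z^-1 * u <= N * (z^-1 * psi x).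
  move=> /andP[u0 uM]; rewrite mulr_ge0 ?invr_ge0 ?(ltW z0)//= mulrCA.
  rewrite ler_pM2l ?invr_gt0//; apply: le_trans uM _.
  by rewrite ler_wpM2r.
have : z^-1 * a * (z^-1 * b) <= K ^+ 2.
  apply: (@line_bound_normalized W (fun x => z^-1 * p x) (fun x => z^-1 * q x)
    (fun x => z^-1 * psi x) N k) => //.
  - split.
    + exact: measurable_funM.
    + move=> x; rewrite mulr_ge0 ?invr_ge0 ?(ltW z0)//= le_max; apply/orP; right.
      by rewrite ler_pM2l ?invr_gt0//; have /andP[] := psiM x.
    + by rewrite (scale _ _ mpsi psi0 psiz) mulVf ?gt_eqF.
  - move=> x y t t01; have /andP[t0 t1] := t01.
    rewrite !powRM ?invr_ge0 ?psi0 ?(ltW z0)//.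
    have zE : z^-1 = z^-1 `^ (1 - t) * z^-1 `^ t.
      rewrite -powRD ?subrK ?powRr1 ?invr_ge0 ?ltW//.
      by rewrite invr_eq0 (gt_eqF z0) implybT.
    rewrite mulrACA -zE -[leLHS]mulrA ler_pM2l ?invr_gt0//; exact: lcpsi.
  - move=> x; rewrite mulf_eq0 negb_or => /andP[_]; exact: psik.
  - exact: measurable_funM.
  - exact: measurable_funM.
  - by move=> x; exact: zM.
  - by move=> x; exact: zM.
  - move=> x y; rewrite (mulrACA _ (p x)) (mulrACA _ (psi x)) [leRHS]mulrCA.
    by rewrite ler_wpM2l// mulr_ge0 ?invr_ge0 ?(ltW z0).
  - exact: scale.
  - exact: scale.
rewrite mulrACA -invfM mulrC ler_pdivrMr ?mulr_gt0//.
Qed.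

End line_case.

(** * Planar convex sets avoiding a grid *)

Section planar_slab.
Context {R : realType}.

Lemma grid_exists (k d : R) : 0 < d -> exists ps : seq (R * R),
  forall c1 c2, `|c1| <= k -> `|c2| <= k ->
    exists2 p, p \in ps & `|c1 - p.1| <= d /\ `|c2 - p.2| <= d.
Proof.
move=> d0.
pose pt i := - k + i%:R * d.
pose N := (Num.truncn (2 * k / d)).+1.
exists [seq (pt i, pt j) | i <- iota 0 N, j <- iota 0 N].
have near1 c : `|c| <= k -> exists2 i, i \in iota 0 N & `|c - pt i| <= d.
  rewrite ler_norml => /andP[kc ck].
  have c0 : 0 <= (c + k) / d by apply: divr_ge0; [lra|exact: ltW].
  have /andP[i1 i2] := truncn_itv c0.
  exists (Num.truncn ((c + k) / d)).
    rewrite mem_iota/= add0n /N ltnS; apply: le_truncn.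
    by rewrite ler_pM2r ?invr_gt0//; lra.
  move: i1 i2; rewrite ler_pdivlMr// ltr_pdivrMr// -[_.+1%:R]natr1 => i1 i2.
  by rewrite /pt ler_norml; apply/andP; split; lra.
move=> c1 c2 /near1[i iN ci] /near1[j jN cj].
by exists (pt i, pt j) => //; apply/allpairsP; exists (i, j).
Qed.

(** If the triangle is large compared with [d], then [p] lies strictly inside it: its barycentric
    coordinates are proportional to [l1], [l2], [l3]. At the centroid each is a third of the doubled
    area, and moving to [p] changes it by at most [2 * D * d], whence the 6. An affine form
    vanishing at [p] and nonnegative at the vertices then vanishes at all three. *)
Lemma halfplane_near_centroid (x1 x2 y1 y2 z1 z2 p1 p2 a b d D : R) :
  `|x1 - y1| <= D -> `|x2 - y2| <= D -> `|y1 - z1| <= D -> `|y2 - z2| <= D ->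
  `|z1 - x1| <= D -> `|z2 - x2| <= D -> 0 <= d ->
  `|(x1 + y1 + z1) / 3 - p1| <= d -> `|(x2 + y2 + z2) / 3 - p2| <= d ->
  6 * D * d < (y1 - x1) * (z2 - x2) - (y2 - x2) * (z1 - x1) ->
  0 <= a * (x1 - p1) + b * (x2 - p2) -> 0 <= a * (y1 - p1) + b * (y2 - p2) ->
  0 <= a * (z1 - p1) + b * (z2 - p2) -> a = 0 /\ b = 0.
Proof.
move=> xy1 xy2 yz1 yz2 zx1 zx2 d0 g1 g2 big hx hy hz.
have pert u1 u2 : `|u1| <= D -> `|u2| <= D ->
   `|u1 * ((x2 + y2 + z2) / 3 - p2) - u2 * ((x1 + y1 + z1) / 3 - p1)| <= 2 * D * d.
  move=> u1D u2D; apply: le_trans (ler_normB _ _) _; rewrite !normrM.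
  rewrite (_ : 2 * D * d = D * d + D * d); last by ring.
  by apply: lerD; apply: ler_pM.
pose l1 := (y1 - p1) * (z2 - p2) - (y2 - p2) * (z1 - p1).
pose l2 := (z1 - p1) * (x2 - p2) - (z2 - p2) * (x1 - p1).
pose l3 := (x1 - p1) * (y2 - p2) - (x2 - p2) * (y1 - p1).
have l1_gt0 : 0 < l1.
  have := pert _ _ yz1 yz2; rewrite ler_norml => /andP[+ _].
  by rewrite /l1; lra.
have l2_gt0 : 0 < l2.
  have := pert _ _ zx1 zx2; rewrite ler_norml => /andP[+ _].
  by rewrite /l2; lra.
have l3_gt0 : 0 < l3.
  have := pert _ _ xy1 xy2; rewrite ler_norml => /andP[+ _].
  by rewrite /l3; lra.
have bary : l1 * (a * (x1 - p1) + b * (x2 - p2)) +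
    l2 * (a * (y1 - p1) + b * (y2 - p2)) +
    l3 * (a * (z1 - p1) + b * (z2 - p2)) = 0 by rewrite /l1 /l2 /l3; ring.
have hx1 := mulr_ge0 (ltW l1_gt0) hx.
have hy1 := mulr_ge0 (ltW l2_gt0) hy.
have hz1 := mulr_ge0 (ltW l3_gt0) hz.
have /eqP : l1 * (a * (x1 - p1) + b * (x2 - p2)) = 0 by lra.
rewrite mulf_eq0 gt_eqF//= => /eqP ex.
have /eqP : l2 * (a * (y1 - p1) + b * (y2 - p2)) = 0 by lra.
rewrite mulf_eq0 gt_eqF//= => /eqP ey.
(* Cramer's rule recovers [a] and [b] from the values of the form at [x] and [y]. *)
have al3 : a * l3 = (a * (x1 - p1) + b * (x2 - p2)) * (y2 - p2) -
    (a * (y1 - p1) + b * (y2 - p2)) * (x2 - p2) by rewrite /l3; ring.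
have bl3 : b * l3 = (a * (y1 - p1) + b * (y2 - p2)) * (x1 - p1) -
    (a * (x1 - p1) + b * (x2 - p2)) * (y1 - p1) by rewrite /l3; ring.
rewrite ex ey !mul0r subrr in al3 bl3.
by split; apply/eqP; [move/eqP: al3|move/eqP: bl3];
  rewrite mulf_eq0 (gt_eqF l3_gt0) orbF.
Qed.

(** This is the trace of convexity that the argument keeps: [p] is not interior to the convex hull
    of [S]. *)
Definition in_halfplane_at (S : set (R * R)) (p : R * R) := exists a b : R,
  ~ (a = 0 /\ b = 0) /\
  forall v, S v -> 0 <= a * (v.1 - p.1) + b * (v.2 - p.2).

(** Take two points of [S] almost realizing its diameter. If the strip of half-width [e] about their
    line misses a point of [S], the triangle so formed is large, and its centroid, which stays in
    the box, has a grid point nearby through which no half-plane contains the triangle. *)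
Lemma grid_slab (k e : R) : 0 < e -> exists ps : seq (R * R),
  forall S : set (R * R),
  (forall v, S v -> `|v.1| <= k /\ `|v.2| <= k) ->
  (forall p, p \in ps -> in_halfplane_at S p) ->
  exists al be ka : R, al ^+ 2 + be ^+ 2 = 1 /\
    forall v, S v -> `|al * v.1 + be * v.2 - ka| <= e.
Proof.
(* The doubled area below exceeds [e * L], hence [D * e / 2], which is the threshold [6 * D * d] of
   [halfplane_near_centroid] for [d = e / 12]. *)
move=> e0; have d0 : 0 < e / 12 by rewrite divr_gt0.
have [ps psP] := grid_exists k d0; exists ps => S Sk Sps.
have [S0|/set0P[v0 Sv0]] := eqVneq S set0.
  by exists 1, 0, 0; split; [rewrite expr1n expr0n/= addr0|rewrite S0].
pose dist (v w : R * R) := Num.max `|v.1 - w.1| `|v.2 - w.2|.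
pose E := [set r | exists v w, [/\ S v, S w & r = dist v w]].
have hE : has_sup E.
  split; first by exists (dist v0 v0), v0, v0.
  exists (2 * k) => _ [v [w [Sv Sw ->]]].
  have [v1 v2] := Sk _ Sv; have [w1 w2] := Sk _ Sw.
  by rewrite ge_max; apply/andP; split; apply: le_trans (ler_normB _ _) _; lra.
pose D := sup E.
have distD v w : S v -> S w -> `|v.1 - w.1| <= D /\ `|v.2 - w.2| <= D.
  move=> Sv Sw; have : dist v w <= D.
    by apply: ub_le_sup; [exact: hE.2|exists v, w].
  by rewrite ge_max => /andP[].
have [De|eD] := leP D e.
  exists 1, 0, v0.1; split; first by rewrite expr1n expr0n/= addr0.
  move=> v Sv; rewrite mul1r mul0r addr0.
  by apply: le_trans De; have [] := distD _ _ Sv Sv0.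
have D0 : 0 < D by exact: lt_trans eD.
have D2 : 0 < D / 2 by rewrite divr_gt0.
have [_ [x [y [Sx Sy ->]]] xyD] := sup_adherent D2 hE.
pose u1 := y.1 - x.1; pose u2 := y.2 - x.2.
pose L := Num.sqrt (u1 ^+ 2 + u2 ^+ 2).
have L2 : L ^+ 2 = u1 ^+ 2 + u2 ^+ 2 by rewrite sqr_sqrtr// addr_ge0// sqr_ge0.
have LD : D / 2 < L.
  have {xyD} : D / 2 < dist x y by move: xyD; rewrite -/D; lra.
  move/lt_le_trans; apply.
  rewrite ge_max -!sqrtr_sqr; apply/andP; split; apply: ler_wsqrtr.
    by rewrite -[leLHS]sqrrN opprB lerDl sqr_ge0.
  by rewrite -[leLHS]sqrrN opprB lerDr sqr_ge0.
have L0 : 0 < L by exact: lt_trans LD.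
(* Doubled signed area of the triangle [x], [y], [z]; over [L] it is the signed distance from [z] to
   the line through [x] and [y]. *)
pose cr (z : R * R) := u1 * (z.2 - x.2) - u2 * (z.1 - x.1).
have [flat|] := pselect (forall z, S z -> `|cr z| <= e * L).
  exists (- u2 / L), (u1 / L), ((u1 * x.2 - u2 * x.1) / L); split.
    by rewrite !expr_div_n L2 -mulrDl sqrrN addrC divff// -L2 sqrf_eq0 gt_eqF.
  move=> z Sz; rewrite (_ : _ - _ = cr z / L); last by rewrite /cr; field; rewrite gt_eqF.
  by rewrite normrM normfV (gtr0_norm L0) ler_pdivrMr// flat.
move=> /existsNP[z /not_implyP[Sz /negP]]; rewrite -ltNge => crz.
have crD : D * e / 2 < `|cr z|.
  by apply: lt_trans crz; rewrite mulrAC mulrC ltr_pM2l.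
exfalso.
have cbox : `|(x.1 + y.1 + z.1) / 3| <= k /\ `|(x.2 + y.2 + z.2) / 3| <= k.
  have [] := Sk _ Sx; have [] := Sk _ Sy; have [] := Sk _ Sz.
  by rewrite !ler_norml => /andP[? ?] /andP[? ?] /andP[? ?] /andP[? ?] /andP[? ?]
    /andP[? ?]; split; apply/andP; split; lra.
have [p pps [pc1 pc2]] := psP _ _ cbox.1 cbox.2.
have [a [b [ab0 abS]]] := Sps _ pps.
apply: ab0.
have [xy1 xy2] := distD _ _ Sx Sy; have [yz1 yz2] := distD _ _ Sy Sz.
have [zx1 zx2] := distD _ _ Sz Sx.
have [pos|neg] := leP 0 (cr z).
  apply: (halfplane_near_centroid xy1 xy2 yz1 yz2 zx1 zx2 (ltW d0) pc1 pc2).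
  - by move: crD; rewrite ger0_norm// /cr /u1 /u2; lra.
  - exact: abS.
  - exact: abS.
  - exact: abS.
(* A clockwise triangle is read in the order [x], [z], [y]. *)
rewrite distrC in xy1; rewrite distrC in xy2; rewrite distrC in yz1.
rewrite distrC in yz2; rewrite distrC in zx1; rewrite distrC in zx2.
apply: (halfplane_near_centroid zx1 zx2 yz1 yz2 xy1 xy2 (ltW d0)
  (x1 := x.1) (x2 := x.2) (y1 := z.1) (y2 := z.2) (z1 := y.1) (z2 := y.2)
  (p1 := p.1) (p2 := p.2)).
- by rewrite addrAC.
- by rewrite addrAC.
- by move: crD; rewrite ltr0_norm// /cr /u1 /u2; lra.
- exact: abS.
- exact: abS.
- exact: abS.
Qed.

End planar_slab.

(** * Rotations and strong log-concavity *)

Section shears.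
Context {R : realType}.
Local Notation leb := (@lebesgue_measure R).
Local Notation mR := (measurableTypeR R).
Implicit Types (F : mR * mR -> \bar R).

Let measurable_pair_comp F (g1 g2 : mR * mR -> mR) : measurable_fun setT F ->
  measurable_fun setT g1 -> measurable_fun setT g2 ->
  measurable_fun setT (fun p => F (g1 p, g2 p)).
Proof.
by move=> mF m1 m2; apply: (measurableT_comp mF); exact: measurable_fun_pair.
Qed.

Let integral_shear2 F (b : R) : measurable_fun setT F -> (forall p, 0 <= F p)%E ->
  (\int[leb]_s \int[leb]_t F (s, (t + b * s)%R) =
   \int[leb]_s \int[leb]_t F (s, t))%E.
Proof.
move=> mF F0; apply: eq_integral => s _.
apply: (@ge0_integral_shift _ (fun t => F (s, t))) => //.
exact: (measurableT_comp mF (measurable_pair1 s)).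
Qed.

Let integral_shear1 F (a : R) : measurable_fun setT F -> (forall p, 0 <= F p)%E ->
  (\int[leb]_s \int[leb]_t F ((s + a * t)%R, t) =
   \int[leb]_s \int[leb]_t F (s, t))%E.
Proof.
move=> mF F0.
have swap (G : mR * mR -> \bar R) : measurable_fun setT G -> (forall p, 0 <= G p)%E ->
    (\int[leb]_s \int[leb]_t G (s, t) = \int[leb]_t \int[leb]_s G (s, t))%E.
  by move=> mG G0; exact: (@fubini_tonelli _ _ _ _ _ leb leb G mG G0).
rewrite (swap F)// (swap (fun p => F ((p.1 + a * p.2)%R, p.2)))//.
  apply: eq_integral => t _.
  apply: (@ge0_integral_shift _ (fun s => F (s, t)) (a * t)) => //.
  exact: (measurableT_comp mF (measurable_pair2 t)).
apply: measurable_pair_comp => //; apply: measurable_funD => //.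
exact: measurable_funM.
Qed.

(* A rotation is a product of three shears. *)
Lemma integral_rotation F (a b : R) : a ^+ 2 + b ^+ 2 = 1 -> 0 <= a ->
  measurable_fun setT F -> (forall p, 0 <= F p)%E ->
  (\int[leb]_s \int[leb]_t F ((a * s - b * t)%R, (b * s + a * t)%R) =
   \int[leb]_s \int[leb]_t F (s, t))%E.
Proof.
(* With [a] and [b] the cosine and sine of the angle, [c] is minus the tangent of half the angle;
   [0 <= a] keeps [1 + a] away from 0. *)
move=> ab a0 mF F0; pose c := - (b / (1 + a)).
have a1 : 1 + a != 0 by rewrite gt_eqF//; lra.
have c2 : c * (1 + a) = - b by rewrite /c mulNr divfK.
have cb : 1 + c * b = a.
  apply: (mulIf a1).
  have -> : (1 + c * b) * (1 + a) = 1 + a + c * (1 + a) * b by ring.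
  by rewrite c2; lra.
pose F1 p := F ((p.1 + c * p.2)%R, p.2).
pose F2 p := F1 (p.1, (p.2 + b * p.1)%R).
have mF1 : measurable_fun setT F1.
  apply: measurable_pair_comp => //; apply: measurable_funD => //.
  exact: measurable_funM.
have mF2 : measurable_fun setT F2.
  apply: measurable_pair_comp => //; apply: measurable_funD => //.
  exact: measurable_funM.
rewrite -(integral_shear1 c mF F0) -(integral_shear2 b mF1 (fun=> F0 _)).
rewrite -(integral_shear1 c mF2 (fun=> F0 _)).
apply: eq_integral => s _; apply: eq_integral => t _.
rewrite /F2 /F1 /=; congr (F (_, _)); last by rewrite -cb; ring.
have -> : s + c * t + c * (t + b * (s + c * t)) =
  (1 + c * b) * s + c * (1 + (1 + c * b)) * t by ring.
by rewrite cb c2; ring.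
Qed.

End shears.

(** * Row vectors: iterated integrals, strong log-concavity, rotations *)

Section rV.
Context {R : realType}.
Local Notation leb := (@lebesgue_measure R).
Local Notation lebn := (lebesgue_rV R).
Local Notation mR := (measurableTypeR R).

Lemma integral_rV_cons1 n (F : 'rV[R]_n.+1 -> \bar R) : measurable_fun setT F ->
  (forall x, 0 <= F x)%E ->
  (\int[lebn n.+1]_x F x = \int[leb]_x \int[lebn n]_v F (rV_cons (x, v)))%E.
Proof.
move=> mF F0; rewrite /= ge0_integral_pushforward//=.
  rewrite fubini_tonelli1//.
  by apply: (measurableT_comp mF); exact: measurable_rV_cons.
exact: measurable_rV_cons.
Qed.

Lemma integral_rV_cons2 n (F : 'rV[R]_n.+1 -> \bar R) : measurable_fun setT F ->
  (forall x, 0 <= F x)%E ->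
  (\int[lebn n.+1]_x F x = \int[lebn n]_v \int[leb]_x F (rV_cons (x, v)))%E.
Proof.
move=> mF F0; rewrite /= ge0_integral_pushforward//=.
  rewrite fubini_tonelli2//.
  by apply: (measurableT_comp mF); exact: measurable_rV_cons.
exact: measurable_rV_cons.
Qed.

Lemma measurable_section n (u : 'rV[R]_n.+1 -> R) v : measurable_fun setT u ->
  measurable_fun setT (fun x : R => u (rV_cons (x, v))).
Proof.
move=> mu; apply: (measurableT_comp mu).
exact: (measurableT_comp (@measurable_rV_cons R n) (measurable_pair2 v)).
Qed.

Lemma rV_cons_comb n (a b x y : R) (v w : 'rV[R]_n) :
  a *: rV_cons (x, v) + b *: rV_cons (y, w) =
  rV_cons (a * x + b * y, a *: v + b *: w).
Proof.
apply/rowP => i; rewrite mxE [X in X + _]mxE [X in _ + X]mxE.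
case: (unliftP ord0 i) => [j|] ->; last by rewrite !rV_cons0.
by rewrite !rV_consS/= !mxE.
Qed.

Lemma enorm_ge0 n (v : 'rV[R]_n) : 0 <= enorm v.
Proof. exact: sqrtr_ge0. Qed.

Lemma enorm_rV_consB n (x y : R) (v w : 'rV[R]_n) :
  enorm (rV_cons (x, v) - rV_cons (y, w)) ^+ 2 =
  (x - y) ^+ 2 + enorm (v - w) ^+ 2.
Proof.
have BE (u u' : 'rV[R]_n.+1) i : (u - u') 0 i = u 0 i - u' 0 i.
  by rewrite mxE [X in _ + X]mxE.
rewrite !enorm_sqr big_ord_recl BE !rV_cons0; congr (_ + _).
by apply: eq_bigr => i _; rewrite BE !rV_consS/= !mxE.
Qed.

Lemma enorm_rV_consB_le n (x y : R) (v w : 'rV[R]_n) :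
  enorm (rV_cons (x, v) - rV_cons (y, w)) <= `|x - y| + enorm (v - w).
Proof.
have e0 := enorm_ge0 (v - w).
rewrite -(@ler_pXn2r _ 2)// ?nnegrE ?addr_ge0 ?enorm_ge0//.
rewrite enorm_rV_consB [leRHS]sqrrD real_normK ?num_real// addrAC lerDl.
by rewrite mulrn_wge0// mulr_ge0.
Qed.

Definition slc n (psi : 'rV[R]_n -> R) := forall x y t, 0 < t < 1 ->
  psi x `^ (1 - t) * psi y `^ t *
    expR (t * (1 - t) / 2 * enorm (x - y) ^+ 2) <=
  psi ((1 - t) *: x + t *: y).

Definition rV_head2 n (w : 'rV[R]_n.+2) : R * R :=
  (w 0 ord0, w 0 (lift ord0 ord0)).

Definition rV_rot n (a b : R) (w : 'rV[R]_n.+2) : 'rV[R]_n.+2 :=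
  rV_cons (a * (rV_head2 w).1 - b * (rV_head2 w).2,
    rV_cons (b * (rV_head2 w).1 + a * (rV_head2 w).2,
      \row_i w 0 (lift ord0 (lift ord0 i)))).

Lemma rV_rot_cons n (a b s t : R) (z : 'rV[R]_n) :
  rV_rot a b (rV_cons (s, rV_cons (t, z))) =
  rV_cons (a * s - b * t, rV_cons (b * s + a * t, z)).
Proof.
rewrite /rV_rot /= !rV_consS !rV_cons0; congr (rV_cons (_, rV_cons (_, _))).
by apply/rowP => i; rewrite mxE !rV_consS.
Qed.

Lemma rV_rot_comb n (a b c d : R) (v w : 'rV[R]_n.+2) :
  rV_rot a b (c *: v + d *: w) = c *: rV_rot a b v + d *: rV_rot a b w.
Proof.
rewrite !rV_cons_comb /rV_rot /= !mxE; congr (rV_cons (_, rV_cons (_, _))).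
- by ring.
- by ring.
- by apply/rowP => i; rewrite !mxE.
Qed.

Lemma enorm_rV_rotB n (a b : R) (v w : 'rV[R]_n.+2) : a ^+ 2 + b ^+ 2 = 1 ->
  enorm (rV_rot a b v - rV_rot a b w) = enorm (v - w).
Proof.
move=> ab; apply/eqP; rewrite -(@eqrXn2 _ 2)// ?enorm_ge0//; apply/eqP.
rewrite /rV_rot !enorm_rV_consB !enorm_sqr [in RHS]big_ord_recl big_ord_recl.
rewrite !addrA !mxE; congr (_ + _); last first.
  by apply: eq_bigr => i _; rewrite !mxE.
rewrite -[RHS]mul1r -ab /=; ring.
Qed.

Lemma measurable_rV_rot n (a b : R) : measurable_fun setT (@rV_rot n a b).
Proof.
have mc i := @measurable_coord R 1 n.+2 0 i.
apply: (measurableT_comp (@measurable_rV_cons R n.+1)); apply: measurable_fun_pair.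
  by apply: measurable_funB; apply: measurable_funM => //; exact: mc.
apply: (measurableT_comp (@measurable_rV_cons R n)); apply: measurable_fun_pair.
  by apply: measurable_funD; apply: measurable_funM => //; exact: mc.
apply: measurable_fun_mx => i j.
by under eq_fun do rewrite mxE; exact: mc.
Qed.

(** Integrating out the other coordinates leaves a function of two variables, to which the planar
    rotation applies. *)
Lemma integral_rV_rot n (F : 'rV[R]_n.+2 -> \bar R) (a b : R) :
  a ^+ 2 + b ^+ 2 = 1 -> 0 <= a -> measurable_fun setT F ->
  (forall x, 0 <= F x)%E ->
  (\int[lebn n.+2]_x F (rV_rot a b x) = \int[lebn n.+2]_x F x)%E.
Proof.
move=> ab a0 mF F0.
pose G (p : mR * mR) := (\int[lebn n]_z F (rV_cons (p.1, rV_cons (p.2, z))))%E.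
have step (H : 'rV[R]_n.+2 -> \bar R) : measurable_fun setT H -> (forall x, 0 <= H x)%E ->
    (\int[lebn n.+2]_x H x = \int[leb]_s \int[leb]_t \int[lebn n]_z
      H (rV_cons (s, rV_cons (t, z))))%E.
  move=> mH H0; rewrite integral_rV_cons1//; apply: eq_integral => s _.
  rewrite integral_rV_cons1//; apply: (measurableT_comp mH).
  exact: (measurableT_comp (@measurable_rV_cons R _) (measurable_pair1 s)).
have mG : measurable_fun setT G.
  apply: (@measurable_fun_fubini_tonelli_F _ _ _ _ _ (lebn n)
    (fun q : (mR * mR) * 'rV[R]_n =>
      F (rV_cons (q.1.1, rV_cons (q.1.2, q.2))))) => //.
  apply: (measurableT_comp mF).
  apply: (measurableT_comp (@measurable_rV_cons R _)).
  apply: measurable_fun_pair.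
    by apply: measurableT_comp.
  apply: (measurableT_comp (@measurable_rV_cons R _)).
  apply: measurable_fun_pair => //.
  by apply: measurableT_comp.
have mFr : measurable_fun setT (fun x => F (rV_rot a b x)).
  by apply: (measurableT_comp mF); exact: measurable_rV_rot.
have G0 p : (0 <= G p)%E by apply: integral_ge0.
rewrite (step _ mFr (fun=> F0 _)) [RHS](step _ mF F0).
apply: etrans (integral_rotation ab a0 mG G0).
apply: eq_integral => s _; apply: eq_integral => t _.
by apply: eq_integral => z _; rewrite rV_rot_cons.
Qed.

End rV.

(** * Marginals *)

Section admissible.
Context {R : realType}.
Local Notation leb := (@lebesgue_measure R).
Local Notation lebn := (lebesgue_rV R).
Implicit Types (W : R -> R) (M k : R).

(** One constant [M] bounds the density and the ratios of [p] and [q] to it; [k] is the half-side of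
    a cube carrying the density. *)
Record admissible n W M k (p q psi : 'rV[R]_n -> R) : Prop := Admissible {
  adm_mp : measurable_fun setT p;
  adm_mq : measurable_fun setT q;
  adm_mpsi : measurable_fun setT psi;
  adm_psi : forall x, 0 <= psi x <= M;
  adm_supp : forall x, psi x != 0 -> forall i, `|x 0 i| <= k;
  adm_slc : slc psi;
  adm_p : forall x, 0 <= p x <= M * psi x;
  adm_q : forall x, 0 <= q x <= M * psi x;
  adm_pq : forall x y, p x * q y <= W (enorm (x - y) / 2) ^+ 2 * (psi x * psi y) }.

(** The inverse rotation expresses each of the two coordinates as a sum of two terms of size at most
    [k], hence the support bound [2 * k]. *)
Lemma admissible_rot n W M k (p q psi : 'rV[R]_n.+2 -> R) (a b : R) :
  a ^+ 2 + b ^+ 2 = 1 -> 0 <= k ->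
  admissible W M k p q psi ->
  admissible W M (2 * k) (p \o rV_rot a b) (q \o rV_rot a b) (psi \o rV_rot a b).
Proof.
move=> ab k0 [mp mq mpsi psiM psik lcpsi pM qM pq].
have mrot := @measurable_rV_rot R n a b.
have a1 : `|a| <= 1.
  by rewrite -(@ler_pXn2r _ 2)// ?nnegrE// expr1n real_normK ?num_real// -ab lerDl sqr_ge0.
have b1 : `|b| <= 1.
  by rewrite -(@ler_pXn2r _ 2)// ?nnegrE// expr1n real_normK ?num_real// -ab lerDr sqr_ge0.
split; try by [exact: measurableT_comp|move=> x; rewrite /=].
- move=> x /= /psik xk.
  have x0 := xk ord0; have x1 := xk (lift ord0 ord0).
  rewrite /rV_rot rV_cons0 /= in x0; rewrite /rV_rot rV_consS rV_cons0 /= in x1.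
  set s := x 0 ord0 in x0 x1; set t := x 0 (lift ord0 ord0) in x0 x1.
  have sE : s = a * (a * s - b * t) + b * (b * s + a * t).
    by rewrite -[LHS]mul1r -ab; ring.
  have tE : t = a * (b * s + a * t) - b * (a * s - b * t).
    by rewrite -[LHS]mul1r -ab; ring.
  have bound c u : `|c| <= 1 -> `|u| <= k -> `|c * u| <= k.
    by move=> c1 uk; rewrite normrM -[k]mul1r; apply: ler_pM.
  move=> i; case: (unliftP ord0 i) => [j|] ->; last first.
    rewrite -/s sE; apply: le_trans (ler_normD _ _) _.
    by rewrite (_ : 2 * k = k + k); [apply: lerD; exact: bound|ring].
  case: (unliftP ord0 j) => [l|] ->; last first.
    rewrite -/t tE; apply: le_trans (ler_normB _ _) _.
    by rewrite (_ : 2 * k = k + k); [apply: lerD; exact: bound|ring].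
  have := xk (lift ord0 (lift ord0 l)); rewrite /rV_rot !rV_consS mxE.
  by move/le_trans; apply; lra.
- move=> x y t t01 /=; rewrite rV_rot_comb -(enorm_rV_rotB x y ab).
  exact: lcpsi.
- by move=> x y /=; rewrite -(enorm_rV_rotB x y ab).
Qed.

(** [fine] would turn an infinite fibre integral into 0; the slab below bounds all those that
    occur. *)
Definition marginal n (u : 'rV[R]_n.+1 -> R) (v : 'rV[R]_n) : R :=
  fine (\int[leb]_x (u (rV_cons (x, v)))%:E).

Section marginal.
Variables (n : nat) (W : R -> R) (M k h c : R) (p q psi : 'rV[R]_n.+1 -> R).
Hypotheses (ndW : {homo W : x y / x <= y}) (W0 : forall r, 0 <= W r).
Hypotheses (h0 : 0 <= h) (adm : admissible W M k p q psi).
Hypothesis slab : forall x, psi x != 0 -> `|x 0 ord0 - c| <= h.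

(** A fibre of [psi] has height at most [M] and is carried by an interval of length [2 * h]. *)
Let C := M * (2 * h).

Let psi0 x : 0 <= psi x. Proof. by have /andP[] := adm_psi adm x. Qed.
Let p0 x : 0 <= p x. Proof. by have /andP[] := adm_p adm x. Qed.
Let q0 x : 0 <= q x. Proof. by have /andP[] := adm_q adm x. Qed.

Let M0 : 0 <= M.
Proof. by have /andP[l u] := adm_psi adm 0; exact: le_trans l u. Qed.

Let C0 : 0 <= C. Proof. by rewrite !mulr_ge0. Qed.

Let dominated (u : 'rV[R]_n.+1 -> R) :=
  [/\ measurable_fun setT u, forall x, 0 <= u x & forall x, u x <= M * psi x].

Let dom_p : dominated p.
Proof. by split => [|//|x]; [exact: (adm_mp adm)|have /andP[] := adm_p adm x]. Qed.

Let dom_q : dominated q.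
Proof. by split => [|//|x]; [exact: (adm_mq adm)|have /andP[] := adm_q adm x]. Qed.

Let int_psi_le v : (\int[leb]_x (psi (rV_cons (x, v)))%:E <= C%:E)%E.
Proof.
apply: (@le_trans _ _ (\int[leb]_x (M%:E * (\1_(`[(c - h)%R, (c + h)%R]) x)%:E))%E).
  apply: ge0_le_integral => //=.
  - by move=> x _; rewrite lee_fin.
  - by apply/measurable_EFinP; apply: measurable_section; exact: (adm_mpsi adm).
  - apply: measurable_funeM; apply/measurable_EFinP; exact: measurable_indic.
  - move=> x _; rewrite -EFinM lee_fin indicE mem_setE in_itv/=.
    have [z|/slab] := eqVneq (psi (rV_cons (x, v))) 0.
      by rewrite z mulr_ge0.
    rewrite rV_cons0/= ler_norml => /andP[h1 h2].
    rewrite (_ : _ && _ = true) ?mulr1; first by have /andP[] := adm_psi adm (rV_cons (x, v)).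
    by apply/andP; split; lra.
have mI : measurable_fun setT
    (fun x : R => (\1_(`[(c - h)%R, (c + h)%R]) x)%:E : \bar R).
  by apply/measurable_EFinP; exact: measurable_indic.
rewrite (ge0_integralZl leb measurableT mI)//.
have L : (leb `[(c - h)%R, (c + h)%R]%classic = (2 * h)%:E)%E.
  rewrite lebesgue_measure_itv/= lte_fin; case: ltP => hh.
    by rewrite -EFinB; congr EFin; ring.
  by have -> : h = 0; [apply/le_anti; rewrite h0 andbT -(lerD2l c); lra|rewrite mulr0].
by rewrite integral_indic// setIT [X in (_ * X)%E]L -EFinM lee_fin.
Qed.

Let int_dom_le (u : 'rV[R]_n.+1 -> R) v (d : R) : 0 <= d -> measurable_fun setT u ->
  (forall x, 0 <= u x) -> (forall x, u x <= d * psi x) ->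
  (\int[leb]_x (u (rV_cons (x, v)))%:E <= d%:E * \int[leb]_x (psi (rV_cons (x, v)))%:E)%E.
Proof.
move=> d0 mu u0 uM.
have ms : measurable_fun setT (fun x : R => (psi (rV_cons (x, v)))%:E).
  by apply/measurable_EFinP; apply: measurable_section; exact: (adm_mpsi adm).
rewrite -(ge0_integralZl leb measurableT ms)//; try by rewrite ?lee_fin//; move=> x _; rewrite lee_fin.
apply: ge0_le_integral => //=.
- by move=> x _; rewrite lee_fin.
- by apply/measurable_EFinP; exact: measurable_section.
- exact: measurable_funeM.
- by move=> x _; rewrite -EFinM lee_fin.
Qed.

Let marginalE (u : 'rV[R]_n.+1 -> R) v : (forall x, 0 <= u x) ->
  (\int[leb]_x (u (rV_cons (x, v)))%:E < +oo)%E ->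
  (\int[leb]_x (u (rV_cons (x, v)))%:E = (marginal u v)%:E)%E.
Proof.
move=> u0 fin; rewrite /marginal fineK// ge0_fin_numE//.
by apply: integral_ge0 => x _; rewrite lee_fin.
Qed.

Lemma marginal_psiE v :
  (\int[leb]_x (psi (rV_cons (x, v)))%:E = (marginal psi v)%:E)%E.
Proof. by apply: marginalE => //; exact: le_lt_trans (int_psi_le v) (ltry _). Qed.

Let marginal_domE u v : dominated u ->
  (\int[leb]_x (u (rV_cons (x, v)))%:E = (marginal u v)%:E)%E.
Proof.
move=> [mu u0 uM]; apply: marginalE => //.
apply: le_lt_trans (int_dom_le v M0 mu u0 uM) _.
by rewrite marginal_psiE -EFinM ltry.
Qed.

Let marginal_ge0 (u : 'rV[R]_n.+1 -> R) v : (forall x, 0 <= u x) -> 0 <= marginal u v.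
Proof.
by move=> u0; apply: fine_ge0; apply: integral_ge0 => x _; rewrite lee_fin.
Qed.

Let measurable_marginal (u : 'rV[R]_n.+1 -> R) : measurable_fun setT u ->
  (forall x, 0 <= u x) -> measurable_fun setT (marginal u).
Proof.
move=> mu u0; apply: (measurableT_comp (@fine_measurable R setT measurableT)).
apply: (@measurable_fun_fubini_tonelli_G _ _ _ _ _ leb
  (fun z : measurableTypeR R * 'rV[R]_n => (u (rV_cons z))%:E)) => //.
  apply/measurable_EFinP; apply: (measurableT_comp mu).
  exact: measurable_rV_cons.
by move=> z; rewrite lee_fin.
Qed.

Lemma integral_marginal (u : 'rV[R]_n.+1 -> R) : dominated u ->
  (\int[lebn n]_v (marginal u v)%:E = \int[lebn n.+1]_x (u x)%:E)%E.
Proof.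
move=> du; have [mu u0 uM] := du; rewrite integral_rV_cons2//.
- by apply: eq_integral => v _; rewrite (marginal_domE v du).
- exact/measurable_EFinP.
Qed.

Lemma integral_marginal_psi :
  (\int[lebn n]_v (marginal psi v)%:E = \int[lebn n.+1]_x (psi x)%:E)%E.
Proof.
rewrite integral_rV_cons2//.
- by apply: eq_integral => v _; rewrite marginal_psiE.
- by apply/measurable_EFinP; exact: (adm_mpsi adm).
Qed.

(* Prekopa's theorem; the first coordinate's share of the strong log-concavity
   factor is discarded. *)
Lemma slc_marginal : slc (marginal psi).
Proof.
move=> v w t t01; have /andP[t0 t1] := t01.
set E := expR _; set z := _ *: v + _.
have E0 : 0 < E by exact: expR_gt0.
have sM x y : 0 <= psi (rV_cons (x, y)) <= M by exact: (adm_psi adm).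
have mpsi := adm_mpsi adm.
have mz : measurable_fun setT (fun x : R => (psi (rV_cons (x, z)))%:E).
  by apply/measurable_EFinP; exact: measurable_section.
have iE : (\int[leb]_x (E^-1 * psi (rV_cons (x, z)))%:E =
    (E^-1 * marginal psi z)%:E)%E.
  under eq_integral do rewrite EFinM.
  rewrite (ge0_integralZl leb measurableT mz)//;
    try by [rewrite lee_fin invr_ge0 ltW|move=> x _; rewrite lee_fin].
  by rewrite marginal_psiE EFinM.
have := @prekopa_leindler R (fun x => psi (rV_cons (x, v)))
  (fun x => psi (rV_cons (x, w))) (fun x => E^-1 * psi (rV_cons (x, z)))
  t M (marginal psi v) (marginal psi w) t01 (measurable_section v mpsi)
  (measurable_section w mpsi).
rewrite iE lee_fin => PL.
rewrite -ler_pdivlMr// [leRHS]mulrC; apply: PL.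
- by apply: measurable_funM => //; exact: measurable_section.
- by move=> x; exact: sM.
- by move=> x; exact: sM.
- move=> x y; rewrite [leRHS]mulrC ler_pdivlMr//.
  have := adm_slc adm (rV_cons (x, v)) (rV_cons (y, w)) t01.
  rewrite rV_cons_comb -/z; apply: le_trans.
  apply: ler_wpM2l; first by rewrite mulr_ge0 ?powR_ge0.
  rewrite /E ler_expR; apply: ler_wpM2l.
    by rewrite !mulr_ge0 ?invr_ge0 ?subr_ge0 ?ltW.
  by rewrite enorm_rV_consB lerDr sqr_ge0.
- exact: marginal_psiE.
- exact: marginal_psiE.
Qed.

(** Coefficients on both sides let it serve twice, once in each variable of a product inequality. *)
Lemma marginal_le (u : 'rV[R]_n.+1 -> R) v (d e : R) : dominated u -> 0 <= e -> 0 <= d ->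
  (forall x, e * u (rV_cons (x, v)) <= d * psi (rV_cons (x, v))) ->
  e * marginal u v <= d * marginal psi v.
Proof.
move=> du e0 d0 ud; have [mu u0 uM] := du.
have mpsi := adm_mpsi adm.
rewrite -lee_fin !EFinM -marginal_domE// -marginal_psiE.
rewrite -!ge0_integralZl//=; try by [move=> x _; rewrite lee_fin|rewrite lee_fin|
  apply/measurable_EFinP; apply: measurable_section].
apply: ge0_le_integral => //=.
- by move=> x _; rewrite mule_ge0 ?lee_fin.
- by apply: measurable_funeM; apply/measurable_EFinP; apply: measurable_section.
- by apply: measurable_funeM; apply/measurable_EFinP; apply: measurable_section.
- by move=> x _; rewrite -!EFinM lee_fin.
Qed.

(** Two points of the slab have first coordinates at most [2 * h] apart, so dropping that coordinate
    lowers their distance by at most [2 * h]; halved, this is the shift of [W]. In [M + C], [M]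
    bounds the ratios and [C] the new density. *)
Lemma admissible_marginal :
  admissible (fun r => W (r + h)) (M + C) k (marginal p) (marginal q) (marginal psi).
Proof.
have mpsi := adm_mpsi adm.
have domM (u : 'rV[R]_n.+1 -> R) v : dominated u ->
    0 <= marginal u v <= (M + C) * marginal psi v.
  move=> du; have [mu u0 uM] := du; rewrite marginal_ge0//=.
  apply: (@le_trans _ _ (M * marginal psi v)); last first.
    by rewrite ler_wpM2r ?marginal_ge0// lerDl.
  by rewrite -[leLHS]mul1r; apply: marginal_le => // x; rewrite mul1r.
split.
- by case: dom_p => mp _ _; exact: measurable_marginal.
- by case: dom_q => mq _ _; exact: measurable_marginal.
- exact: measurable_marginal.
- move=> v; rewrite marginal_ge0//= -lee_fin -marginal_psiE.
  by apply: le_trans (int_psi_le v) _; rewrite lee_fin lerDr.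
- move=> v psiv i.
  have [x psix] : exists x, psi (rV_cons (x, v)) != 0.
    apply: contrapT => nex; move/eqP: psiv; apply.
    rewrite /marginal integral0_eq// => x _; congr EFin.
    by apply/eqP; apply: contra_notT nex => ne; exists x.
  by have := adm_supp adm psix (lift ord0 i); rewrite rV_consS.
- exact: slc_marginal.
- by move=> v; exact: domM.
- by move=> v; exact: domM.
- move=> v w; set Wh := W _ ^+ 2.
  have Wh0 : 0 <= Wh by rewrite sqr_ge0.
  have pq x y : p (rV_cons (x, v)) * q (rV_cons (y, w)) <=
      Wh * (psi (rV_cons (x, v)) * psi (rV_cons (y, w))).
    have zero z : psi z = 0 -> p z = 0 /\ q z = 0.
      move=> z0; have := adm_p adm z; have := adm_q adm z; rewrite z0 mulr0.
      by move=> /le_anti <- /le_anti <-.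
    have [zx|/slab] := eqVneq (psi (rV_cons (x, v))) 0.
      by rewrite (zero _ zx).1 zx !mul0r mulr0.
    have [zy|/slab] := eqVneq (psi (rV_cons (y, w))) 0.
      by rewrite (zero _ zy).2 zy !mulr0.
    rewrite !rV_cons0/= => hy hx.
    apply: le_trans (adm_pq adm _ _) _; apply: ler_wpM2r; first exact: mulr_ge0.
    rewrite lerXn2r ?nnegrE//; apply: ndW.
    have xy : `|x - y| <= 2 * h.
      rewrite (_ : x - y = (x - c) - (y - c)); last by ring.
      by apply: le_trans (ler_normB _ _) _; lra.
    have := enorm_rV_consB_le x y v w; lra.
  (* Integrate in [y] with [x] fixed, then in [x]. *)
  have pq' x : p (rV_cons (x, v)) * marginal q w <=
      Wh * psi (rV_cons (x, v)) * marginal psi w.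
    by apply: marginal_le => //; [rewrite mulr_ge0|move=> y; rewrite -mulrA].
  rewrite [leLHS]mulrC [in leRHS](mulrC (marginal psi v)) [leRHS]mulrA.
  by apply: marginal_le; rewrite ?mulr_ge0 ?marginal_ge0// => x;
    rewrite [leLHS]mulrC [leRHS]mulrAC.
Qed.

End marginal.
End admissible.

(** * Bisection *)

Section bisection.
Context {R : realType}.
Local Notation leb := (@lebesgue_measure R).
Local Notation lebn := (lebesgue_rV R).
Implicit Types (W : R -> R) (M k : R).

Definition Rint n (u : 'rV[R]_n -> R) : R := fine (\int[lebn n]_x (u x)%:E).

Definition dominated_by_density n M (psi u : 'rV[R]_n -> R) :=
  measurable_fun setT u /\ forall x, 0 <= u x <= M * psi x.

Section admissible_integrals.
Variables (n : nat) (W : R -> R) (M k : R) (p q psi : 'rV[R]_n -> R).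
Hypothesis adm : admissible W M k p q psi.

Lemma dominated_adm_p : dominated_by_density M psi p.
Proof. by split; [exact: (adm_mp adm)|exact: (adm_p adm)]. Qed.

Lemma dominated_adm_q : dominated_by_density M psi q.
Proof. by split; [exact: (adm_mq adm)|exact: (adm_q adm)]. Qed.

Let psi0 x : 0 <= psi x. Proof. by have /andP[] := adm_psi adm x. Qed.

Let M0 : 0 <= M.
Proof. by have /andP[l u] := adm_psi adm 0; exact: le_trans l u. Qed.

Let int_psi_fin : (\int[lebn n]_x (psi x)%:E < +oo)%E.
Proof.
pose B := [set v : 'rV[R]_n | forall i, `[- k, k]%classic (v 0 i)].
have mB : measurable B by exact: (@measurable_box R n (fun=> `[- k, k]%classic)).
apply: (@le_lt_trans _ _ (\int[lebn n]_x (M%:E * (\1_B x)%:E))%E).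
  apply: ge0_le_integral => //=.
  - by move=> x _; rewrite lee_fin.
  - by apply/measurable_EFinP; exact: (adm_mpsi adm).
  - by apply: measurable_funeM; apply/measurable_EFinP; exact: measurable_indic.
  - move=> x _; rewrite -EFinM lee_fin indicE.
    have [z|/(adm_supp adm) xk] := eqVneq (psi x) 0; first by rewrite z mulr_ge0.
    rewrite mem_set ?mulr1; first by have /andP[] := adm_psi adm x.
    by move=> i /=; rewrite in_itv/= -ler_norml.
have mI : measurable_fun setT (fun x => (\1_B x)%:E : \bar R).
  by apply/measurable_EFinP; exact: measurable_indic.
rewrite (ge0_integralZl (lebn n) measurableT mI)//.
rewrite integral_indic// setIT.
pose I : set R := `[- k, k]%classic.
have Ifin : (leb I = (fine (leb I))%:E)%E.
  rewrite fineK// ge0_fin_numE// /I lebesgue_measure_itv/=.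
  by case: ifP => _; rewrite ?ltry.
have [r rE] : exists r : R, (\prod_(i < n) leb I)%E = r%:E.
  elim/big_ind : _ => [|x y [a ->] [b ->]|i _]; first by exists 1.
    by exists (a * b).
  by exists (fine (leb I)).
rewrite [X in (_ * X)%E](_ : _ = r%:E); first by rewrite -EFinM ltry.
by apply: etrans rE; apply: (@lebesgue_rV_box R n (fun=> I)) => i; exact: measurable_itv.
Qed.

Lemma Rint_psiE : (\int[lebn n]_x (psi x)%:E = (Rint psi)%:E)%E.
Proof.
rewrite /Rint fineK// ge0_fin_numE//; apply: integral_ge0 => x _.
by rewrite lee_fin.
Qed.

Lemma Rint_domE (C : R) u : dominated_by_density C psi u ->
  (\int[lebn n]_x (u x)%:E = (Rint u)%:E)%E.
Proof.
move=> [mu uC]; rewrite /Rint fineK// ge0_fin_numE; last first.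
  by apply: integral_ge0 => x _; rewrite lee_fin; have /andP[] := uC x.
apply: (@le_lt_trans _ _ (\int[lebn n]_x (`|C|%:E * (psi x)%:E))%E).
  apply: ge0_le_integral => //=.
  - by move=> x _; rewrite lee_fin; have /andP[] := uC x.
  - exact/measurable_EFinP.
  - by apply: measurable_funeM; apply/measurable_EFinP; exact: (adm_mpsi adm).
  - move=> x _; rewrite -EFinM lee_fin; have /andP[_ uCx] := uC x.
    by apply: le_trans uCx _; rewrite ler_wpM2r// ler_norm.
have mpsi : measurable_fun setT (EFin \o psi).
  by apply/measurable_EFinP; exact: (adm_mpsi adm).
rewrite (ge0_integralZl (lebn n) measurableT mpsi)/= ?Rint_psiE -?EFinM ?ltry//.
by move=> x _; rewrite lee_fin.
Qed.

End admissible_integrals.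

Definition restr n (H : 'rV[R]_n -> bool) (u : 'rV[R]_n -> R) x :=
  if H x then u x else 0.

(** If an endpoint is outside [H], the left side vanishes, because a positive power of 0 is 0. *)
Lemma slc_restr n (psi : 'rV[R]_n -> R) (H : 'rV[R]_n -> bool) :
  (forall x, 0 <= psi x) ->
  (forall x y t, 0 < t < 1 -> H x -> H y -> H ((1 - t) *: x + t *: y)) ->
  slc psi -> slc (restr H psi).
Proof.
move=> psi0 cH lcpsi x y t t01; rewrite {1 2}/restr.
have /andP[t0 t1] := t01.
have r0 : 0 <= restr H psi ((1 - t) *: x + t *: y).
  by rewrite /restr; case: ifP.
case: ifPn => Hx; last first.
  by rewrite powR0 ?mul0r// gt_eqF// subr_gt0.
case: ifPn => Hy; last by rewrite (@powR0 _ t) ?gt_eqF// mulr0 mul0r.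
by rewrite /restr cH//; exact: lcpsi.
Qed.

Lemma admissible_restr n W M k (p q psi : 'rV[R]_n -> R) (H : 'rV[R]_n -> bool) :
  measurable_fun setT H ->
  (forall x y t, 0 < t < 1 -> H x -> H y -> H ((1 - t) *: x + t *: y)) ->
  admissible W M k p q psi ->
  admissible W M k (restr H p) (restr H q) (restr H psi).
Proof.
move=> mH cH adm; have [mp mq mpsi psiM psik lcpsi pM qM pq] := adm.
have M0 : 0 <= M by have /andP[l u] := psiM 0; exact: le_trans l u.
have dom u x : 0 <= u x <= M * psi x -> 0 <= restr H u x <= M * restr H psi x.
  by rewrite /restr; case: ifP => // _ _; rewrite mulr0 lexx.
have psi0 x : 0 <= psi x by have /andP[] := psiM x.
split.
- exact: measurable_fun_ifT.
- exact: measurable_fun_ifT.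
- exact: measurable_fun_ifT.
- by move=> x; rewrite /restr; case: ifP => // _; rewrite lexx.
- by move=> x; rewrite /restr; case: ifP => [_ /psik//|]; rewrite eqxx.
- exact: slc_restr.
- by move=> x; exact: dom.
- by move=> x; exact: dom.
- move=> x y; rewrite /restr; case: ifP => _; case: ifP => _;
    rewrite ?mulr0 ?mul0r ?mulr0//.
Qed.

End bisection.

(** * Integrals over subsets and their limits *)

Section restricted_integrals.
Context {R : realType}.
Local Notation lebn := (lebesgue_rV R).
Variables (n : nat) (W : R -> R) (M k : R) (p q psi : 'rV[R]_n -> R).
Hypothesis adm : admissible W M k p q psi.
Variable C : R.

Lemma lebesgue_rV_indic m (N : set 'rV[R]_m) : measurable N ->
  lebn m N = (\int[lebn m]_x (\1_N x)%:E)%E.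
Proof. by move=> mN; rewrite integral_indic// setIT. Qed.

Lemma measurable_restr (H : 'rV[R]_n -> bool) u : measurable_fun setT H ->
  measurable_fun setT u -> measurable_fun setT (restr H u).
Proof. by move=> mH mu; exact: measurable_fun_ifT. Qed.

Lemma dominated_restr H u : measurable_fun setT H ->
  dominated_by_density C psi u -> dominated_by_density C psi (restr H u).
Proof.
move=> mH [mu uM]; split; first exact: measurable_restr.
move=> x; rewrite /restr; case: ifP => // _; rewrite lexx/=.
by have /andP[u0 u1] := uM x; exact: le_trans u1.
Qed.

Lemma Rint_split H u : measurable_fun setT H -> dominated_by_density C psi u ->
  Rint u = Rint (restr H u) + Rint (restr (fun x => ~~ H x) u).
Proof.
move=> mH du; have mNH : measurable_fun setT (fun x => ~~ H x).
  exact: measurable_neg.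
apply: EFin_inj; rewrite EFinD -(Rint_domE adm du).
rewrite -(Rint_domE adm (dominated_restr mH du)).
rewrite -(Rint_domE adm (dominated_restr mNH du)).
have [mu uM] := du.
have r0 H' x : 0 <= restr H' u x.
  by rewrite /restr; case: ifP => // _; have /andP[] := uM x.
rewrite -ge0_integralD//=.
- apply: eq_integral => x _; rewrite -EFinD /restr.
  by case: (H x) => /=; rewrite ?addr0 ?add0r.
- by move=> x _; rewrite lee_fin.
- by apply/measurable_EFinP; exact: measurable_restr.
- by move=> x _; rewrite lee_fin.
- by apply/measurable_EFinP; exact: measurable_restr.
Qed.

Lemma Rint_restr_ae (N : set 'rV[R]_n) (H H' : 'rV[R]_n -> bool) u :
  measurable N -> lebn n N = 0%E -> measurable_fun setT H ->
  measurable_fun setT H' -> dominated_by_density C psi u ->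
  (forall x, ~ N x -> H x = H' x) -> Rint (restr H u) = Rint (restr H' u).
Proof.
move=> mN N0 mH mH' [mu uM] HH'; rewrite /Rint; congr fine.
apply: ae_eq_integral => //.
- by apply/measurable_EFinP; exact: measurable_restr.
- by apply/measurable_EFinP; exact: measurable_restr.
exists N; split => // x /=; apply: contra_notP => /HH' HH _.
by rewrite /restr HH.
Qed.

(** The exceptional set [N] will be a hyperplane: off it, membership in a converging sequence of
    half-spaces is eventually constant. [u] itself dominates. *)
Lemma Rint_restr_cvg (N : set 'rV[R]_n) (H_ : nat -> 'rV[R]_n -> bool)
    (H : 'rV[R]_n -> bool) u :
  measurable N -> lebn n N = 0%E -> (forall j, measurable_fun setT (H_ j)) ->
  measurable_fun setT H -> dominated_by_density C psi u ->
  (forall x, ~ N x -> \forall j \near \oo, H_ j x = H x) ->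
  Rint (restr (H_ j) u) @[j --> \oo] --> Rint (restr H u).
Proof.
move=> mN N0 mH_ mH du HH; have [mu uM] := du.
have u0 x : 0 <= u x by have /andP[] := uM x.
have [|||||_ _ lim] := @dominated_convergence _ _ R (lebn n) setT measurableT
    (fun j x => (restr (H_ j) u x)%:E)
    (fun x => (restr H u x)%:E) (fun x => (u x)%:E).
- by move=> j; apply/measurable_EFinP; exact: measurable_restr (mH_ j) mu.
- by apply/measurable_EFinP; exact: measurable_restr mH mu.
- exists N; split => // x /=; apply: contra_notP => /HH near_x _.
  apply: cvg_near_cst; apply: filterS near_x => j Hj.
  by rewrite /restr Hj.
- apply/integrableP; split; first exact/measurable_EFinP.
  under eq_integral do rewrite gee0_abs ?lee_fin//.
  by rewrite (Rint_domE adm du) ltry.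
- apply: aeW => x j _; rewrite gee0_abs ?lee_fin /restr; case: ifP => //.
by apply: fine_cvg; rewrite -(Rint_domE adm (dominated_restr mH du)).
Qed.

End restricted_integrals.

(** * Cuts by half-spaces through a point of the plane *)

Section cut.
Context {R : realType}.
Local Notation leb := (@lebesgue_measure R).
Local Notation lebn := (lebesgue_rV R).

Definition planar_form n (a b : R) (pt : R * R) (x : 'rV[R]_n.+2) : R :=
  a * ((rV_head2 x).1 - pt.1) + b * ((rV_head2 x).2 - pt.2).

Lemma measurable_planar_form n a b pt :
  measurable_fun setT (@planar_form n a b pt).
Proof.
have mc i := @measurable_coord R 1 n.+2 0 i.
apply: measurable_funD; apply: measurable_funM => //; apply: measurable_funB => //;
  exact: mc.
Qed.

Lemma planar_form_comb n a b pt (x y : 'rV[R]_n.+2) t :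
  planar_form a b pt ((1 - t) *: x + t *: y) =
  (1 - t) * planar_form a b pt x + t * planar_form a b pt y.
Proof. by rewrite /planar_form /rV_head2 /= !mxE; ring. Qed.

(** By Tonelli: along a coordinate whose coefficient is nonzero, the hyperplane meets each line in
    at most one point. *)
Lemma null_planar_form n a b pt : ~ (a = 0 /\ b = 0) ->
  lebn n.+2 [set x | planar_form a b pt x = 0] = 0%E.
Proof.
move=> ab; set N := mkset _.
have mN : measurable N.
  have := @measurable_planar_form n a b pt measurableT [set 0] (measurable_set1 _).
  by rewrite setTI.
have mI : measurable_fun setT (fun x => (\1_N x)%:E : \bar R).
  by apply/measurable_EFinP; exact: measurable_indic.
have I0 x : (0 <= (\1_N x)%:E :> \bar R)%E by rewrite lee_fin.
have point (z : R) : (\int[leb]_x (\1_[set z] x)%:E = 0)%E.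
  by rewrite integral_indic// setIT; exact: lebesgue_measure_set1.
have line0 (c d : R) (S : set R) : c != 0 -> (forall x, S x -> c * x = d) ->
    (\int[leb]_x (\1_S x)%:E = 0)%E.
  move=> c0 Sd; have : S `<=` [set d / c].
    by move=> x Sx /=; rewrite -(Sd _ Sx) mulrC mulKf.
  move=> /subset_set1[] ->; last exact: point.
  by apply: integral0_eq => x _; rewrite indicE in_set0.
apply: etrans (lebesgue_rV_indic mN) _.
have [a0|a0] := eqVneq a 0.
  have b0 : b != 0 by apply/eqP => b0; exact: ab.
  apply: etrans (integral_rV_cons1 mI I0) _; apply: integral0_eq => x _.
  have mIx : measurable_fun setT (fun v => (\1_N (rV_cons (x, v)))%:E : \bar R).
    apply: (measurableT_comp mI).
    exact: (measurableT_comp (@measurable_rV_cons R _) (measurable_pair1 x)).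
  apply: etrans (integral_rV_cons2 mIx (fun=> I0 _)) _.
  apply: integral0_eq => z _.
  apply: (@line0 b (b * pt.2) [set y | N (rV_cons (x, rV_cons (y, z)))] b0).
  move=> y; rewrite /N /= /planar_form /rV_head2 /= !rV_consS !rV_cons0 a0 /=; lra.
apply: etrans (integral_rV_cons2 mI I0) _; apply: integral0_eq => v _.
pose d := a * pt.1 - b * (v 0 ord0 - pt.2).
apply: (@line0 a d [set y | N (rV_cons (y, v))] a0).
move=> y; rewrite /N /= /planar_form /rV_head2 /= !rV_consS !rV_cons0 /d /=; lra.
Qed.

Section cut_integrals.
Variables (n : nat) (W : R -> R) (M k : R) (p q psi : 'rV[R]_n.+2 -> R).
Hypothesis adm : admissible W M k p q psi.

(** For [s] between -1 and 1 the normal (s, 1 - |s|) runs along the upper half of the unit sphere of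
    the l1 norm: a path of nonzero vectors, with opposite ends, that avoids angles. *)
Definition cut (pt : R * R) (s : R) (x : 'rV[R]_n.+2) : bool :=
  0 <= planar_form s (1 - `|s|) pt x.

Let cut_form_neq0 (s : R) : ~ (s = 0 /\ 1 - `|s| = 0).
Proof. by case=> ->; rewrite normr0 subr0; apply/eqP; exact: oner_neq0. Qed.

Lemma measurable_cut pt s : measurable_fun setT (cut pt s).
Proof.
by apply: measurable_fun_ler => //; exact: measurable_planar_form.
Qed.

Let measurable_line a b pt :
  measurable [set x : 'rV[R]_n.+2 | planar_form a b pt x = 0].
Proof.
have := @measurable_planar_form n a b pt measurableT [set 0] (measurable_set1 _).
by rewrite setTI.
Qed.

(** Off the hyperplane at [s] the sign of the form is unchanged for nearby parameters, and the
    hyperplane is null. *)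
Lemma continuous_Rint_cut pt u : dominated_by_density M psi u ->
  continuous (fun s => Rint (restr (cut pt s) u)).
Proof.
move=> du s; apply/(@cvg_nbhsP _ R^o) => t ts.
have lim := Rint_restr_cvg adm (measurable_line s (1 - `|s|) pt)
  (null_planar_form n pt (@cut_form_neq0 s)) (fun j => measurable_cut pt (t j))
  (measurable_cut pt s) du.
apply: lim => x /= /eqP l0.
have cl : planar_form (t j) (1 - `|t j|) pt x @[j --> \oo] -->
    planar_form s (1 - `|s|) pt x.
  apply: cvgD; apply: cvgMl => //; apply: cvgB; first exact: cvg_cst.
  exact: cvg_norm.
rewrite /cut; move: l0 cl; set l := planar_form s _ _ _ => l0 cl.
have [lp|ln] := leP 0 l.
  have {}lp : 0 < l by rewrite lt_neqAle eq_sym l0.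
  by near=> j; apply/ltW; near: j; exact: (cvgr_gt l).
near=> j; apply/negbTE; rewrite -ltNge; near: j; exact: (cvgr_lt l).
Unshelve. all: by end_near. Qed.

Lemma Rint_cut_opp pt u : dominated_by_density M psi u ->
  Rint (restr (cut pt (-1)) u) = Rint (restr (fun x => ~~ cut pt 1 x) u).
Proof.
move=> du; apply: (Rint_restr_ae (measurable_line 1 (1 - `|1|) pt)
  (null_planar_form n pt (@cut_form_neq0 1)) (measurable_cut _ _) _ du).
  by apply: measurable_neg; exact: measurable_cut.
move=> x /= /eqP; rewrite /cut /planar_form normrN normr1 subrr !mul0r !addr0.
rewrite mul1r mulN1r oppr_ge0 -ltNge lt_neqAle => ->.
by [].
Qed.

(* [s] runs from one half-plane through [pt] to the opposite one, so some
   intermediate cut balances [p] against [r ^+ 2 * q]; one of its two halves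
   inherits the strict inequality. *)
Lemma cut_exists pt (K r : R) : 0 <= k ->
  Rint p = r ^+ 2 * Rint q -> K * Rint psi < r * Rint q ->
  exists p' q' psi' : 'rV[R]_n.+2 -> R,
  [/\ admissible W M k p' q' psi', forall x, psi' x != 0 -> psi x != 0,
      Rint p' = r ^+ 2 * Rint q', K * Rint psi' < r * Rint q' &
      in_halfplane_at [set rV_head2 x | x in [set x | psi' x != 0]] pt].
Proof.
move=> k0 bal strict; have dp := dominated_adm_p adm; have dq := dominated_adm_q adm.
pose D s := Rint (restr (cut pt s) p) - r ^+ 2 * Rint (restr (cut pt s) q).
have cD : continuous D.
  move=> s; apply: cvgB; first exact: continuous_Rint_cut.
  by apply: cvgMr; exact: continuous_Rint_cut.
(* The two ends are complementary half-spaces up to a null set, and the totals balance; so [D] takes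
   opposite values there. *)
have D1 : D (-1) = - D 1.
  have := Rint_split adm (measurable_cut pt 1) dp.
  have := Rint_split adm (measurable_cut pt 1) dq.
  by rewrite /D !Rint_cut_opp// => eq ep; move: bal; rewrite ep eq; lra.
have [s _ Ds] : exists2 s, s \in `[(-1 : R), 1] & D s = 0.
  have m11 : -1 <= 1 :> R by lra.
  apply: (IVT m11); first exact: continuous_subspaceT.
  rewrite D1 ge_min le_max; have [d|/ltW d] := leP (D 1) 0.
    by rewrite orbT oppr_ge0 d.
  by rewrite d orbT oppr_le0 d.
have mH := measurable_cut pt s.
have mNH : measurable_fun setT (fun x => ~~ cut pt s x) by exact: measurable_neg.
have half (H : 'rV[R]_n.+2 -> bool) (a b : R) : ~ (a = 0 /\ b = 0) ->
    measurable_fun setT H ->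
    (forall x y t, 0 < t < 1 -> H x -> H y -> H ((1 - t) *: x + t *: y)) ->
    (forall x, H x -> 0 <= planar_form a b pt x) ->
    Rint (restr H p) = r ^+ 2 * Rint (restr H q) ->
    K * Rint (restr H psi) < r * Rint (restr H q) ->
    exists p' q' psi' : 'rV[R]_n.+2 -> R,
    [/\ admissible W M k p' q' psi', forall x, psi' x != 0 -> psi x != 0,
      Rint p' = r ^+ 2 * Rint q', K * Rint psi' < r * Rint q' &
      in_halfplane_at [set rV_head2 x | x in [set x | psi' x != 0]] pt].
  move=> ab mH' cH Hab balH strictH.
  exists (restr H p), (restr H q), (restr H psi); split => //.
  - exact: admissible_restr.
  - by move=> x; rewrite /restr; case: ifP; rewrite ?eqxx.
  - exists a, b; split=> // _ [x /= psix <-]; apply: Hab.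
    by move: psix; rewrite /restr; case: ifP; rewrite ?eqxx.
have dpsi : dominated_by_density 1 psi psi.
  split; first exact: (adm_mpsi adm).
  by move=> x; rewrite mul1r lexx andbT; have /andP[] := adm_psi adm x.
have splitp := Rint_split adm mH dp.
have splitq := Rint_split adm mH dq.
have splitpsi := Rint_split adm mH dpsi.
have t_ge0 (t : R) : 0 < t < 1 -> 0 < 1 - t by move=> /andP[_]; rewrite subr_gt0.
have [str1|str1] := ltP (K * Rint (restr (cut pt s) psi))
  (r * Rint (restr (cut pt s) q)).
  apply: (half (cut pt s) s (1 - `|s|)) => //.
  - move=> x y t t01 Hx Hy; rewrite /cut planar_form_comb addr_ge0//.
      by rewrite mulr_ge0// ltW// t_ge0.
    by rewrite mulr_ge0// ltW//; case/andP: t01.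
  - by move: Ds; rewrite /D; lra.
apply: (half (fun x => ~~ cut pt s x) (- s) (- (1 - `|s|))) => //.
- by move=> [/eqP + /eqP]; rewrite !oppr_eq0 => /eqP s0 /eqP s1; exact: (@cut_form_neq0 s).
- move=> x y t t01; rewrite /cut -!ltNge planar_form_comb => Hx Hy.
  have := t_ge0 t t01; case/andP: t01 => t0 _ t1; nra.
- move=> x; rewrite /cut -ltNge /planar_form; lra.
- by move: Ds bal; rewrite /D splitp splitq; lra.
- by move: strict str1; rewrite splitpsi splitq !mulrDr; lra.
Qed.

End cut_integrals.
End cut.

(** * Localization *)

Section localization.
Context {R : realType}.
Local Notation leb := (@lebesgue_measure R).
Local Notation lebn := (lebesgue_rV R).

Lemma in_halfplane_at_subset (S S' : set (R * R)) pt : S' `<=` S ->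
  in_halfplane_at S pt -> in_halfplane_at S' pt.
Proof. by move=> S'S [a [b [ab h]]]; exists a, b; split => // v /S'S/h. Qed.

(** Supports only shrink under further cuts, so half-plane conditions already obtained persist. *)
Lemma cuts_exist n W (M k : R) (p q psi : 'rV[R]_n.+2 -> R) (K r : R)
    (ps : seq (R * R)) : 0 <= k ->
  admissible W M k p q psi ->
  Rint p = r ^+ 2 * Rint q -> K * Rint psi < r * Rint q ->
  exists p' q' psi' : 'rV[R]_n.+2 -> R,
  [/\ admissible W M k p' q' psi', forall x, psi' x != 0 -> psi x != 0,
      Rint p' = r ^+ 2 * Rint q', K * Rint psi' < r * Rint q' &
      forall pt, pt \in ps ->
        in_halfplane_at [set rV_head2 x | x in [set x | psi' x != 0]] pt].
Proof.
move=> k0; elim: ps p q psi => [|pt ps IH] p q psi adm bal strict.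
  by exists p, q, psi; split.
have [p1 [q1 [psi1 [adm1 sub1 bal1 strict1 hp1]]]] := cut_exists adm pt k0 bal strict.
have [p2 [q2 [psi2 [adm2 sub2 bal2 strict2 hp2]]]] := IH _ _ _ adm1 bal1 strict1.
exists p2, q2, psi2; split => // [x /sub2/sub1//|z].
rewrite inE => /predU1P[->|/hp2//]; apply: in_halfplane_at_subset hp1.
by move=> _ [x /= /sub2 ? <-]; exists x.
Qed.

Lemma Rint_ge0 n (u : 'rV[R]_n -> R) : (forall x, 0 <= u x) -> 0 <= Rint u.
Proof.
by move=> u0; apply: fine_ge0; apply: integral_ge0 => x _; rewrite lee_fin.
Qed.

Lemma localization_step n W (M k e K : R) (p q psi : 'rV[R]_n.+2 -> R) :
  (forall W M k e K (p q psi : 'rV[R]_n.+1 -> R),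
    {homo W : x y / x <= y} -> (forall r, 0 <= W r) -> 0 < e -> 0 <= k ->
    (\int[normal_prob 0 1]_r (W (`|r| + e))%:E <= K%:E)%E ->
    admissible W M k p q psi ->
    Rint p * Rint q <= K ^+ 2 * Rint psi ^+ 2) ->
  {homo W : x y / x <= y} -> (forall r, 0 <= W r) -> 0 < e -> 0 <= k ->
  (\int[normal_prob 0 1]_r (W (`|r| + e))%:E <= K%:E)%E ->
  admissible W M k p q psi ->
  Rint p * Rint q <= K ^+ 2 * Rint psi ^+ 2.
Proof.
move=> IH ndW W0 e0 k0 WK adm; rewrite leNgt; apply/negP => strict.
have K0 : 0 <= K.
  by rewrite -lee_fin; apply: le_trans WK; apply: integral_ge0 => x _; rewrite lee_fin.
have nonneg (p' q' psi' : 'rV[R]_n.+2 -> R) : admissible W M k p' q' psi' ->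
    [/\ 0 <= Rint p', 0 <= Rint q' & 0 <= Rint psi'].
  move=> adm'; split; apply: Rint_ge0 => x.
  - by have /andP[] := adm_p adm' x.
  - by have /andP[] := adm_q adm' x.
  - by have /andP[] := adm_psi adm' x.
have [P0 Q0 Z0] := nonneg _ _ _ adm.
have PQ : 0 < Rint p * Rint q.
  by apply: le_lt_trans strict; rewrite mulr_ge0 ?sqr_ge0.
have Qp : 0 < Rint q.
  by rewrite lt_neqAle Q0 andbT eq_sym; apply: contraTneq PQ => ->; rewrite mulr0 ltxx.
have Pp : 0 < Rint p.
  by rewrite lt_neqAle P0 andbT eq_sym; apply: contraTneq PQ => ->; rewrite mul0r ltxx.
(* With this [r] the product of the two integrals is the square of [r * Rint q], and [strict1] is
   the square root of [strict]. *)
pose r := Num.sqrt (Rint p / Rint q).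
have r0 : 0 <= r by exact: sqrtr_ge0.
have r2 : r ^+ 2 = Rint p / Rint q by rewrite sqr_sqrtr// divr_ge0.
have bal : Rint p = r ^+ 2 * Rint q by rewrite r2 divfK// gt_eqF.
have strict1 : K * Rint psi < r * Rint q.
  rewrite -(@ltr_pXn2r _ 2)// ?nnegrE ?mulr_ge0// !exprMn.
  by apply: lt_le_trans strict _; rewrite bal expr2 -!mulrA.
have e2 : 0 < e / 2 by rewrite divr_gt0.
have [ps psP] := grid_slab k e2.
have [p1 [q1 [psi1 [adm1 _ bal1 strict2 hp]]]] := cuts_exist ps k0 adm bal strict1.
pose S := [set rV_head2 x | x in [set x | psi1 x != 0]].
have Sk v : S v -> `|v.1| <= k /\ `|v.2| <= k.
  by move=> [x /= /(adm_supp adm1) xk <-]; split; exact: xk.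
have [a [b [c [a0 ab slab]]]] : exists a b c : R, [/\ 0 <= a,
    a ^+ 2 + b ^+ 2 = 1 & forall v, S v -> `|a * v.1 + b * v.2 - c| <= e / 2].
  have [a [b [c [ab slab]]]] := psP S Sk hp.
  (* The rotation is available for [0 <= a]; the equation of the slab may be negated. *)
  have [a0|a0] := leP 0 a; first by exists a, b, c.
  exists (- a), (- b), (- c); split; [lra|by rewrite !sqrrN|].
  move=> v Sv; rewrite -normrN.
  have -> : - (- a * v.1 + - b * v.2 - - c) = a * v.1 + b * v.2 - c by ring.
  exact: slab.
have adm2 := admissible_rot ab k0 adm1.
(* After the rotation the form [a * v.1 + b * v.2] is the first coordinate, the one that [marginal]
   integrates out. *)
have slab2 w : (psi1 \o rV_rot a b) w != 0 -> `|w 0 ord0 - c| <= e / 2.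
  move=> /= psiw; have := slab (rV_head2 (rV_rot a b w)).
  rewrite /rV_head2 /rV_rot /= rV_consS !rV_cons0 /= => sl.
  have {1}-> : w 0 ord0 = a * (a * w 0 ord0 - b * w 0 (lift ord0 ord0)) +
      b * (b * w 0 ord0 + a * w 0 (lift ord0 ord0)).
    by rewrite -[LHS]mul1r -ab; ring.
  apply: sl; exists (rV_rot a b w) => //.
  by rewrite /rV_head2 /rV_rot /= rV_consS !rV_cons0.
have adm3 := admissible_marginal ndW W0 (ltW e2) adm2 slab2.
have k2 : 0 <= 2 * k by rewrite mulr_ge0.
(* The slab of half-width [e / 2] has shifted [W] by [e / 2]; the same amount is left for the
   induction hypothesis. *)
have WK2 : (\int[normal_prob 0 1]_r (W (`|r| + e / 2 + e / 2))%:E <= K%:E)%E.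
  apply: le_trans WK; rewrite le_eqVlt; apply/orP; left; apply/eqP.
  by apply: eq_integral => x _; rewrite -addrA -splitr.
have := IH _ _ _ _ _ _ _ _ _ _ e2 k2 WK2 adm3.
have rotE (u : 'rV[R]_n.+2 -> R) : measurable_fun setT u -> (forall x, 0 <= u x) ->
    Rint (u \o rV_rot a b) = Rint u.
  move=> mu u0; rewrite /Rint; congr fine.
  apply: (@integral_rV_rot R n (EFin \o u) a b ab a0).
  - exact/measurable_EFinP.
  - by move=> x; rewrite lee_fin.
have pP := adm_p adm2; have qP := adm_q adm2; have psiP := adm_psi adm2.
have -> : Rint (marginal (psi1 \o rV_rot a b)) = Rint psi1.
  rewrite -rotE; [|exact: (adm_mpsi adm1)|by move=> x; have /andP[] := adm_psi adm1 x].
  by rewrite /Rint; congr fine; exact: integral_marginal_psi (ltW e2) adm2 slab2.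
have -> : Rint (marginal (p1 \o rV_rot a b)) = Rint p1.
  rewrite -rotE; [|exact: (adm_mp adm1)|by move=> x; have /andP[] := adm_p adm1 x].
  rewrite /Rint; congr fine; apply: (integral_marginal (ltW e2) adm2 slab2).
  by split; [exact: (adm_mp adm2)|move=> x; have /andP[] := pP x|
    move=> x; have /andP[] := pP x].
have -> : Rint (marginal (q1 \o rV_rot a b)) = Rint q1.
  rewrite -rotE; [|exact: (adm_mq adm1)|by move=> x; have /andP[] := adm_q adm1 x].
  rewrite /Rint; congr fine; apply: (integral_marginal (ltW e2) adm2 slab2).
  by split; [exact: (adm_mq adm2)|move=> x; have /andP[] := qP x|
    move=> x; have /andP[] := qP x].
have W2 : {homo (fun r => W (r + e / 2)) : x y / x <= y}.
  by move=> x y xy; apply: ndW; rewrite lerD2r.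
move=> /(_ W2 (fun=> W0 _)); apply/negP; rewrite -ltNge.
have [P1 Q1 Z1] := nonneg _ _ _ adm1.
rewrite bal1 -mulrA -expr2 -!exprMn ltr_pXn2r// nnegrE mulr_ge0//.
Qed.

(** On the line the shift costs nothing: [W] is below its shift by monotonicity, and [line_bound]
    applies to the latter. *)
Lemma localization_line W (M k e K : R) (p q psi : 'rV[R]_1 -> R) :
  {homo W : x y / x <= y} -> (forall r, 0 <= W r) -> 0 < e ->
  (\int[normal_prob 0 1]_r (W (`|r| + e))%:E <= K%:E)%E ->
  admissible W M k p q psi ->
  Rint p * Rint q <= K ^+ 2 * Rint psi ^+ 2.
Proof.
move=> ndW W0 e0 WK adm; have [mp mq mpsi psiM psik lcpsi pM qM pq] := adm.
pose c (x : R) : 'rV[R]_1 := rV_cons (x, 0).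
have mc (u : 'rV[R]_1 -> R) : measurable_fun setT u -> measurable_fun setT (u \o c).
  by move=> mu; exact: measurable_section.
have intc (u : 'rV[R]_1 -> R) z : measurable_fun setT u -> (forall x, 0 <= u x) ->
    (\int[lebn 1]_x (u x)%:E = z%:E)%E -> (\int[leb]_x (u (c x))%:E = z%:E)%E.
  move=> mu u0 <-; rewrite (@integral_rV_cons1 _ 0 (EFin \o u)).
  - apply: eq_integral => x _; rewrite /= integral_dirac//.
      by rewrite diracE in_setT mul1e.
    apply/measurable_EFinP; apply: (measurableT_comp mu).
    exact: (measurableT_comp (@measurable_rV_cons R _) (measurable_pair1 x)).
  - exact/measurable_EFinP.
  - by move=> x; rewrite lee_fin.
have ec x y : enorm (c x - c y) = `|x - y|.
  apply/eqP; rewrite -(@eqrXn2 _ 2)// ?enorm_ge0// enorm_rV_consB subr0.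
  by rewrite enorm_sqr big_ord0 addr0 real_normK ?num_real.
apply: (@line_bound R (fun r => W (r + e)) (p \o c) (q \o c) (psi \o c) M k) => //.
- by move=> x y xy; apply: ndW; rewrite lerD2r.
- exact: mc.
- by move=> x; exact: psiM.
- move=> x y t t01 /=; have := lcpsi (c x) (c y) t t01.
  by rewrite rV_cons_comb !scaler0 addr0 ec real_normK ?num_real.
- by move=> x /= /psik/(_ ord0); rewrite rV_cons0.
- exact: mc.
- exact: mc.
- by move=> x; exact: pM.
- by move=> x; exact: qM.
- move=> x y /=; apply: le_trans (pq _ _) _; rewrite ec.
  apply: ler_wpM2r.
    by rewrite mulr_ge0//; [have /andP[] := psiM (c x)|have /andP[] := psiM (c y)].
  by rewrite lerXn2r ?nnegrE//; apply: ndW; rewrite lerDl ltW.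
- apply: intc => //; last exact: (Rint_domE adm (dominated_adm_p adm)).
  by move=> x; have /andP[] := pM x.
- apply: intc => //; last exact: (Rint_domE adm (dominated_adm_q adm)).
  by move=> x; have /andP[] := qM x.
- apply: intc => //; last exact: (Rint_psiE adm).
  by move=> x; have /andP[] := psiM x.
Qed.

Lemma localization_point W (M k e K : R) (p q psi : 'rV[R]_0 -> R) :
  {homo W : x y / x <= y} -> (forall r, 0 <= W r) -> 0 < e ->
  (\int[normal_prob 0 1]_r (W (`|r| + e))%:E <= K%:E)%E ->
  admissible W M k p q psi ->
  Rint p * Rint q <= K ^+ 2 * Rint psi ^+ 2.
Proof.
move=> ndW W0 e0 WK adm; have [mp mq mpsi psiM psik lcpsi pM qM pq] := adm.
have RintE (u : 'rV[R]_0 -> R) : measurable_fun setT u -> Rint u = u 0.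
  move=> mu; rewrite /Rint /= integral_dirac//=; last exact/measurable_EFinP.
  by rewrite indicE in_setT mul1r.
(* In dimension 0 only [W 0] occurs, and it is at most the mean of W(|r| + e) over a probability
   measure. *)
have WK0 : W 0 <= K.
  rewrite -lee_fin; apply: le_trans WK.
  rewrite -[leLHS]mule1 -(@probability_setT _ _ _ (normal_prob (0 : R) 1)).
  rewrite -integral_cst//; apply: ge0_le_integral => //=.
  - by move=> x _; rewrite lee_fin.
  - apply/measurable_EFinP; apply: (measurableT_comp (nondecreasing_measurable _ _)) => //.
    exact: measurable_funD.
  - by move=> x _; rewrite lee_fin; apply: ndW; rewrite addr_ge0// ltW.
rewrite !RintE//; apply: le_trans (pq _ _) _.
rewrite /enorm big_ord0 sqrtr0 mul0r -expr2; apply: ler_wpM2r.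
  exact: sqr_ge0.
by rewrite lerXn2r ?nnegrE// (le_trans _ WK0).
Qed.

Theorem localization n W (M k e K : R) (p q psi : 'rV[R]_n -> R) :
  {homo W : x y / x <= y} -> (forall r, 0 <= W r) -> 0 < e -> 0 <= k ->
  (\int[normal_prob 0 1]_r (W (`|r| + e))%:E <= K%:E)%E ->
  admissible W M k p q psi ->
  Rint p * Rint q <= K ^+ 2 * Rint psi ^+ 2.
Proof.
case: n p q psi => [|n] p q psi ndW W0 e0 k0; first exact: localization_point.
elim: n W M k e K p q psi ndW W0 e0 k0 => [|n IH] W M k e K p q psi ndW W0 e0 k0.
  exact: localization_line.
exact: localization_step.
Qed.

End localization.

(** * Removing the shift of the weight *)

Section shift_limit.
Context {R : realType}.
Local Notation leb := (@lebesgue_measure R).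
Local Notation gauss := (@normal_pdf R 0 1).
Variables (W : R -> R) (M : R).
Hypotheses (ndW : {homo W : x y / x <= y}) (W0M : forall r, 0 <= W r <= M).

Let W0 r : 0 <= W r. Proof. by have /andP[] := W0M r. Qed.

Let measurable_W_shift (e : R) : measurable_fun setT (fun r : R => W (`|r| + e)).
Proof.
apply: (measurableT_comp (nondecreasing_measurable _ _)) => //.
exact: measurable_funD.
Qed.

Let measurable_W_norm : measurable_fun setT (fun r : R => W `|r|).
Proof. exact: (measurableT_comp (nondecreasing_measurable _ _)). Qed.

Let gauss_shift (e s : R) : 0 <= e -> gauss (s - e) <= expR (e * s) * gauss s.
Proof.
move=> e0; rewrite !gaussE mulrCA; apply: ler_wpM2l.
  exact: normal_peak_ge0.
rewrite -expRD ler_expR; have := sqr_ge0 e; lra.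
Qed.

Let gaussN (s : R) : gauss (- s) = gauss s.
Proof. by rewrite !gaussE sqrrN. Qed.

(* Moving mass away from the origin by [e] multiplies the Gaussian density by
   at most [expR (e * `|s|)]. *)
Lemma integral_W_shift_le (e : R) : 0 < e ->
  (\int[normal_prob 0 1]_r (W (`|r| + e))%:E <=
   \int[leb]_s (W `|s| * (expR (e * `|s|) * gauss s))%:E)%E.
Proof.
move=> e0.
(* The parts [0 <= r] and [r < 0] of the integral, after the substitutions [s = r + e] and
   [s = r - e]; both make |s| equal to |r| + e. *)
pose G1 s := if e <= s then W `|s| * gauss (s - e) else 0.
pose G2 s := if s < - e then W `|s| * gauss (s + e) else 0.
have mg := @measurable_normal_pdf R 0 1.
have g0 s : 0 <= gauss s by exact: normal_pdf_ge0.
have mG1 : measurable_fun setT G1.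
  apply: measurable_fun_ifT => //; first exact: measurable_fun_ler.
  apply: measurable_funM => //; apply: (measurableT_comp mg).
  exact: measurable_funB.
have mG2 : measurable_fun setT G2.
  apply: measurable_fun_ifT => //; first exact: measurable_fun_ltr.
  apply: measurable_funM => //; apply: (measurableT_comp mg).
  exact: measurable_funD.
have G10 s : 0 <= G1 s by rewrite /G1; case: ifP => // _; exact: mulr_ge0.
have G20 s : 0 <= G2 s by rewrite /G2; case: ifP => // _; exact: mulr_ge0.
have mE (G : R -> R) : measurable_fun setT G -> measurable_fun setT (EFin \o G).
  by move=> mG; exact/measurable_EFinP.
rewrite integral_normal_prob01//; last 2 first.
- exact/measurable_EFinP.
- by move=> x; rewrite lee_fin.
have -> : (\int[leb]_r ((W (`|r| + e)%R)%:E * (gauss r)%:E) =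
    \int[leb]_r ((G1 (r + e)%R)%:E + (G2 (r - e)%R)%:E))%E.
  apply: eq_integral => r _; rewrite -EFinM -EFinD; congr EFin.
  rewrite /G1 /G2 lerDr ltrBlDr addNr addrK subrK; case: (leP 0 r) => r0.
    by rewrite addr0 !ger0_norm ?addr_ge0// ltW.
  rewrite add0r ltr0_norm// ltr0_norm; first by rewrite opprB addrC.
  lra.
have mG1s : measurable_fun setT (fun r : R => (G1 (r + e))%:E : \bar R).
  by apply/measurable_EFinP; apply: (measurableT_comp mG1); exact: measurable_funD.
have mG2s : measurable_fun setT (fun r : R => (G2 (r - e))%:E : \bar R).
  by apply/measurable_EFinP; apply: (measurableT_comp mG2); exact: measurable_funB.
rewrite ge0_integralD//=; try by move=> x _; rewrite lee_fin.
rewrite (@ge0_integral_shift _ (EFin \o G1) e (mE _ mG1)); last first.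
  by move=> x; rewrite lee_fin.
rewrite (@ge0_integral_shift _ (EFin \o G2) (- e) (mE _ mG2)); last first.
  by move=> x; rewrite lee_fin.
rewrite -ge0_integralD//=; try by [move=> x _; rewrite lee_fin|exact: mE].
apply: ge0_le_integral => //=.
- by move=> s _; rewrite -EFinD lee_fin addr_ge0.
- by apply: emeasurable_funD; exact: mE.
- apply/measurable_EFinP; apply: measurable_funM => //.
  apply: measurable_funM => //; apply: measurableT_comp => //.
  exact: measurable_funM.
- move=> s _; rewrite -EFinD lee_fin /G1 /G2.
  have rhs0 : 0 <= W `|s| * (expR (e * `|s|) * gauss s).
    by rewrite !mulr_ge0 ?expR_ge0.
  have [es|es] := leP e s; have [se|se] := ltP s (- e);
    rewrite ?addr0 ?add0r//; first lra.
    apply: ler_wpM2l => //; rewrite ger0_norm; last lra.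
    by apply: gauss_shift; exact: ltW.
  apply: ler_wpM2l => //; rewrite ltr0_norm; last lra.
  by rewrite -(gaussN s) -gaussN opprD; apply: gauss_shift; exact: ltW.
Qed.

(** Half of the Gaussian exponent absorbs the factor exp |s|; what remains is proportional to the
    Gaussian density of variance 2, and the peaks only adjust the constant. *)
Let dominator (s : R) := M * (expR 1 * (@normal_peak R 1 / @normal_peak R (Num.sqrt 2)) *
  normal_pdf 0 (Num.sqrt 2) s).

Let sqrt2_neq0 : Num.sqrt 2 != 0 :> R.
Proof. by rewrite gt_eqF// sqrtr_gt0. Qed.

(* [`|s| <= 1 + s ^+ 2 / 4] *)
Let dominatorP (e s : R) : 0 <= e <= 1 ->
  `|W `|s| * (expR (e * `|s|) * gauss s)| <= dominator s.
Proof.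
move=> /andP[e0 e1]; have g0 : 0 <= gauss s by exact: normal_pdf_ge0.
have /andP[w0 wM] := W0M `|s|.
rewrite ger0_norm ?mulr_ge0 ?expR_ge0//; apply: ler_pM => //.
  by rewrite mulr_ge0 ?expR_ge0.
rewrite gaussE normal_pdfE// /normal_fun subr0.
have pk1 : 0 < @normal_peak R 1 by apply: normal_peak_gt0; exact: oner_neq0.
have pk2 : 0 < @normal_peak R (Num.sqrt 2) by exact: normal_peak_gt0.
rewrite sqr_sqrtr//.
have -> : - s ^+ 2 / (2 *+ 2) = - s ^+ 2 / 4 by rewrite -mulr_natr; field.
set c1 := normal_peak 1; set c2 := normal_peak _.
have -> : expR 1 * (c1 / c2) * (c2 * expR (- s ^+ 2 / 4)) =
  c1 * (expR 1 * expR (- s ^+ 2 / 4)).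
  by field; rewrite gt_eqF.
rewrite mulrCA; apply: ler_wpM2l; first exact: ltW.
rewrite -!expRD ler_expR -(real_normK (num_real s)).
have s0 := normr_ge0 s; have := sqr_ge0 (`|s| - 2); nra.
Qed.

(** [W] may jump, so its shift need not converge at every point. With the shift carried by the
    Gaussian factor, the integrand converges everywhere, and dominated convergence applies along
    [e = j.+1%:R^-1]. *)
Lemma integral_W_shift_limit (d : R) : 0 < d -> exists2 e : R, 0 < e &
  (\int[normal_prob 0 1]_r (W (`|r| + e))%:E <=
   \int[normal_prob 0 1]_r (W `|r|)%:E + d%:E)%E.
Proof.
move=> d0.
pose F j (s : R) := (W `|s| * (expR (j.+1%:R^-1 * `|s|) * gauss s))%:E : \bar R.
have mg := @measurable_normal_pdf R 0 1.
have g0 s : 0 <= gauss s by exact: normal_pdf_ge0.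
have [|||||int_lim _ lim] := @dominated_convergence _ _ R leb setT measurableT F
    (fun s => (W `|s| * gauss s)%:E) (EFin \o dominator).
- move=> j; apply/measurable_EFinP; apply: measurable_funM => //.
  apply: measurable_funM => //; apply: measurableT_comp => //.
  exact: measurable_funM.
- by apply/measurable_EFinP; exact: measurable_funM.
- apply: aeW => s _; apply: cvg_EFin; first exact: nearW.
  have c0 : (j.+1%:R^-1 * `|s| : R) @[j --> \oo] --> 0 * `|s|.
    by apply: cvgMl; exact: (@cvg_harmonic R).
  have := continuous_cvg _ (@continuous_expR R (0 * `|s|)) c0.
  rewrite mul0r expR0 => c1; apply: cvgMr.
  by rewrite -[X in _ --> X]mul1r; apply: cvgMl; exact: c1.
- set c := M * (expR 1 * (@normal_peak R 1 / @normal_peak R (Num.sqrt 2))).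
  rewrite (_ : EFin \o dominator =
      fun s => c%:E * (normal_pdf 0 (Num.sqrt 2) s)%:E)%E; last first.
    by apply/funext => s; rewrite /dominator /= mulrA EFinM.
  by apply: integrableZl => //; exact: integrable_normal_pdf.
- apply: aeW => s j _; rewrite lee_fin; apply: dominatorP.
  by rewrite invr_ge0 ler0n/= invf_le1// ler1n.
have intE : (\int[normal_prob 0 1]_r (W `|r|)%:E =
    \int[leb]_s (W `|s| * gauss s)%:E)%E.
  rewrite integral_normal_prob01//.
  - exact/measurable_EFinP.
  - by move=> s; rewrite lee_fin.
have fin : (\int[leb]_s (W `|s| * gauss s)%:E \is a fin_num)%E.
  exact: integrable_fin_num int_lim.
have /fine_cvgP[fin_near] : (\int[leb]_s F j s)%E @[j --> \oo] -->
    (fine (\int[leb]_s (W `|s| * gauss s)%:E))%:E by rewrite fineK.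
move=> /cvgrPdist_lt/(_ _ d0) near_d.
have [N _ NP] := filterI fin_near near_d.
have [finN dN] := NP N (leqnn N).
exists N.+1%:R^-1; first by rewrite invr_gt0 ltr0n.
apply: le_trans (integral_W_shift_le _) _; first by rewrite invr_gt0 ltr0n.
rewrite intE -(fineK fin) -EFinD -[leLHS](fineK finN) lee_fin.
by move: dN; rewrite ltr_distl => /andP[h1 h2]; rewrite /= in h1 h2 *; lra.
Qed.

End shift_limit.

(** * Truncation and the theorem *)

Section truncation.
Context {R : realType}.
Local Notation lebn := (lebesgue_rV R).

Theorem localization_sharp n W (M L k K : R) (p q psi : 'rV[R]_n -> R) :
  {homo W : x y / x <= y} -> (forall r, 0 <= W r <= L) -> 0 <= k ->
  (\int[normal_prob 0 1]_r (W `|r|)%:E <= K%:E)%E ->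
  admissible W M k p q psi ->
  Rint p * Rint q <= K ^+ 2 * Rint psi ^+ 2.
Proof.
move=> ndW W0L k0 WK adm.
have W0 r : 0 <= W r by have /andP[] := W0L r.
have K0 : 0 <= K.
  by rewrite -lee_fin; apply: le_trans WK; apply: integral_ge0 => x _; rewrite lee_fin.
set Z := Rint psi ^+ 2; have Z0 : 0 <= Z by exact: sqr_ge0.
apply/ler_addgt0Pr => e e0.
(* For [d <= 1] one has [(K + d) ^+ 2 - K ^+ 2 <= d * (2 * K + 1)]; the last [+ 1] keeps the
   denominator positive when [Z = 0]. *)
pose d := Num.min 1 (e / ((2 * K + 1) * Z + 1)).
have D0 : 0 < (2 * K + 1) * Z + 1.
  by apply: ltr_wpDl => //; apply: mulr_ge0 => //; lra.
have d0 : 0 < d by rewrite lt_min ltr01 divr_gt0.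
have d1 : d <= 1 by rewrite ge_min lexx.
have de : d * ((2 * K + 1) * Z + 1) <= e.
  by rewrite -ler_pdivlMr// ge_min lexx orbT.
have [h h0 Wh] := integral_W_shift_limit ndW W0L d0.
have WKd : (\int[normal_prob 0 1]_r (W (`|r| + h))%:E <= (K + d)%:E)%E.
  by apply: le_trans Wh _; rewrite EFinD leeD2r.
have := localization ndW W0 h0 k0 WKd adm; rewrite -/Z => /le_trans; apply.
apply: (@le_trans _ _ (K ^+ 2 * Z + d * ((2 * K + 1) * Z))).
  rewrite (_ : (K + d) ^+ 2 * Z = K ^+ 2 * Z + d * ((2 * K + d) * Z)); last by ring.
  by rewrite lerD2l ler_pM2l// ler_wpM2r// lerD2l.
by rewrite lerD2l; apply: le_trans de; rewrite ler_pM2l// lerDl.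
Qed.

Lemma gaussian_pdf_interpolate n (x y : 'rV[R]_n) t : 0 < t < 1 ->
  gaussian_pdf x `^ (1 - t) * gaussian_pdf y `^ t *
    expR (t * (1 - t) / 2 * enorm (x - y) ^+ 2) =
  gaussian_pdf ((1 - t) *: x + t *: y).
Proof.
move=> /andP[t0 t1]; rewrite /gaussian_pdf.
have : 0 < (2 * pi : R) `^ (- (n%:R / 2)) by rewrite powR_gt0// mulr_gt0// pi_gt0.
move: (_ `^ _) => c c0.
rewrite !powRM ?expR_ge0 ?ltW// -!expRM.
have cE : c = c `^ (1 - t) * c `^ t.
  by rewrite -powRD ?subrK ?powRr1 ?ltW// gt_eqF ?implybT.
rewrite [in RHS]cE mulrACA -!mulrA; congr (_ * (_ * _)).
rewrite -!expRD; congr expR.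
have nE : enorm ((1 - t) *: x + t *: y) ^+ 2 =
    (1 - t) * enorm x ^+ 2 + t * enorm y ^+ 2 - t * (1 - t) * enorm (x - y) ^+ 2.
  rewrite !enorm_sqr !mulr_sumr -sumrN -!big_split/=.
  by apply: eq_bigr => i _; rewrite !mxE; ring.
by lra.
Qed.

Lemma gaussian_pdf_le n (x : 'rV[R]_n) : gaussian_pdf x <= (2 * pi) `^ (- (n%:R / 2)).
Proof.
rewrite /gaussian_pdf -[leRHS]mulr1; apply: ler_wpM2l; first exact: powR_ge0.
by rewrite -(@expR0 R) ler_expR oppr_le0 divr_ge0// sqr_ge0.
Qed.

(** * Truncated densities and weights *)

Section truncated.
Variables (n : nat) (phi f g : 'rV[R]_n -> R) (W : R -> R).
Hypotheses (lcphi : log_concave phi) (mphi : measurable_fun setT phi).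
Hypotheses (mf : measurable_fun setT f) (f0 : forall x, 0 <= f x).
Hypotheses (mg : measurable_fun setT g) (g0 : forall x, 0 <= g x).
Hypotheses (ndW : {homo W : x y / x <= y}) (W0 : forall r, 0 <= W r).
Hypothesis fgW : forall x y, f x * g y <= W (enorm (x - y) / 2) ^+ 2.

Let phi0 x : 0 <= phi x. Proof. exact: lcphi.1. Qed.

Definition box (j : nat) (x : 'rV[R]_n) : bool := [forall i, `|x 0 i| <= j%:R].

(** The cap is put on [phi], not on the whole density: the minimum of a log-concave function and a
    constant is log-concave, and the Gaussian factor keeps the strong part. The box is convex. *)
Definition trunc_density (j : nat) : 'rV[R]_n -> R :=
  restr (box j) (fun x => Num.min (phi x) j%:R * gaussian_pdf x).

Definition trunc_weighted (u : 'rV[R]_n -> R) (j : nat) (x : 'rV[R]_n) : R :=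
  Num.min (u x) j%:R * trunc_density j x.

Let min0 (r : R) j : 0 <= r -> 0 <= Num.min r j%:R.
Proof. by move=> r0; rewrite le_min r0 ler0n. Qed.

Lemma trunc_density_ge0 j x : 0 <= trunc_density j x.
Proof.
by rewrite /trunc_density /restr; case: ifP => // _; rewrite mulr_ge0 ?min0 ?gaussian_pdf_ge0.
Qed.

Lemma trunc_density_slc j : slc (trunc_density j).
Proof.
apply: slc_restr.
- by move=> x; rewrite mulr_ge0 ?min0 ?gaussian_pdf_ge0.
- move=> x y t /andP[t0 t1] /forallP xj /forallP yj; apply/forallP => i.
  rewrite !mxE; apply: le_trans (ler_normD _ _) _; rewrite !normrM.
  rewrite (gtr0_norm t0) gtr0_norm ?subr_gt0//.
  have h1 : (1 - t) * `|x 0 i| <= (1 - t) * j%:R by rewrite ler_pM2l ?subr_gt0.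
  have h2 : t * `|y 0 i| <= t * j%:R by rewrite ler_pM2l.
  by move: h1 h2; lra.
- move=> x y t t01; have /andP[t0 t1] := t01.
  rewrite (@powRM _ _ (gaussian_pdf x)) ?min0 ?gaussian_pdf_ge0//.
  rewrite (@powRM _ _ (gaussian_pdf y)) ?min0 ?gaussian_pdf_ge0//.
  rewrite mulrACA -[leLHS]mulrA.
  rewrite gaussian_pdf_interpolate//; apply: ler_wpM2r; first exact: gaussian_pdf_ge0.
  rewrite le_min; apply/andP; split.
    apply: le_trans (lcphi.2 x y t t01); apply: ler_pM; rewrite ?powR_ge0//.
      by apply: ge0_ler_powR; rewrite ?nnegrE ?min0 ?subr_ge0 ?(ltW t1)// ge_min lexx.
    by apply: ge0_ler_powR; rewrite ?nnegrE ?min0 ?(ltW t0)// ge_min lexx.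
  have jE : j%:R = j%:R `^ (1 - t) * j%:R `^ t :> R.
    by rewrite -powRD ?subrK ?powRr1// oner_eq0.
  rewrite [leRHS]jE; apply: ler_pM; rewrite ?powR_ge0//.
    by apply: ge0_ler_powR; rewrite ?nnegrE ?min0 ?subr_ge0 ?(ltW t1)// ge_min lexx orbT.
  by apply: ge0_ler_powR; rewrite ?nnegrE ?min0 ?(ltW t0)// ge_min lexx orbT.
Qed.

Lemma measurable_trunc_density j : measurable_fun setT (trunc_density j).
Proof.
apply: measurable_fun_ifT => //.
  apply: (measurable_fun_bool true).
  rewrite [X in measurable X](_ : _ =
      [set v : 'rV[R]_n | forall i, `[- j%:R, j%:R]%classic (v 0 i)]).
    by apply: (@measurable_box R n (fun=> `[- j%:R, j%:R]%classic)) => i.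
  apply/seteqP; split => [v [_ /forallP vj] i|v vj].
    by have := vj i; rewrite ler_norml /= in_itv.
  by split=> //; apply/forallP => i; have := vj i; rewrite /= in_itv/= ler_norml.
apply: measurable_funM; last exact: measurable_gaussian_pdf.
exact: measurable_minr.
Qed.

Lemma measurable_trunc_weighted u j : measurable_fun setT u ->
  measurable_fun setT (trunc_weighted u j).
Proof.
move=> mu; apply: measurable_funM; last exact: measurable_trunc_density.
exact: measurable_minr.
Qed.

(** Capping [f], [g] and [W] at the same level keeps the hypothesis: either the cap of [W] is
    inactive, or both capped functions are at most [j%:R]. In the constant, [j%:R] bounds the ratios
    and [j%:R * c] the density. *)
Lemma admissible_trunc j : exists M,
  admissible (fun r => Num.min (W r) j%:R) M j%:R
    (trunc_weighted f j) (trunc_weighted g j) (trunc_density j).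
Proof.
pose c : R := (2 * pi) `^ (- (n%:R / 2)).
have c0 : 0 <= c by exact: powR_ge0.
have jc : 0 <= j%:R * c by rewrite mulr_ge0.
exists (j%:R + j%:R * c).
have dom (u : 'rV[R]_n -> R) x : (forall x, 0 <= u x) ->
    0 <= trunc_weighted u j x <= (j%:R + j%:R * c) * trunc_density j x.
  move=> u0; rewrite mulr_ge0 ?min0 ?trunc_density_ge0//=.
  apply: ler_wpM2r; first exact: trunc_density_ge0.
  by rewrite ge_min lerDl jc orbT.
split.
- exact: measurable_trunc_weighted.
- exact: measurable_trunc_weighted.
- exact: measurable_trunc_density.
- move=> x; rewrite trunc_density_ge0/= /trunc_density /restr; case: ifP => _.
    apply: (@le_trans _ _ (j%:R * c)); last by rewrite lerDr.
    apply: ler_pM; rewrite ?min0 ?gaussian_pdf_ge0// ?gaussian_pdf_le//.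
    by rewrite ge_min lexx orbT.
  by rewrite addr_ge0.
- move=> x; rewrite /trunc_density /restr; case: ifP; rewrite ?eqxx//.
  by move=> /forallP.
- exact: trunc_density_slc.
- by move=> x; exact: dom.
- by move=> x; exact: dom.
- move=> x y; rewrite /trunc_weighted mulrACA; apply: ler_wpM2r.
    by rewrite mulr_ge0 ?trunc_density_ge0.
  set w := W _; case: (leP w j%:R) => wj.
    apply: le_trans (fgW x y); apply: ler_pM; rewrite ?min0//.
      by rewrite ge_min lexx.
    by rewrite ge_min lexx.
  by rewrite expr2; apply: ler_pM; rewrite ?min0// ge_min lexx orbT.
Qed.

(** The truncated density has mass at most 1, so the squared mass in [localization_sharp]
    disappears. *)
Lemma trunc_product_le (K : R) j :
  (\int[lebn n]_x (phi x * gaussian_pdf x)%:E = 1)%E ->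
  (\int[normal_prob 0 1]_r (W `|r|)%:E <= K%:E)%E ->
  ((\int[lebn n]_x (trunc_weighted f j x)%:E) *
   (\int[lebn n]_x (trunc_weighted g j x)%:E) <= (K ^+ 2)%:E)%E.
Proof.
move=> phi1 WK; have [M adm] := admissible_trunc j.
rewrite (Rint_domE adm (dominated_adm_p adm)) (Rint_domE adm (dominated_adm_q adm)).
rewrite -EFinM lee_fin.
have mW : measurable_fun setT (fun r : R => W `|r|).
  exact: (measurableT_comp (nondecreasing_measurable _ _)).
have WKj : (\int[normal_prob 0 1]_r (Num.min (W `|r|) j%:R)%:E <= K%:E)%E.
  apply: le_trans WK; apply: ge0_le_integral => //=.
  - by move=> x _; rewrite lee_fin min0.
  - by apply/measurable_EFinP; exact: measurable_minr.
  - exact/measurable_EFinP.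
  - by move=> x _; rewrite lee_fin ge_min lexx.
have ndWj : {homo (fun r => Num.min (W r) j%:R) : x y / x <= y}.
  move=> x y /ndW xy; rewrite le_min !ge_min lexx orbT andbT.
  by rewrite xy.
have Wj r : 0 <= Num.min (W r) j%:R <= j%:R by rewrite min0//= ge_min lexx orbT.
have := localization_sharp ndWj Wj (ler0n _ j) WKj adm => /le_trans; apply.
rewrite -[leRHS]mulr1; apply: ler_wpM2l; first exact: sqr_ge0.
have Z0 : 0 <= Rint (trunc_density j) by apply: Rint_ge0; exact: trunc_density_ge0.
rewrite -(expr1n _ 2) lerXn2r ?nnegrE// -lee_fin -(Rint_psiE adm) -phi1.
apply: ge0_le_integral => //=.
- by move=> x _; rewrite lee_fin trunc_density_ge0.
- by apply/measurable_EFinP; exact: measurable_trunc_density.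
- apply/measurable_EFinP; apply: measurable_funM => //; exact: measurable_gaussian_pdf.
- move=> x _; rewrite lee_fin /trunc_density /restr; case: ifP => _.
    by apply: ler_wpM2r; rewrite ?gaussian_pdf_ge0// ge_min lexx.
  by rewrite mulr_ge0 ?gaussian_pdf_ge0.
Qed.

Lemma trunc_weighted_nondecreasing (u : 'rV[R]_n -> R) x : (forall x, 0 <= u x) ->
  {homo (fun j => trunc_weighted u j x) : i j / (i <= j)%N >-> i <= j}.
Proof.
move=> u0 i j ij; apply: ler_pM.
- exact: min0.
- exact: trunc_density_ge0.
- by rewrite le_min !ge_min lexx ler_nat ij orbT.
rewrite /trunc_density /restr; case: ifP => [/forallP xi|_]; last first.
  by case: ifP => // _; rewrite mulr_ge0 ?min0 ?gaussian_pdf_ge0.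
rewrite ifT; last first.
  by apply/forallP => l; apply: le_trans (xi l) _; rewrite ler_nat.
apply: ler_wpM2r; first exact: gaussian_pdf_ge0.
by rewrite le_min !ge_min lexx ler_nat ij orbT.
Qed.

Lemma cvg_trunc_weighted (u : 'rV[R]_n -> R) : measurable_fun setT u -> (forall x, 0 <= u x) ->
  (\int[lebn n]_x (trunc_weighted u j x)%:E @[j --> \oo] -->
   \int[lebn n]_x (u x * (phi x * gaussian_pdf x))%:E)%E.
Proof.
move=> mu u0.
have nd x : {homo (fun j => (trunc_weighted u j x)%:E) : i j / (i <= j)%N >-> (i <= j)%E}.
  by move=> i j ij; rewrite lee_fin; exact: trunc_weighted_nondecreasing.
rewrite [X in _ --> X](_ : _ =
  \int[lebn n]_x (limn (fun j => (trunc_weighted u j x)%:E)))%E.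
  apply: cvg_monotone_convergence => //.
  - by move=> j; apply/measurable_EFinP; exact: measurable_trunc_weighted.
  - by move=> j x _; rewrite lee_fin mulr_ge0 ?min0 ?trunc_density_ge0.
(* At a fixed point the truncations are eventually inactive, so the sequence is stationary. *)
apply: eq_integral => x _; apply/esym/cvg_lim => //; apply: cvg_near_cst.
have minE (r : R) : \forall j \near \oo, Num.min r j%:R = r.
  near=> j; apply/min_idPl; near: j; exact: nbhs_infty_ger.
have xbox : \forall j \near \oo, box j x.
  near=> j; apply/forallP => i; apply: (@le_trans _ _ (\sum_i `|x 0 i|)).
    by rewrite (bigD1 i)//= lerDl sumr_ge0.
  by near: j; exact: nbhs_infty_ger.
near=> j; rewrite /trunc_weighted /trunc_density /restr.
rewrite ifT; last by near: j.
congr (_ * (_ * _))%:E; near: j; exact: minE.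
Unshelve. all: by end_near. Qed.

End truncated.

Let cvg_le_div (F : nat -> \bar R) (B : \bar R) (e c : R) : 0 < e ->
  F @ \oo --> B -> (forall j, e%:E * F j <= c%:E)%E -> (B <= (e^-1 * c)%:E)%E.
Proof.
move=> e0 FB Fc; rewrite -(cvg_lim _ FB)//; apply: lime_le; first by apply/cvg_ex; exists B.
by apply: nearW => j; rewrite EFinM lee_pdivlMl.
Qed.

(** Multiplying the limits directly could meet [0 * +oo]. By monotonicity the bound holds for
    [E i * F j] with independent indices; if neither limit is 0, a positive [E i] makes [B] finite,
    and bounding all [E i] through [B] makes [A] finite. *)
Lemma lim_poweR_half_mul_le (E F : nat -> \bar R) (A B : \bar R) (K : R) :
  0 <= K -> (forall j, 0 <= E j)%E -> (forall j, 0 <= F j)%E ->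
  {homo E : i j / (i <= j)%N >-> (i <= j)%E} ->
  {homo F : i j / (i <= j)%N >-> (i <= j)%E} ->
  E @ \oo --> A -> F @ \oo --> B ->
  (forall j, E j * F j <= (K ^+ 2)%:E)%E -> (A `^ 2^-1 * B `^ 2^-1 <= K%:E)%E.
Proof.
move=> K0 E0 F0 ndE ndF EA FB EF.
have pos (G : nat -> \bar R) C : (forall j, 0 <= G j)%E -> G @ \oo --> C ->
    C != 0%E -> exists i, (0 < G i)%E.
  move=> G0 GC C0; apply: contrapT => /forallNP nG; move/eqP: C0; apply.
  have G_eq0 : G = fun=> 0%E.
    by apply/funext => i; apply/eqP; rewrite eq_le G0 andbT leNgt; apply/negP.
  by move: GC; rewrite G_eq0 => /(cvg_lim _) <-//; rewrite lim_cst.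
have h0 : 2^-1 != 0 :> R by rewrite invr_eq0 pnatr_eq0.
have [->|A0] := eqVneq A 0%E; first by rewrite poweR0r// mul0e lee_fin.
have [->|B0] := eqVneq B 0%E; first by rewrite poweR0r// mule0 lee_fin.
have EFij i j : (E i * F j <= (K ^+ 2)%:E)%E.
  apply: le_trans (EF (maxn i j)); apply: lee_pmul => //.
    by apply: ndE; exact: leq_maxl.
  by apply: ndF; exact: leq_maxr.
have [i0 Ei0] := pos _ _ E0 EA A0.
have [j0 Fj0] := pos _ _ F0 FB B0.
have finE i : exists2 e : R, 0 <= e & E i = e%:E.
  have := EFij i j0; move: (E0 i); case: (E i) => [e|//|//]; first by exists e.
  by rewrite gt0_mulye// leye_eq.
have [e _ ei0] := finE i0.
have e0 : 0 < e by move: Ei0; rewrite ei0.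
have BE : exists2 b : R, 0 < b & B = b%:E.
  have Bub : (B <= (e^-1 * K ^+ 2)%:E)%E.
    by apply: cvg_le_div e0 FB _ => j; rewrite -ei0.
  have Bge0 : (0 <= B)%E.
    rewrite -(cvg_lim _ FB)//; apply: lime_ge; last exact: nearW.
    by apply/cvg_ex; exists B.
  move: Bub Bge0 B0; case: B FB => [b _ _|//|//].
  by rewrite lee_fin => b0 bn0; exists b => //; rewrite lt0r -eqe bn0.
have [b b0 Bb] := BE.
have Aub : (A <= (b^-1 * K ^+ 2)%:E)%E.
  apply: cvg_le_div b0 EA _ => i; have [x x0 Ex] := finE i.
  rewrite Ex -EFinM lee_fin; move: x0; rewrite le_eqVlt => /predU1P[<-|x0].
    by rewrite mulr0 sqr_ge0.
  have : (B <= (x^-1 * K ^+ 2)%:E)%E.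
    by apply: cvg_le_div x0 FB _ => j; rewrite -Ex.
  by rewrite Bb lee_fin mulrC ler_pdivlMr.
have Age0 : (0 <= A)%E.
  rewrite -(cvg_lim _ EA)//; apply: lime_ge; last exact: nearW.
  by apply/cvg_ex; exists A.
case: A EA A0 Aub Age0 => [a| |]//= _ _; rewrite !lee_fin => ab a0.
rewrite Bb !poweR_EFin -EFinM lee_fin -powRM ?(ltW b0)//.
apply: powR_half_le => //; first by rewrite mulr_ge0 ?(ltW b0).
by move: ab; rewrite mulrC ler_pdivlMr.
Qed.

End truncation.

Theorem corollary1p7 (R : realType) (n : nat) (mu : probability 'rV[R]_n R)
    (mu_lc : log_concave_wrt_gaussian mu)
    (f g : 'rV[R]_n -> R) (W : R -> R)
    (f_meas : measurable_fun setT f) (f_ge0 : forall x, 0 <= f x)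
    (g_meas : measurable_fun setT g) (g_ge0 : forall x, 0 <= g x)
    (W_meas : measurable_fun (`[0, +oo[ : set R) W)
    (W_gt0 : forall r, 0 <= r -> 0 < W r)
    (W_nondecr : forall r s, 0 <= r -> r <= s -> W r <= W s)
    (fgW : forall x y, f x `^ 2^-1 * g y `^ 2^-1 <= W (enorm (x - y) / 2)) :
  ((\int[mu]_x (f x)%:E) `^ 2^-1 * (\int[mu]_x (g x)%:E) `^ 2^-1 <=
   \int[normal_prob 0 1]_r (W `|r|)%:E)%E.
Proof.
have [phi [lcphi mphi muE]] := mu_lc.
have phi0 x : 0 <= phi x by exact: lcphi.1.
(* Two successive densities: [phi] relative to [gaussian], then [gaussian_pdf] relative to Lebesgue
   measure. *)
have int_mu (u : 'rV[R]_n -> R) : measurable_fun setT u -> (forall x, 0 <= u x) ->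
    (\int[mu]_x (u x)%:E =
     \int[lebesgue_rV R n]_x (u x * (phi x * gaussian_pdf x))%:E)%E.
  move=> mu_ u0.
  have mE : measurable_fun setT (EFin \o u) by exact/measurable_EFinP.
  have uE x : (0 <= (EFin \o u) x)%E by rewrite lee_fin.
  have mE' : measurable_fun setT (fun x => ((EFin \o u) x * (phi x)%:E)%E).
    by apply: emeasurable_funM => //; exact/measurable_EFinP.
  apply: etrans (ge0_integral_density mphi phi0 muE mE uE) _.
  apply: etrans (@ge0_integral_density _ _ _ (lebesgue_rV R n) _
    (@measurable_gaussian_pdf R n) (@gaussian_pdf_ge0 R n) (gaussian R n) _ _ mE' _) _.
  - by [].
  - by move=> x; rewrite -EFinM lee_fin mulr_ge0.
  - by apply: eq_integral => x _; rewrite -!EFinM mulrA.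
have phi1 : (\int[lebesgue_rV R n]_x (phi x * gaussian_pdf x)%:E = 1)%E.
  rewrite -(@probability_setT _ _ _ mu) -[RHS]mul1e -integral_cst//.
  rewrite (int_mu (cst 1))//.
  by apply: eq_integral => x _; rewrite mul1r.
(* [W] is constrained on the half-line only; extending it to the left by [W 0] gives a function
   monotone and nonnegative on all of [R], as the lemmas above require. *)
pose V r := W (Num.max r 0).
have V0 r : 0 <= V r by apply/ltW/W_gt0; rewrite le_max lexx orbT.
have ndV : {homo V : x y / x <= y}.
  move=> x y xy; apply: W_nondecr; first by rewrite le_max lexx orbT.
  by rewrite ge_max !le_max xy lexx orbT.
have VW r : 0 <= r -> V r = W r by move=> r0; rewrite /V max_l.
have fgV x y : f x * g y <= V (enorm (x - y) / 2) ^+ 2.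
  rewrite VW ?divr_ge0 ?enorm_ge0//.
  have := fgW x y; rewrite -powRM// powR12_sqrt ?mulr_ge0// => h.
  have s0 := sqrtr_ge0 (f x * g y).
  by rewrite -[leLHS](@sqr_sqrtr R) ?mulr_ge0// lerXn2r ?nnegrE// (le_trans s0).
have -> : (\int[normal_prob 0 1]_r (W `|r|)%:E = \int[normal_prob 0 1]_r (V `|r|)%:E)%E.
  by apply: eq_integral => x _; rewrite VW.
have K0 : (0 <= \int[normal_prob 0 1]_r (V `|r|)%:E)%E.
  by apply: integral_ge0 => x _; rewrite lee_fin.
have [->|Kfin] := eqVneq (\int[normal_prob 0 1]_r (V `|r|)%:E)%E +oo%E; first exact: leey.
have [K KE] : exists K : R, (\int[normal_prob 0 1]_r (V `|r|)%:E = K%:E)%E.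
  exists (fine (\int[normal_prob 0 1]_r (V `|r|)%:E)%E); rewrite fineK//.
  by rewrite ge0_fin_numE// ltey.
rewrite KE; rewrite KE lee_fin in K0.
rewrite (int_mu f)// (int_mu g)//.
set A := (\int[_]_x _)%E; set B := (\int[_]_x _)%E.
have tw0 (u : 'rV[R]_n -> R) j x : (forall x, 0 <= u x) -> 0 <= trunc_weighted phi u j x.
  by move=> u0; rewrite mulr_ge0 ?le_min ?u0 ?ler0n// trunc_density_ge0.
have nd (u : 'rV[R]_n -> R) : measurable_fun setT u -> (forall x, 0 <= u x) ->
    {homo (fun j => \int[lebesgue_rV R n]_x (trunc_weighted phi u j x)%:E)%E :
      i j / (i <= j)%N >-> (i <= j)%E}.
  move=> mu_ u0 i j ij; apply: ge0_le_integral => //=.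
  - by move=> x _; rewrite lee_fin tw0.
  - by apply/measurable_EFinP; exact: measurable_trunc_weighted.
  - by apply/measurable_EFinP; exact: measurable_trunc_weighted.
  - by move=> x _; rewrite lee_fin; exact: trunc_weighted_nondecreasing.
apply: (lim_poweR_half_mul_le K0 _ _ (nd f f_meas f_ge0) (nd g g_meas g_ge0)
  (cvg_trunc_weighted lcphi mphi f_meas f_ge0)
  (cvg_trunc_weighted lcphi mphi g_meas g_ge0)).
- by move=> j; apply: integral_ge0 => x _; rewrite lee_fin tw0.
- by move=> j; apply: integral_ge0 => x _; rewrite lee_fin tw0.
- by move=> j; apply: (trunc_product_le (W := V)) => //; rewrite KE.
Qed.
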